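(* There exist positive integers $\upsilon_n$ ($n\ge 3$), $\upsilon_n$ depending only on $n$, such that for every $n\ge 3$ and every $m\in\mathbb{N}$: (1) any element of $EL_n(R_m)$ can be written as a product of at most $\upsilon_n$ matrices from $X_n(m)$; (2) any element of $\Gamma_n(m)$ can be written as a product of at most $2\upsilon_3+n^3$ matrices from $X_n^c(m)$.
   Context: $\mathbb{N}=\{1,2,\dots\}$. $X_{ij}(r)$ ($i\ne j$) is the $n\times n$ matrix with $1$ on the diagonal, $r$ in position $(i,j)$ and zero elsewhere. $R_m=m\mathbb{Z}$; $EL_n(R_m)=\langle X_{ij}(r): r\in R_m,\ 1\le i\ne j\le n\rangle$; $\Gamma_n(m)=\{g\in SL_n(\mathbb{Z}): g\equiv I \bmod m\}$. $X_n(m)=\{X_{ij}(r): r\in m\mathbb{Z},\ 1\le i\neq j\le n\}$ is the set of all elementary matrices in $SL_n(\mathbb{Z})$ with all off-diagonal entries divisible by $m$. $y_n=I-\sum_{i=1}^{n-1}E_{i+1,i}$, where $E_{ij}$ is the matrix unit with entry $1$ at $(i,j)$. For $A\subset SL_n(\mathbb{Z})$ and $g\in SL_n(\mathbb{Z})$, $A^g=\{g^{-1}ag:a\in A\}$. $X_n^c(m)=X_n(m)\cup X_n(m)^{y_n}$. *)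

(* Defs.v *)
From mathcomp Require Import all_boot all_order all_algebra.
Set Implicit Arguments.
Unset Strict Implicit.
Unset Printing Implicit Defensive.
Import Order.TTheory GRing.Theory Num.Theory.
Local Open Scope ring_scope.

Definition mxset (n : nat) := 'M[int]_n -> Prop.

Definition elem_mx (n : nat) (i j : 'I_n) (r : int) : 'M[int]_n :=
  1%:M + r *: delta_mx i j.

Definition in_SL (n : nat) : mxset n := fun g => \det g = 1.

Definition X_set (n m : nat) : mxset n := fun A =>
  exists (i j : 'I_n) (r : int),
    [/\ i != j, (m%:Z %| r)%Z & A = elem_mx i j r].

(* Every generator used below is invertible, so that invmx is the genuine
   inverse throughout. *)
Inductive gen_subgroup (n : nat) (S : mxset n) : mxset n :=
| gen_base A : S A -> gen_subgroup S A
| gen_one : gen_subgroup S 1%:M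
| gen_mul A B : gen_subgroup S A -> gen_subgroup S B -> gen_subgroup S (A *m B)
| gen_inv A : gen_subgroup S A -> gen_subgroup S (invmx A).

Definition EL (n m : nat) : mxset n := gen_subgroup (@X_set n m).

Definition Gamma (n m : nat) : mxset n := fun g =>
  in_SL g /\
  forall i j : 'I_n, (g i j = (1%:M : 'M[int]_n) i j %[mod m%:Z])%Z.

(* The shift by one of the row index is the same for 'I_n (based at 0) as for
   indices in {1, ..., n}. *)
Definition y_mx (n : nat) : 'M[int]_n :=
  1%:M - \sum_(p : 'I_n * 'I_n | p.1 == p.2.+1 :> nat) delta_mx p.1 p.2.

Definition conj_set (n : nat) (S : mxset n) (g : 'M[int]_n) : mxset n :=
  fun B => exists2 A, S A & B = invmx g *m A *m g.

Definition Xc_set (n m : nat) : mxset n := fun A =>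
  X_set m A \/ conj_set (@X_set n m) (y_mx n) A.

Definition prod_of_at_most (n k : nat) (S : mxset n) (A : 'M[int]_n) : Prop :=
  exists s : seq 'M[int]_n,
    [/\ (size s <= k)%N,
        forall B, B \in s -> S B
      & A = \big[mulmx/1%:M]_(B <- s) B].

(* Main.v *)
Require Import Defs.
From HB Require Import structures.
From mathcomp Require Import all_boot all_order all_algebra.
From mathcomp Require Import cyclic ring lra zify.
From mathcomp Require Import boolp classical_sets reals exp Rstruct.
From Stdlib Require Rdefinitions.
Set Implicit Arguments.
Unset Strict Implicit.
Unset Printing Implicit Defensive.
Import Order.TTheory GRing.Theory Num.Theory.

(* Bounded elementary operations bring a matrix of [EL_n(m)], whose diagonal is 1
   modulo [m^2], down to a 2 x 2 block [[a, m b], [m c, d]] inside SL_3; for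
   [Gamma_n(m)] one first makes the diagonal 1 modulo [m^2] with [n - 1] conjugated
   generators.  Inside SL_3 the class of the block up to boundedly many factors is a
   Mennicke symbol of [(a, b)], multiplicative in [b] (Mennicke's trick).  Following
   Carter and Keller, write [A^N = x A + y] by Cayley-Hamilton; [x] factors as a
   product of two polynomials in the trace, modulo which the symbol is explicit, so
   [A^N] is short as soon as [a^N = 1] modulo [m^2 b], and by transposition as soon as
   [a^N = 1] modulo [m^2 c].  Dirichlet's theorem makes [- b] a prime p with
   [(p - 1) / 2] odd, and then [c] a prime p' with [p' - 1] prime to [(p - 1) / 2]; so
   [A] is the quotient of two short powers, uniformly in [m].

   Dirichlet's theorem is proved with real functions on (Z/N)^* instead of characters.
   Convolution with [n |-> 1/n] gives an operator L on the functions of mean zero.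
   Sums of [Lambda(d)/d] against the image of L are bounded, and against a function [v]
   in the kernel of L they are [- v ln x + O(1)]; evaluating where |v| is maximal
   forces the primes into the classes where [v] takes the opposite value, hence
   [v] is a real character [w], which is ruled out by the positivity of the divisor
   sums of [w].  So L is invertible, and [Lambda(d)/d] has unbounded sums on every
   class prime to N. *)

(** * Dirichlet's theorem on primes in arithmetic progressions *)

(** The level is [m ^ 2] because the off-diagonal entries of a block carry a factor [m]: an
    elementary operation with multiplier [m t] changes [a] by [m ^ 2 t b]. The obstacle is
    uniformity in [m]: writing A as a quotient of two short powers needs coprime exponents, while p
    - 1 and p' - 1 are both even. Hence the exponent (p - 1) / 2, which is odd because p = -1 modulo
    4; taking p' = -1 modulo (p - 1) / 2 makes p' - 1 congruent to -2, hence prime to it. The price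
    is a sign: a ^ ((p - 1) / 2) is only known to be 1 or -1 modulo p. The value -1 is absorbed by
    the symbol of (2 b - 1, b), which is short when b = 1 modulo m ^ 2; this is why p is taken to be
    -1 modulo 4 m ^ 2. *)

Section Summation.
Variable R : realType.
Local Open Scope ring_scope.
Implicit Types (c h : nat -> R).

Lemma abel_bound c h (B : R) a b : (a <= b)%N ->
  (forall k, (a <= k)%N -> c k.+1 <= c k) -> (forall k, (a <= k)%N -> 0 <= c k) ->
  (forall k, (a <= k)%N -> `|\sum_(a <= i < k) h i| <= B) ->
  `|\sum_(a <= i < b) c i * h i| <= c a * B.
Proof.
move=> ab c_dec c_ge0 hB.
have B_ge0 : 0 <= B by apply: le_trans (hB a (leqnn a)); exact: normr_ge0.
(* Once the boundary term [c b] times the full sum is split off, the rest telescopes with the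
   increments [c k - c k.+1], and the induction on [b] closes. *)
suff key : `|\sum_(a <= i < b) c i * h i - c b * \sum_(a <= i < b) h i|
           <= (c a - c b) * B.
  have := ler_normD (\sum_(a <= i < b) c i * h i - c b * \sum_(a <= i < b) h i)
                    (c b * \sum_(a <= i < b) h i).
  rewrite subrK => /le_trans -> //.
  rewrite [X in _ <= X](_ : _ = (c a - c b) * B + c b * B); last by ring.
  by rewrite lerD // normrM (ger0_norm (c_ge0 _ ab)) ler_wpM2l // ?c_ge0 ?hB.
elim: b ab => [|b IHb] ab.
  by move: ab; rewrite leqn0 => /eqP ->; rewrite !big_geq // mulr0 !subrr mul0r normr0.
move: ab; rewrite leq_eqVlt => /predU1P[<-|ab].
  by rewrite !big_geq // mulr0 !subrr mul0r normr0.
rewrite !big_nat_recr //=; set S := \sum_(a <= i < b) _; set T := \sum_(a <= i < b) _.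
rewrite [X in `|X|](_ : _ = (S - c b * T) + (c b - c b.+1) * (T + h b)); last by ring.
apply: le_trans (ler_normD _ _) _.
rewrite [X in _ <= X](_ : _ = (c a - c b) * B + (c b - c b.+1) * B); last by ring.
rewrite lerD ?IHb // normrM ger0_norm ?subr_ge0 ?c_dec // ler_wpM2l ?subr_ge0 ?c_dec //.
by have := hB b.+1 (leqW ab); rewrite big_nat_recr.
Qed.

Lemma periodic_window h N a : (0 < N)%N -> (forall n, h (n + N)%N = h n) ->
  \sum_(a <= i < a + N) h i = \sum_(0 <= i < N) h i.
Proof.
move=> N_gt0 hN; elim: a => [//|a IHa].
have a_lt : (a < a + N)%N by lia.
rewrite -IHa addSn big_nat_recr //= hN (big_ltn a_lt); exact: addrC.
Qed.

(** Whole periods cancel, so fewer than [N] terms survive. *)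
Lemma periodic_sum_bound h N (M : R) a b : (0 < N)%N -> (forall n, h (n + N)%N = h n) ->
  \sum_(0 <= i < N) h i = 0 -> (forall n, `|h n| <= M) ->
  `|\sum_(a <= i < b) h i| <= M *+ N.
Proof.
move=> N_gt0 hN h0 hM.
have M_ge0 : 0 <= M by apply: le_trans (hM 0%N); exact: normr_ge0.
have [k] := ubnP (b - a)%N; elim: k a => [//|k IHk] a kba.
have [ba|ab] := leqP (a + N) b.
  rewrite (big_cat_nat (n := (a + N)%N)) ?leq_addr //= periodic_window // h0 add0r.
  by apply: IHk; lia.
apply: le_trans (ler_norm_sum _ _ _) _.
apply: le_trans (_ : \sum_(a <= i < b) M <= _); first exact: ler_sum.
rewrite sumr_const_nat -[_ *+ (b - a)]mulr_natr -[_ *+ N]mulr_natr ler_wpM2l // ler_nat; lia.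
Qed.

(** The intervals of radius [C / x.+1] around the [s x] meet pairwise, so the supremum of their left
    ends lies in all of them. The rate is kept because later estimates use it. *)
Lemma nested_limit (s : nat -> R) (C : R) :
  (forall x y, (x <= y)%N -> `|s y - s x| <= C / x.+1%:R) ->
  exists l, forall x, `|s x - l| <= C / x.+1%:R.
Proof.
move=> hs.
have C_ge0 x : 0 <= C / x.+1%:R by apply: le_trans (hs x x (leqnn x)).
have le_ub x y : s x - C / x.+1%:R <= s y + C / y.+1%:R.
  have [xy|/ltnW yx] := leqP x y.
    have := C_ge0 y; have := hs _ _ xy; rewrite ler_norml.
    by move: (C / _) (C / _) => u v /andP[]; lra.
  have := C_ge0 x; have := hs _ _ yx; rewrite ler_norml.
  by move: (C / _) (C / _) => u v /andP[]; lra.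
pose A : set R := [set z | exists x, z = s x - C / x.+1%:R]%classic.
have supA : has_sup A.
  split; first by exists (s 0%N - C / 1%:R), 0%N.
  by exists (s 0%N + C / 1%:R) => _ [x ->]; apply: le_ub.
exists (sup A) => x; rewrite ler_norml; apply/andP; split.
  suff : sup A <= s x + C / x.+1%:R by move: (C / _) => u; lra.
  by apply: ge_sup => [|_ [y ->]]; [case: supA | apply: le_ub].
suff : s x - C / x.+1%:R <= sup A by move: (C / _) => u; lra.
by apply: (ub_le_sup (proj2 supA)); exists x.
Qed.

Lemma limit_uniq (s : nat -> R) (l l' C C' : R) :
  (forall x, `|s x - l| <= C / x.+1%:R) -> (forall x, `|s x - l'| <= C' / x.+1%:R) -> l = l'.
Proof.
move=> hl hl'; apply/eqP/negPn/negP => ll'.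
have d_gt0 : 0 < `|l - l'| by rewrite normr_gt0 subr_eq0.
have [x hx] : exists x : nat, (C + C') / `|l - l'| < x%:R.
  exists (Num.bound `|(C + C') / `|l - l'| |).
  by apply: le_lt_trans (ler_norm _) (archi_boundP _).
have : `|l - l'| <= (C + C') / x.+1%:R.
  rewrite mulrDl; apply: le_trans (lerD (hl x) (hl' x)).
  by rewrite -(distrC l); apply: le_trans (ler_normD _ _); rewrite addrA subrK.
rewrite ler_pdivlMr ?ltr0n //; apply/negP; rewrite -ltNge.
move: hx; rewrite ltr_pdivrMr // mulrC => /lt_le_trans -> //.
by rewrite ler_pM2l // ler_nat.
Qed.

End Summation.

(** * Divisor sums and the Moebius function *)

Section DivisorSums.
Variable R : realType.
Local Open Scope ring_scope.

Lemma sum_nat_pick (a b j : nat) (G : nat -> R) :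
  \sum_(a <= i < b | j == i) G i = if (a <= j < b)%N then G j else 0.
Proof.
rewrite -big_filter; case: ifP => jab.
  rewrite (_ : filter _ _ = [:: j]) ?big_seq1 //.
  rewrite (eq_filter (a2 := pred1 j)) => [|i]; last by rewrite /= eq_sym.
  by rewrite filter_pred1_uniq ?iota_uniq // mem_index_iota.
rewrite big_filter big_nat_cond big1 // => i /andP[iab /eqP ji].
by rewrite -ji jab in iab.
Qed.

Lemma sum_multiples (G : nat -> R) d x : (0 < d)%N ->
  \sum_(1 <= n < x.+1 | (d %| n)%N) G n = \sum_(1 <= k < (x %/ d).+1) G (d * k)%N.
Proof.
move=> d_gt0; elim: x => [|x IHx]; first by rewrite div0n !big_geq.
rewrite big_mkcond big_nat_recr //= -big_mkcond IHx divnS //.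
case: ifPn => [dx|_]; last by rewrite addr0 add0n.
rewrite add1n [RHS]big_nat_recr //=; congr (_ + G _).
have := divnS x d_gt0; rewrite dx add1n => <-.
by rewrite mulnC divnK.
Qed.

Lemma sum_divisors_range (F : nat -> R) n y : (0 < n < y)%N ->
  \sum_(1 <= d < y | (d %| n)%N) F d = \sum_(d <- divisors n) F d.
Proof.
case/andP=> n_gt0 ny; rewrite -big_filter; apply: perm_big; apply: uniq_perm.
- by rewrite filter_uniq ?iota_uniq.
- exact: divisors_uniq.
move=> d; rewrite mem_filter mem_index_iota -dvdn_divisors //.
case: (boolP (d %| n)%N) => //= dn.
by rewrite (dvdn_gt0 n_gt0 dn) (leq_ltn_trans (dvdn_leq n_gt0 dn) ny).
Qed.

Lemma sum_divisors_sum (F : nat -> nat -> R) x :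
  \sum_(1 <= n < x.+1) \sum_(d <- divisors n) F d (n %/ d)%N
  = \sum_(1 <= d < x.+1) \sum_(1 <= k < (x %/ d).+1) F d k.
Proof.
rewrite [LHS](_ : _ = \sum_(1 <= n < x.+1) \sum_(1 <= d < x.+1 | (d %| n)%N) F d (n %/ d)%N).
  rewrite (exchange_big_dep xpredT) //=; apply: eq_big_nat => d /andP[d_gt0 _].
  rewrite sum_multiples //; apply: eq_bigr => k _; by rewrite mulKn.
apply: eq_big_nat => n /andP[n_gt0 nx].
by rewrite (sum_divisors_range (fun d => F d (n %/ d)%N)) ?n_gt0.
Qed.

Lemma sum_divisors_pfactor (F : nat -> R) p k m : prime p -> (0 < m)%N -> ~~ (p %| m)%N ->
  \sum_(d <- divisors (p ^ k * m)) F d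
  = \sum_(0 <= i < k.+1) \sum_(d <- divisors m) F (p ^ i * d)%N.
Proof.
move=> p_pr m_gt0 pm; have p_gt0 := prime_gt0 p_pr.
have n_gt0 : (0 < p ^ k * m)%N by rewrite muln_gt0 expn_gt0 p_gt0.
rewrite (perm_big [seq (p ^ i * d)%N | i <- index_iota 0 k.+1, d <- divisors m]).
  by rewrite big_allpairs_dep.
have ndiv d : d \in divisors m -> ~~ (p %| d)%N.
  by rewrite -dvdn_divisors // => dm; apply: contra pm => /dvdn_trans; apply.
have logE i d : d \in divisors m -> logn p (p ^ i * d) = i.
  move=> dm; have d_gt0 : (0 < d)%N.
    by move: dm; rewrite -dvdn_divisors //; apply: dvdn_gt0.
  have := ndiv _ dm; rewrite -prime_coprime // => /logn_coprime log0.
  by rewrite lognM ?expn_gt0 ?p_gt0 // pfactorK // log0 addn0.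
apply: uniq_perm; first exact: divisors_uniq.
  apply: allpairs_uniq; rewrite ?iota_uniq ?divisors_uniq //.
  move=> u v /allpairsPdep[i' [d' [_ hd ->]]] /allpairsPdep[j' [e' [_ he ->]]] /= eq_ij.
  have ij : i' = j' by rewrite -(logE i' d') // eq_ij logE.
  move: eq_ij; rewrite ij => /eqP; rewrite eqn_pmul2l ?expn_gt0 ?p_gt0 // => /eqP ->.
  by [].
move=> d; rewrite -dvdn_divisors //; apply/idP/allpairsPdep => [dn|[i [e []]]].
  have d_gt0 : (0 < d)%N := dvdn_gt0 n_gt0 dn.
  exists (logn p d), (d`_p^')%N; split; last by rewrite -p_part partnC.
    rewrite mem_index_iota /= ltnS -[k](logE k m) ?divisors_id //.
    exact: dvdn_leq_log.
  rewrite -dvdn_divisors //; apply: dvdn_trans (_ : (p ^ k * m)`_p^' %| _)%N.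
    exact: partn_dvd.
  rewrite partnM ?expn_gt0 ?p_gt0 //.
  rewrite (part_p'nat (pi := p^') (n := (p ^ k)%N)) ?mul1n ?dvdn_part //.
  by rewrite pnatNK pnatX pnat_id // orbT.
rewrite mem_index_iota /= ltnS -dvdn_divisors // => ik em ->.
exact: dvdn_mul (dvdn_exp2l _ ik) em.
Qed.

Definition moebius n : R := \prod_(p <- primes n) (if (p ^ 2 %| n)%N then 0 else -1).

Lemma moebius1 : moebius 1 = 1.
Proof. by rewrite /moebius big_nil. Qed.

Lemma moebius_norm n : `|moebius n| <= 1.
Proof.
rewrite /moebius normr_prod; elim: (primes n) => [|p s IHs]; first by rewrite big_nil.
rewrite big_cons mulr_ile1 ?normr_ge0 ?prodr_ge0 //.
by case: ifP; rewrite ?normr0 ?normrN1 ?ler01.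
Qed.

Lemma moebius_prime_mul p d : prime p -> (0 < d)%N -> ~~ (p %| d)%N ->
  moebius (p * d) = - moebius d.
Proof.
move=> p_pr d_gt0 pd; have p_gt0 := prime_gt0 p_pr.
rewrite /moebius (perm_big (p :: primes d)) /=; last first.
  apply: uniq_perm; rewrite ?primes_uniq //= ?primes_uniq ?andbT.
    by rewrite mem_primes negb_and negb_and pd !orbT.
  by move=> q; rewrite primesM // primes_prime // !inE.
rewrite big_cons ifF; last first.
  apply/negbTE; rewrite expnS expn1 dvdn_pmul2l //.
rewrite mulN1r; congr (- _); apply: eq_big_seq => q.
rewrite mem_primes => /and3P[q_pr _ qd].
rewrite Gauss_dvdr // coprimeXl // prime_coprime // dvdn_prime2 //.
by apply: contraNN pd => /eqP <-.
Qed.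

Lemma moebius_square p d : prime p -> (0 < d)%N -> (p ^ 2 %| d)%N -> moebius d = 0.
Proof.
move=> p_pr d_gt0 pd; rewrite /moebius (big_rem p) /= ?pd ?mul0r //.
by rewrite mem_primes p_pr d_gt0 (dvdn_trans _ pd) // dvdn_mulr.
Qed.

Lemma sum_moebius n : (0 < n)%N -> \sum_(d <- divisors n) moebius d = (n == 1%N)%:R.
Proof.
move=> n_gt0; have [->|n_neq1] := eqVneq n 1%N; first by rewrite big_seq1 moebius1.
have n_gt1 : (1 < n)%N by case: n n_gt0 n_neq1 => [|[]].
have p_pr := pdiv_prime n_gt1; set p := pdiv n in p_pr.
have [m pm nE] := pfactor_coprime p_pr n_gt0.
have m_gt0 : (0 < m)%N by move: n_gt0; rewrite nE muln_gt0 => /andP[].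
have pm' : ~~ (p %| m)%N by rewrite -prime_coprime.
have k_gt0 : (0 < logn p n)%N by rewrite logn_gt0 mem_primes p_pr n_gt0 pdiv_dvd.
rewrite nE mulnC sum_divisors_pfactor //; case: (logn p n) k_gt0 => // k _.
(* Only the exponents 0 and 1 of [p] give nonzero terms, and these two cancel. *)
rewrite big_ltn // big_ltn // [X in _ + (_ + X)]big_nat_cond [X in _ + (_ + X)]big1 ?addr0; last first.
  move=> i /andP[/andP[i2 _] _]; rewrite big_seq big1 // => d; rewrite -dvdn_divisors // => dm.
  apply: (moebius_square p_pr); last by rewrite dvdn_mulr // dvdn_exp2l.
  by rewrite muln_gt0 expn_gt0 prime_gt0 //= (dvdn_gt0 m_gt0 dm).
rewrite expn0 expn1 -big_split /= big_seq big1 // => d; rewrite -dvdn_divisors // => dm.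
rewrite mul1n moebius_prime_mul ?subrr ?(dvdn_gt0 m_gt0 dm) //.
by apply: contra pm' => /dvdn_trans; apply.
Qed.

End DivisorSums.

(** * The von Mangoldt function; Chebyshev and Mertens bounds *)

Section VonMangoldt.
Variable R : realType.
Local Open Scope ring_scope.

(** Written as a sum over all pairs with [p ^ k = n], of which at most one occurs, so that sums
    against it are computed by exchanging summations. *)
Definition vonMangoldt n : R :=
  \sum_(1 <= p < n.+1 | prime p) \sum_(1 <= k < n.+1 | (p ^ k)%N == n) ln p%:R.

Local Notation Lam := vonMangoldt.

Lemma ln_nat_ge0 n : 0 <= ln n%:R :> R.
Proof.
by case: n => [|n]; [rewrite ln0 | rewrite ln_ge0 // ler1n].
Qed.

Lemma vonMangoldt_ge0 n : 0 <= Lam n.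
Proof. by do 2!apply: sumr_ge0 => ? _; exact: ln_nat_ge0. Qed.

(** Since [p] and [k] are at most [p ^ k], a larger range adds nothing. A range common to all [n] is
    what the exchange of sums requires. *)
Lemma vonMangoldt_widen n y : (0 < n < y)%N ->
  Lam n = \sum_(1 <= p < y | prime p) \sum_(1 <= k < y | (p ^ k)%N == n) ln p%:R.
Proof.
case/andP=> n_gt0 ny; rewrite /Lam [RHS](big_cat_nat (n := n.+1)) //=.
rewrite [X in _ = _ + X]big_nat_cond [X in _ = _ + X]big1 ?addr0; last first.
  move=> p /andP[/andP[np _] p_pr]; rewrite big_nat_cond big1 // => k /andP[/andP[k1 _] /eqP pk].
  move: np; rewrite -pk ltnNge => /negP[].
  by rewrite -[X in (X <= _)%N]expn1 leq_exp2l // prime_gt1.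
apply: eq_bigr => p p_pr; rewrite [RHS](big_cat_nat (n := n.+1)) //=.
rewrite [X in _ = _ + X]big_nat_cond [X in _ = _ + X]big1 ?addr0 //.
move=> k /andP[/andP[nk _] /eqP pk].
by move: nk; rewrite -pk ltnNge ltnW // ltn_expl // prime_gt1.
Qed.

Lemma sum_vonMangoldt (F : nat -> R) x :
  \sum_(1 <= d < x.+1) Lam d * F d
  = \sum_(1 <= p < x.+1 | prime p)
      \sum_(1 <= k < x.+1 | (p ^ k <= x)%N) ln p%:R * F (p ^ k)%N.
Proof.
transitivity (\sum_(1 <= d < x.+1) \sum_(1 <= p < x.+1 | prime p)
   \sum_(1 <= k < x.+1 | (p ^ k)%N == d) ln p%:R * F d).
  apply: eq_big_nat => d hd; rewrite (vonMangoldt_widen hd) mulr_suml.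
  by apply: eq_bigr => p _; rewrite mulr_suml.
rewrite exchange_big /=; apply: eq_bigr => p p_pr.
rewrite (exchange_big_dep xpredT) //= [RHS]big_mkcond /=; apply: eq_big_nat => k _.
rewrite (sum_nat_pick 1 x.+1 (p ^ k) (fun d => ln p%:R * F d)).
by rewrite expn_gt0 prime_gt0.
Qed.

Lemma ln_prod (I : Type) (s : seq I) (F : I -> R) :
  (forall i, 0 < F i) -> ln (\prod_(i <- s) F i) = \sum_(i <- s) ln (F i).
Proof.
move=> F_gt0; elim: s => [|i s IHs]; first by rewrite !big_nil ln1.
by rewrite !big_cons lnM ?IHs // posrE ?prodr_gt0.
Qed.

Lemma sum_divisors_vonMangoldt n : (0 < n)%N -> \sum_(d <- divisors n) Lam d = ln n%:R.
Proof.
move=> n_gt0.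
rewrite -(@sum_divisors_range _ _ n n.+1) ?n_gt0 //= big_mkcond /=.
rewrite (eq_bigr (fun d => Lam d * (d %| n)%:R)) => [|d _]; last first.
  by case: (d %| n)%N; rewrite (mulr1, mulr0).
rewrite (sum_vonMangoldt (fun d => (d %| n)%:R)).
have -> : n%:R = \prod_(p <- index_iota 0 n.+1) (p ^ logn p n)%:R :> R.
  by rewrite -natr_prod; congr _%:R; rewrite -{1}(partnT n_gt0) /partn.
have pos p : 0 < (p ^ logn p n)%:R :> R.
  by rewrite ltr0n; case: p => [|p]; rewrite ?expn_gt0.
rewrite ln_prod // big_ltn // [logn 0 n]lognE expn0 ln1 add0r [LHS]big_mkcond.
apply: eq_big_nat => p /andP[p_gt0 pn]; case: ifPn => p_pr; last first.
  by rewrite lognE (negbTE p_pr) expn0 ln1.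
rewrite natrX lnXn ?ltr0n //; set l := logn p n.
have l_lt : (l < n)%N by rewrite ltn_logl.
rewrite big_mkcond (big_cat_nat (n := l.+1)) //=; last exact: leqW.
rewrite [X in _ + X]big_nat_cond [X in _ + X]big1 ?addr0; last first.
  move=> k /andP[/andP[lk _] _]; have -> : (p ^ k %| n)%N = false by rewrite pfactor_dvdn // leqNgt lk.
  by rewrite mulr0; case: ifP.
rewrite (eq_big_nat _ _ (F2 := fun=> ln p%:R)).
  by rewrite sumr_const_nat subSS subn0.
move=> k /andP[_ kl]; have pkn : (p ^ k %| n)%N by rewrite pfactor_dvdn.
by rewrite (dvdn_leq n_gt0 pkn) pkn mulr1.
Qed.

Lemma ln_le_sub1 (x : R) : 0 < x -> ln x <= x - 1.
Proof. by move=> x_gt0; have := @le_ln1Dx R (x - 1); rewrite [1 + _](_ : _ = x); [apply; lra | ring]. Qed.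

Lemma ln_fact x : ln (x`!)%:R = \sum_(1 <= n < x.+1) ln n%:R :> R.
Proof.
elim: x => [|x IHx]; first by rewrite big_geq // fact0 ln1.
by rewrite factS natrM lnM ?posrE ?ltr0n ?fact_gt0 // IHx [RHS]big_nat_recr //= addrC.
Qed.

Lemma ln_fact_vonMangoldt x :
  ln (x`!)%:R = \sum_(1 <= d < x.+1) Lam d * (x %/ d)%:R.
Proof.
rewrite ln_fact.
rewrite (eq_big_nat _ _ (F2 := fun n => \sum_(d <- divisors n) Lam d)); last first.
  by move=> n /andP[n_gt0 _]; rewrite sum_divisors_vonMangoldt.
rewrite (sum_divisors_sum (fun d _ => Lam d)); apply: eq_bigr => d _.
by rewrite sumr_const_nat subSS subn0 mulr_natr.
Qed.

Lemma ln_fact_le x : ln (x`!)%:R <= x%:R * ln x%:R :> R.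
Proof.
rewrite ln_fact mulr_natl (_ : _ *+ x = \sum_(1 <= n < x.+1) ln x%:R); last first.
  by rewrite sumr_const_nat subSS subn0.
rewrite big_nat_cond [X in _ <= X]big_nat_cond; apply: ler_sum => n.
rewrite andbT ltnS => /andP[n_gt0 nx].
by rewrite ler_ln ?posrE ?ltr0n ?ler_nat // (leq_trans n_gt0).
Qed.

Lemma ln_fact_ge x : x%:R * ln x%:R - x%:R <= ln (x`!)%:R :> R.
Proof.
elim: x => [|x IHx]; first by rewrite mul0r subrr fact0 ln1.
rewrite factS natrM lnM ?posrE ?ltr0n ?fact_gt0 //.
case: x IHx => [|x] IHx; first by rewrite fact0 !ln1; lra.
have x_gt0 : 0 < x.+1%:R :> R by rewrite ltr0n.
have := @ln_le_sub1 (x.+2%:R / x.+1%:R); rewrite divr_gt0 ?ltr0n // => /(_ isT).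
rewrite ln_div ?posrE ?ltr0n // => h.
have : x.+1%:R * (ln x.+2%:R - ln x.+1%:R) <= 1 :> R.
  apply: le_trans (ler_wpM2l (ltW x_gt0) h) _.
  by rewrite mulrBr mulrCA mulfV ?gt_eqF // !mulr1 -[x.+2%:R]natr1; lra.
move: IHx; rewrite -[x.+2%:R]natr1.
move: (ln _) (ln _) (ln _) => a b c; move: x_gt0; move: (x.+1%:R) => y; nra.
Qed.

Definition psi x : R := \sum_(1 <= d < x.+1) Lam d.

Lemma fact_double_le y : ((y.*2)`! <= 4 ^ y * y`! ^ 2)%N.
Proof.
elim: y => [//|y IHy]; rewrite doubleS !factS expnS.
apply: leq_trans (_ : y.*2.+2 * (y.*2.+1 * (4 ^ y * y`! ^ 2)) <= _)%N.
  by rewrite !leq_mul2l IHy !orbT.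
rewrite -!mul2n; move: (4 ^ y)%N (y`!)%N => a b.
by rewrite !expnS !expn0; nia.
Qed.

(** Chebyshev's argument: in [ln (2y)! - 2 ln y!] the coefficient of each [Lam d] is nonnegative,
    and at least 1 for [y < d <= 2y]. The bound [4 ^ y] on the central binomial coefficient and
    [ln 4 <= 2] give [2y]. *)
Lemma psi_double y : psi y.*2 - psi y <= (y.*2)%:R.
Proof.
have h1 : ln (y.*2`!)%:R - 2 * ln (y`!)%:R <= (y.*2)%:R :> R.
  have : ln (y.*2`!)%:R <= ln (4 ^ y * y`! ^ 2)%:R :> R.
    by rewrite ler_ln ?posrE ?ltr0n ?muln_gt0 ?expn_gt0 ?fact_gt0 // ler_nat fact_double_le.
  rewrite natrM lnM ?posrE ?ltr0n ?expn_gt0 ?fact_gt0 // !natrX.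
  rewrite !lnXn ?ltr0n ?fact_gt0 //.
  have : ln 4 <= 2 :> R.
    by rewrite (_ : 4 = 2 ^+ 2 :> R); [rewrite lnXn ?ltr0n // mulr2n; have := @ln_le_sub1 2; lra | ring].
  rewrite -[_ *+ y]mulr_natr -[_ *+ 2]mulr_natr -muln2 natrM.
  have : 0 <= y%:R :> R by rewrite ler0n.
  move: (ln _) (ln _) (ln _) y%:R => a b c d; nra.
apply: le_trans h1; rewrite !ln_fact_vonMangoldt /psi.
have y2 : (y.+1 <= y.*2.+1)%N by rewrite ltnS -addnn leq_addr.
have cut F : \sum_(1 <= d < y.*2.+1) F d
    = \sum_(1 <= d < y.+1) F d + \sum_(y.+1 <= d < y.*2.+1) F d :> R by exact: big_cat_nat.
rewrite (cut Lam) (cut (fun d => Lam d * _)) addrAC subrr add0r mulr_sumr addrAC -sumrB.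
rewrite -[X in X <= _]add0r lerD //.
  apply: sumr_ge0 => d _; rewrite [2 * _]mulrC -mulrA -mulrBr mulr_ge0 ?vonMangoldt_ge0 //.
  rewrite -natrM subr_ge0 ler_nat; case: d => [|d]; first by rewrite divn0.
  by rewrite leq_divRL // -mulnA [(2 * _)%N]mulnC mulnA -muln2 leq_mul2r leq_trunc_div.
rewrite big_nat_cond [X in _ <= X]big_nat_cond; apply: ler_sum => d.
rewrite andbT => /andP[yd dy]; rewrite -[X in X <= _]mulr1 ler_wpM2l ?vonMangoldt_ge0 //.
by rewrite ler1n divn_gt0 // (leq_trans _ yd).
Qed.

Lemma psi_le x : psi x <= (6 * x)%:R.
Proof.
have [n] := ubnP x; elim: n x => // n IHn [|[|x]] xn; first by rewrite /psi big_geq.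
  by rewrite /psi big_nat1 /Lam big_mkcond big_nat1 ler0n.
set z := x.+2; set y := uphalf z.
have zy : (z <= y.*2)%N by rewrite /y; lia.
apply: le_trans (_ : psi y.*2 <= _).
  rewrite /psi [X in _ <= X](big_cat_nat (n := z.+1)) //= lerDl.
  by apply: sumr_ge0 => d _; exact: vonMangoldt_ge0.
have := psi_double y; have : psi y <= (6 * y)%:R by apply: IHn; rewrite /y; lia.
(* The origin of 6: halving yields [6 y + 2 y], and [8 y <= 4 z + 4 <= 6 z] for [z >= 2]. *)
have : (8 * y <= 6 * z)%N by rewrite /y; lia.
rewrite -(ler_nat R) -muln2 !natrM; move: (psi _) (psi _) y%:R z%:R => a b c d; lra.
Qed.

(** [x S - ln x!] is the sum of [Lam d] against the fractional parts of [x / d], hence lies between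
    0 and [psi x <= 6 x]; the bounds on [ln x!] lose at most another [x], and 7 is 6 + 1. *)
Lemma mertens x : (0 < x)%N ->
  `|\sum_(1 <= d < x.+1) Lam d / d%:R - ln x%:R| <= 7.
Proof.
move=> x_gt0; have x0 : 0 < x%:R :> R by rewrite ltr0n.
set S := \sum_(_ <= _ < _) _.
have E : x%:R * S - ln (x`!)%:R = \sum_(1 <= d < x.+1) Lam d * (x%:R / d%:R - (x %/ d)%:R).
  rewrite ln_fact_vonMangoldt mulr_sumr -sumrB; apply: eq_bigr => d _.
  by rewrite mulrBr mulrCA mulrA.
have frac d : (0 < d)%N -> (0 <= x%:R / d%:R - (x %/ d)%:R :> R) && (x%:R / d%:R - (x %/ d)%:R <= 1 :> R).
  move=> d_gt0; have d0 : 0 < d%:R :> R by rewrite ltr0n.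
  have xd : x%:R = (x %/ d)%:R * d%:R + (x %% d)%:R :> R by rewrite {1}(divn_eq x d) natrD natrM.
  have -> : x%:R / d%:R - (x %/ d)%:R = (x %% d)%:R / d%:R :> R.
    by rewrite xd mulrDl mulfK ?gt_eqF // addrAC subrr add0r.
  rewrite divr_ge0 ?ler0n //=.
  by rewrite ler_pdivrMr // mul1r ler_nat ltnW // ltn_mod.
have lo : 0 <= x%:R * S - ln (x`!)%:R.
  rewrite E big_nat_cond sumr_ge0 // => d /andP[/andP[d0 _] _].
  by rewrite mulr_ge0 ?vonMangoldt_ge0 //; case/andP: (frac _ d0).
have hi : x%:R * S - ln (x`!)%:R <= 6 * x%:R.
  apply: le_trans (_ : psi x <= _); last by rewrite -natrM psi_le.
  rewrite E /psi big_nat_cond [X in _ <= X]big_nat_cond; apply: ler_sum => d /andP[/andP[d0 _] _].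
  by rewrite -[X in _ <= X]mulr1 ler_wpM2l ?vonMangoldt_ge0 //; case/andP: (frac _ d0).
have := ln_fact_le x; have := ln_fact_ge x.
rewrite ler_norml => h1 h2; apply/andP; split.
  by rewrite -(ler_pM2l x0) mulrBr; lra.
by rewrite -(ler_pM2l x0) mulrBr; lra.
Qed.

Lemma sum_ln_consecutive x : \sum_(2 <= n < x.+1) ln n%:R / (n%:R * (n%:R - 1)) <= 2 :> R.
Proof.
(* The differences [g n - g n.+1] dominate the terms, so the sum telescopes below [g 1 = 2]. The 2
   in [g] makes [(y + 1) * (ln (y + 1) - ln y) <= 2] exactly what is needed. *)
pose g n : R := (ln n%:R + 2) / n%:R.
have g_ge0 n : 0 <= g n by rewrite divr_ge0 ?addr_ge0 ?ln_nat_ge0 ?ler0n.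
case: x => [|x]; first by rewrite big_geq ?ler0n.
suff : \sum_(2 <= n < x.+2) ln n%:R / (n%:R * (n%:R - 1)) <= g 1%N - g x.+1.
  have -> : g 1%N = 2 by rewrite /g ln1 add0r divr1.
  by have := g_ge0 x.+1; move: (g _) (\sum_(_ <= _ < _) _) => u v; lra.
elim: x => [|x IHx]; first by rewrite big_geq // subrr.
rewrite big_nat_recr //=.
suff : ln x.+2%:R / (x.+2%:R * (x.+2%:R - 1)) <= g x.+1 - g x.+2.
  by move=> h; apply: le_trans (lerD IHx h) _; rewrite subrKA.
rewrite /g -[x.+2%:R]natr1; have : 1 <= x.+1%:R :> R by rewrite ler1n.
move: (x.+1%:R : R) => y y1.
have := @ln_le_sub1 ((y + 1) / y); rewrite divr_gt0; try lra.
move=> /(_ isT); rewrite ln_div ?posrE; try lra.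
move: (ln (y + 1)) (ln y) => a b h.
have h' : (y + 1) * (a - b) <= 2.
  have h1 : y * (a - b) <= 1.
    have e : y * ((y + 1) / y - 1) = 1 by field; rewrite gt_eqF //; lra.
    by rewrite -[X in _ <= X]e ler_wpM2l //; lra.
  have h2 : a - b <= 1 by nra.
  lra.
rewrite addrK -subr_ge0.
rewrite [X in 0 <= X](_ : _ = (2 - (y + 1) * (a - b)) / ((y + 1) * y)); last first.
  by field; rewrite !gt_eqF //; lra.
by rewrite divr_ge0 ?mulr_ge0; lra.
Qed.

(** For each prime the powers with [k >= 2] form a geometric series of sum at most
    [1 / (p (p - 1))]. Consequently unbounded sums of [Lam d / d] can only come from primes. *)
Lemma sum_prime_powers x :
  \sum_(1 <= d < x.+1 | ~~ prime d) Lam d / d%:R <= 2.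
Proof.
rewrite big_mkcond (eq_bigr (fun d => Lam d * (if prime d then 0 else d%:R^-1))) => [|d _]; last first.
  by case: (prime d); rewrite ?mulr0.
rewrite (sum_vonMangoldt (fun d => if prime d then 0 else d%:R^-1)).
apply: le_trans (sum_ln_consecutive x).
apply: le_trans (_ : \sum_(1 <= p < x.+1 | prime p) ln p%:R / (p%:R * (p%:R - 1)) <= _); last first.
  case: x => [|x]; first by rewrite !big_geq.
  rewrite big_ltn_cond //= big_mkcond; apply: ler_sum_nat => p /andP[p2 _].
  case: ifP => // _; rewrite divr_ge0 ?ln_nat_ge0 // mulr_ge0 ?ler0n // subr_ge0 ler1n.
  exact: ltnW.
apply: ler_sum => p p_pr; have p1 := prime_gt1 p_pr.
have P1 : 1 < p%:R :> R by rewrite ltr1n.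
apply: le_trans (_ : \sum_(1 <= k < x.+1) ln p%:R * (if (k == 1)%N then 0 else p%:R^-1 ^+ k) <= _).
  rewrite big_mkcond; apply: ler_sum_nat => k /andP[k0 _]; case: ifP => _; last first.
    by rewrite mulr_ge0 ?ln_nat_ge0 //; case: eqP => // _; rewrite exprn_ge0 // invr_ge0 ler0n.
  rewrite ler_wpM2l ?ln_nat_ge0 //; have [->|k1] := eqVneq k 1%N; first by rewrite expn1 p_pr.
  by case: ifP => _; rewrite ?natrX ?exprVn // invr_ge0 exprn_ge0 ?ler0n.
rewrite -mulr_sumr ler_wpM2l ?ln_nat_ge0 //.
case: x => [|x]; first by rewrite big_geq // invr_ge0 mulr_ge0; lra.
have gt0 : 0 < p%:R - 1 :> R by lra.
suff -> : \sum_(1 <= k < x.+2) (if (k == 1)%N then 0 else p%:R^-1 ^+ k)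
   = (p%:R * (p%:R - 1))^-1 - p%:R^-1 ^+ x.+1 / (p%:R - 1) :> R.
  by rewrite gerBl divr_ge0 ?exprn_ge0 ?invr_ge0; lra.
elim: x => [|x IHx]; first by rewrite big_nat1 /= expr1 invfM subrr.
rewrite big_nat_recr //= IHx [p%:R^-1 ^+ x.+2]exprS; move: (p%:R^-1 ^+ x.+1) => u.
by field; rewrite !gt_eqF //; lra.
Qed.

End VonMangoldt.

(** * Functions on the unit group of Z/N and the operator L *)

Section PeriodicFunctions.
Variables (R : realType) (N : nat).
Hypothesis N_gt0 : (0 < N)%N.
Local Open Scope ring_scope.
Local Notation Lam := (vonMangoldt R).
Implicit Types (h u v w : nat -> R).

(** Functions on the unit group of Z/N, extended by zero and pulled back to [nat]. *)
Definition unit_periodic h :=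
  (forall n, h (n %% N)%N = h n) /\ (forall n, ~~ coprime n N -> h n = 0).
Definition mean_zero h := \sum_(0 <= i < N) h i = 0.
Definition translate g h : nat -> R := fun n => h (g * n)%N.
Definition unit_fun : nat -> R := fun n => (coprime n N)%:R.

Lemma unit_periodic_cong h m n : unit_periodic h -> (m = n %[mod N])%N -> h m = h n.
Proof. by case=> hN _ mn; rewrite -(hN m) mn hN. Qed.

Lemma unit_periodicD h n : unit_periodic h -> h (n + N)%N = h n.
Proof. by move=> hU; apply: unit_periodic_cong hU _; rewrite modnDr. Qed.

Lemma unit_periodic_bound h : unit_periodic h -> exists2 M, 0 <= M & forall n, `|h n| <= M.
Proof.
case=> hN _; exists (\sum_(0 <= i < N) `|h i|); first exact: sumr_ge0.
move=> n; rewrite -hN (bigD1_seq (n %% N)%N) ?iota_uniq ?mem_index_iota ?ltn_mod //=.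
by rewrite lerDl sumr_ge0.
Qed.

Lemma unit_fun_periodic : unit_periodic unit_fun.
Proof.
by split=> n; rewrite /unit_fun ?coprime_modl // => /negbTE ->.
Qed.

Lemma sum_unit_fun_gt0 : 0 < \sum_(0 <= i < N) unit_fun i.
Proof.
rewrite lt_def sumr_ge0 ?andbT => [|i _]; last exact: ler0n.
apply/eqP => /eqP; rewrite psumr_eq0 => [|i _]; last exact: ler0n.
move=> /allP /(_ (1 %% N)%N); rewrite mem_index_iota ltn_mod N_gt0 => /(_ isT).
by rewrite /unit_fun coprime_modl coprime1n oner_eq0.
Qed.

Lemma translate_periodic g h : unit_periodic h -> unit_periodic (translate g h).
Proof.
move=> hU; split=> [n|n nN]; rewrite /translate.
  by apply: unit_periodic_cong hU _; rewrite modnMmr.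
by apply: hU.2; rewrite coprimeMl (negbTE nN) andbF.
Qed.

Lemma sum_translate g h : unit_periodic h -> coprime g N ->
  \sum_(0 <= i < N) h (g * i)%N = \sum_(0 <= i < N) h i.
Proof.
move=> hU gN; rewrite !big_mkord.
pose f (i : 'I_N) : 'I_N := Ordinal (ltn_pmod (g * i) N_gt0).
have f_inj : injective f.
  move=> i j /(congr1 val) /= /eqP.
  wlog ij : i j / (i <= j)%N => [hw|].
    by case/orP: (leq_total i j) => ij; [|rewrite eq_sym => e; apply/esym; move: e]; apply: hw.
  rewrite eq_sym eqn_mod_dvd ?leq_mul // -mulnBr Gauss_dvdr 1?coprime_sym //.
  have [lt_ij|] := ltnP i j; last by move=> ji _; apply/val_inj/eqP; rewrite eqn_leq ij ji.
  by move/dvdn_leq; rewrite subn_gt0 => /(_ lt_ij); have := ltn_ord j; lia.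
by rewrite [RHS](reindex_inj f_inj) /=; apply: eq_bigr => i _; rewrite hU.1.
Qed.

Lemma translate_mean_zero g h : unit_periodic h -> mean_zero h -> mean_zero (translate g h).
Proof.
move=> hU h0; rewrite /mean_zero /translate.
have [gN|gN] := boolP (coprime g N); first by rewrite sum_translate.
by rewrite big1 // => i _; apply: hU.2; rewrite coprimeMl (negbTE gN).
Qed.

Definition harmonic_sum h x := \sum_(1 <= n < x.+1) h n / n%:R.
Local Notation H := harmonic_sum.

Lemma harmonic_sum_cauchy h (M : R) x y : unit_periodic h -> mean_zero h ->
  (forall n, `|h n| <= M) -> (x <= y)%N -> `|H h y - H h x| <= M *+ N / x.+1%:R.
Proof.
move=> hU h0 hM xy.
rewrite /H (big_cat_nat (n := x.+1)) //= addrAC subrr add0r.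
(* [i.-1.+1] equals [i] for [i > 0]. At 0, where the inverse of 0 is 0, the two sides agree because
   [h 0 = 0]: 0 is not a unit unless [N = 1], and then mean zero applies. *)
rewrite (eq_bigr (fun i => (i.-1.+1%:R)^-1 * h i))%R => [|i _]; last first.
  rewrite mulrC; case: i => [|i]; last by [].
  have [N1|N1] := eqVneq N 1%N.
    by move: h0; rewrite /mean_zero N1 big_nat1 => ->; rewrite !mulr0.
  by rewrite hU.2 ?mulr0 // /coprime gcd0n.
rewrite mulrC.
apply: (@abel_bound _ (fun i => (i.-1.+1%:R)^-1) h) => //.
- by move=> [|k] //= _; rewrite lef_pV2 ?posrE ?ltr0n // ler_nat.
- by move=> k _; rewrite invr_ge0 ler0n.
- by move=> k _; apply: periodic_sum_bound => // n; apply: unit_periodicD.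
Qed.

Definition sums_to h l := exists C, forall x, `|H h x - l| <= C / x.+1%:R.
Definition Lsum h := xget 0 [set l | sums_to h l]%classic.

Lemma sums_toE h l : sums_to h l -> Lsum h = l.
Proof.
move=> hl; rewrite /Lsum; case: xgetP => [l' -> [C' hl']|/(_ l)//].
by case: hl => C hl; apply: limit_uniq hl' hl.
Qed.

Lemma Lsum_bound h (M : R) x : unit_periodic h -> mean_zero h -> (forall n, `|h n| <= M) ->
  `|H h x - Lsum h| <= M *+ N / x.+1%:R.
Proof.
move=> hU h0 hM.
have [l hl] : exists l, forall x, `|H h x - l| <= M *+ N / x.+1%:R.
  by apply: nested_limit => y z; apply: harmonic_sum_cauchy.
by rewrite (@sums_toE h l) //; exists (M *+ N).
Qed.

Lemma Lsum_sums_to h : unit_periodic h -> mean_zero h -> sums_to h (Lsum h).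
Proof.
move=> hU h0; have [M _ hM] := unit_periodic_bound hU.
by exists (M *+ N) => x; apply: Lsum_bound.
Qed.

Lemma sums_toD h1 h2 l1 l2 : sums_to h1 l1 -> sums_to h2 l2 ->
  sums_to (fun n => h1 n + h2 n) (l1 + l2).
Proof.
move=> [C1 hl1] [C2 hl2]; exists (C1 + C2) => x.
rewrite (_ : H _ x = H h1 x + H h2 x); last first.
  by rewrite /H -big_split; apply: eq_bigr => i _; rewrite mulrDl.
by rewrite opprD addrACA mulrDl; apply: le_trans (ler_normD _ _) (lerD _ _).
Qed.

Lemma sums_toZ a h l : sums_to h l -> sums_to (fun n => a * h n) (a * l).
Proof.
move=> [C hl]; exists (`|a| * C) => x.
rewrite (_ : H _ x = a * H h x); last first.
  by rewrite /H mulr_sumr; apply: eq_bigr => i _; rewrite mulrA.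
by rewrite -mulrBr normrM -mulrA ler_wpM2l.
Qed.

Lemma sums_to0 : sums_to (fun=> 0) 0.
Proof.
by exists 0 => x; rewrite mul0r /H big1 ?subrr ?normr0 // => i _; rewrite mul0r.
Qed.

Lemma sums_to_sum (I : Type) (s : seq I) (F : I -> nat -> R) (l : I -> R) :
  (forall i, sums_to (F i) (l i)) ->
  sums_to (fun n => \sum_(i <- s) F i n) (\sum_(i <- s) l i).
Proof.
move=> Fl; elim: s => [|i s IHs].
  by rewrite big_nil (_ : (fun _ => _) = fun=> 0) ?funeqE => [|n]; [exact: sums_to0|rewrite big_nil].
rewrite big_cons (_ : (fun _ => _) = fun n => F i n + \sum_(i <- s) F i n).
  exact: sums_toD.
by apply/funext => n; rewrite big_cons.
Qed.

(** On a nonprincipal real character [h] this is multiplication by L(1, h), so injectivity of [Lop]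
    contains the nonvanishing of L(1, h). *)
Definition Lop h g := Lsum (translate g h).

Lemma Lop_translate g g' h : Lop (translate g h) g' = Lop h (g * g').
Proof.
by rewrite /Lop; congr Lsum; apply/funext => n; rewrite /translate mulnA.
Qed.

Lemma Lop_sums_to h g : unit_periodic h -> mean_zero h -> sums_to (translate g h) (Lop h g).
Proof.
move=> hU h0; apply: Lsum_sums_to; first exact: translate_periodic.
exact: translate_mean_zero.
Qed.

Lemma Lop_bound h (M : R) g : unit_periodic h -> mean_zero h -> (forall n, `|h n| <= M) ->
  `|Lop h g| <= M *+ N.
Proof.
move=> hU h0 hM; have := @Lsum_bound (translate g h) M 0.
rewrite /H big_geq // sub0r normrN divr1; apply; first exact: translate_periodic.
  exact: translate_mean_zero.
by move=> n; apply: hM.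
Qed.

Lemma Lop_periodic h : unit_periodic h -> unit_periodic (Lop h).
Proof.
move=> hU; split=> [n|n nN]; rewrite /Lop.
  congr Lsum; apply/funext => k; rewrite /translate.
  by apply: unit_periodic_cong hU _; rewrite modnMml.
apply: sums_toE; rewrite (_ : translate n h = fun=> 0); first exact: sums_to0.
apply/funext => k; apply: hU.2; by rewrite coprimeMl (negbTE nN).
Qed.

Lemma Lop_mean_zero h : unit_periodic h -> mean_zero h -> mean_zero (Lop h).
Proof.
move=> hU h0.
have : sums_to (fun=> 0) (\sum_(0 <= g < N) Lop h g).
  rewrite (_ : (fun=> 0) = fun n => \sum_(0 <= g < N) translate g h n).
    by apply: sums_to_sum => g; apply: Lop_sums_to.
  apply/funext => n; rewrite -[LHS](translate_mean_zero n hU h0).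
  by apply: eq_bigr => g _; rewrite /translate mulnC.
by move/sums_toE; rewrite (sums_toE sums_to0) => /esym.
Qed.

Lemma sum_ln_bound h (M : R) x : unit_periodic h -> mean_zero h -> (forall n, `|h n| <= M) ->
  `|\sum_(1 <= n < x.+1) h n * (ln n%:R / n%:R)| <= M *+ 3 + M *+ N.
Proof.
move=> hU h0 hM; have M_ge0 : 0 <= M by apply: le_trans (hM 0%N).
have le1 n : (0 <= ln n%:R / n%:R :> R) && (ln n%:R / n%:R <= 1 :> R).
  rewrite divr_ge0 ?ln_nat_ge0 //=; case: n => [|n]; first by rewrite invr0 mulr0 ler01.
  by rewrite ler_pdivrMr ?ltr0n // mul1r ltW // ln_sublinear ?ltr0n.
have small a b : `|\sum_(a <= n < b) h n * (ln n%:R / n%:R)| <= M *+ (b - a).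
  rewrite -sumr_const_nat; apply: le_trans (ler_norm_sum _ _ _) _.
  apply: ler_sum => n _; have /andP[ge0 le] := le1 n.
  by rewrite normrM (ger0_norm ge0) -[M]mulr1 ler_pM.
have [x4|x4] := leqP x.+1 4.
  apply: le_trans (small _ _) _; rewrite -[X in X <= _]addr0 lerD ?mulrn_wge0 //.
  by rewrite ler_wpMn2l //; lia.
(* [ln n / n] decreases only once [ln n >= 1]; the terms below 4 are bounded one by one and give
   [M *+ 3]. *)
rewrite (big_cat_nat (n := 4%N)) //=; last exact: ltnW.
apply: le_trans (ler_normD _ _) (lerD (small _ _) _).
rewrite (eq_bigr (fun n => ln n%:R / n%:R * h n)) => [|n _]; last by rewrite mulrC.
pose c n : R := ln (maxn n 4)%:R / (maxn n 4)%:R.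
rewrite (eq_big_nat _ _ (F2 := fun n => c n * h n)) => [|n /andP[n4 _]]; last first.
  by rewrite /c (maxn_idPl n4).
have c_ge0 n : 0 <= c n by have /andP[] := le1 (maxn n 4).
apply: le_trans (@abel_bound _ c h (M *+ N) 4 x.+1 _ _ _ _) _ => //.
- exact: ltnW.
- move=> k k4; rewrite /c (maxn_idPl k4) (maxn_idPl (leqW k4)).
  have k0 : 0 < k%:R :> R by rewrite ltr0n (leq_trans _ k4).
  have k4R : 4 <= k%:R :> R by rewrite (ler_nat R 4).
  have lnk : 1 <= ln k%:R :> R.
    apply: le_trans (_ : ln 4 <= _); last by rewrite ler_ln ?posrE //; lra.
    (* With 4 in this form, [ln t <= t - 1] at [t = 1/2] yields the lower bound [ln 4 >= 1]. *)
    rewrite (_ : 4 = 2^-1 ^- 2 :> R) ?lnV ?posrE ?exprn_gt0 ?invr_gt0 ?ltr0n //; last by field.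
    rewrite lnXn ?invr_gt0 ?ltr0n //; have := @ln_le_sub1 R 2^-1; rewrite invr_gt0 ltr0n.
    by move=> /(_ isT) h1; rewrite mulr2n; move: h1; move: (ln _) => t h1; lra.
  have := @ln_le_sub1 R ((k%:R + 1) / k%:R); rewrite divr_gt0; try lra.
  move=> /(_ isT); rewrite ln_div ?posrE; try lra.
  rewrite -[k.+1%:R]natr1; move: (k%:R : R) k0 lnk => y y0.
  move: (ln (y + 1)) (ln y) => b a a1 ba.
  have hy : y * (b - a) <= 1.
    have e : y * ((y + 1) / y - 1) = 1 by field; rewrite gt_eqF.
    by rewrite -[X in _ <= X]e ler_wpM2l //; lra.
  rewrite -subr_ge0 [X in 0 <= X](_ : _ = (a - y * (b - a)) / (y * (y + 1))).
    by rewrite divr_ge0 ?mulr_ge0; lra.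
  by field; rewrite !gt_eqF //; lra.
- by move=> k _; apply: periodic_sum_bound => // n; apply: unit_periodicD.
by have /andP[_ le] := le1 4; rewrite -[X in _ <= X]mul1r ler_wpM2r ?mulrn_wge0.
Qed.

End PeriodicFunctions.

(** * Sums of Lambda(d)/d against the image and the kernel of L *)

Section WeightedSums.
Variables (R : realType) (N : nat).
Hypothesis N_gt0 : (0 < N)%N.
Local Open Scope ring_scope.
Local Notation Lam := (vonMangoldt R).
Local Notation unit_periodic := (@unit_periodic R N).
Local Notation mean_zero := (@mean_zero R N).
Local Notation unit_fun := (unit_fun R N).
Implicit Types (h u v w : nat -> R).

Definition Psum x h g := \sum_(1 <= d < x.+1) Lam d / d%:R * h (g * d)%N.

Lemma moebius_inversion n : (0 < n)%N ->
  \sum_(d <- divisors n) moebius R d * ln (n %/ d)%:R = Lam n.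
Proof.
move=> n_gt0.
transitivity (\sum_(1 <= d < n.+1) \sum_(1 <= e < n.+1)
    (if (d * e %| n)%N then moebius R d * Lam e else 0)).
  rewrite -(@sum_divisors_range _ _ n n.+1) ?n_gt0 //= big_mkcond.
  apply: eq_big_nat => d /andP[d_gt0 _]; case: ifPn => dn; last first.
    rewrite big1 // => e _; case: ifP => // den; case/negP: dn.
    exact: dvdn_trans (dvdn_mulr _ (dvdnn d)) den.
  have nd_gt0 : (0 < n %/ d)%N by rewrite divn_gt0 // dvdn_leq.
  rewrite -sum_divisors_vonMangoldt // -(@sum_divisors_range _ _ _ n.+1); last first.
    by rewrite nd_gt0 ltnS leq_div.
  rewrite mulr_sumr big_mkcond; apply: eq_bigr => e _.
  by rewrite dvdn_divRL // mulnC.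
rewrite exchange_big /=.
transitivity (\sum_(1 <= e < n.+1) (if e == n then Lam e else 0)); last first.
  rewrite -big_mkcond (eq_bigl (fun e => n == e)) => [|e]; last exact: eq_sym.
  by rewrite sum_nat_pick n_gt0 ltnSn.
apply: eq_big_nat => e /andP[e_gt0 en].
have [e_dvd|ndvd] := boolP (e %| n)%N; last first.
  rewrite ifN ?big1 //; last by apply: contraNneq ndvd => ->.
  move=> d _; case: ifP => // den; case/negP: ndvd.
  exact: dvdn_trans (dvdn_mull _ (dvdnn e)) den.
have ne_gt0 : (0 < n %/ e)%N by rewrite divn_gt0 // dvdn_leq.
rewrite (eq_bigr (fun d => (if (d %| n %/ e)%N then moebius R d else 0) * Lam e)) => [|d _].
  rewrite -mulr_suml -big_mkcond sum_divisors_range ?ne_gt0 ?ltnS ?leq_div //.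
  rewrite sum_moebius // [_ == 1%N]eq_sym eqn_div // mul1n.
  by case: eqP; rewrite ?mul1r ?mul0r.
by rewrite dvdn_divRL //; case: ifP; rewrite ?mul0r.
Qed.

Lemma harmonic_sum_quotient h (M : R) g d x : unit_periodic h -> mean_zero h ->
  (forall n, `|h n| <= M) -> (0 < d)%N -> (0 < x)%N ->
  `|harmonic_sum (translate g h) (x %/ d) - Lop h g| <= M *+ N / x%:R * d%:R.
Proof.
move=> hU h0 hM d_gt0 x_gt0.
apply: le_trans (_ : M *+ N / (x %/ d).+1%:R <= _).
  apply: Lsum_bound => // [||n]; last exact: hM.
    exact: translate_periodic.
  exact: translate_mean_zero.
rewrite -mulrA ler_wpM2l ?mulrn_wge0 ?(le_trans _ (hM 0%N)) // [_ * d%:R]mulrC.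
rewrite ler_pdivlMr ?ltr0n // mulrC ler_pdivrMr ?ltr0n // -natrM ler_nat mulnC.
by rewrite ltnW // ltn_ceil.
Qed.

(** Expand [ln n] as a divisor sum of [Lam] in the bounded sum of [h (g n) ln n / n]: the
    coefficient of [Lam d / d] is a harmonic sum cut at [x / d]. Replacing it by its limit costs at
    most [M *+ N * psi x / x], whence the 6. *)
Lemma Psum_Lop_bounded h : unit_periodic h -> mean_zero h ->
  exists C, forall x g, (0 < x)%N -> `|Psum x (Lop h) g| <= C.
Proof.
move=> hU h0; have [M M_ge0 hM] := unit_periodic_bound N_gt0 hU.
exists (M *+ 3 + M *+ N + (M *+ N) * 6) => x g x_gt0.
have x0 : 0 < x%:R :> R by rewrite ltr0n.
pose S := \sum_(1 <= n < x.+1) h (g * n)%N * (ln n%:R / n%:R).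
have S_bound : `|S| <= M *+ 3 + M *+ N.
  apply: (@sum_ln_bound _ N _ (translate g h)) => // [||n]; last exact: hM.
    exact: translate_periodic.
  exact: translate_mean_zero.
have SE : S = \sum_(1 <= d < x.+1) Lam d / d%:R * harmonic_sum (translate (g * d) h) (x %/ d).
  rewrite (eq_bigr (fun d => \sum_(1 <= k < (x %/ d).+1)
      Lam d / d%:R * (h (g * d * k)%N / k%:R))) => [|d _]; last by rewrite /harmonic_sum mulr_sumr.
  rewrite -(sum_divisors_sum (fun d k => Lam d / d%:R * (h (g * d * k)%N / k%:R))).
  apply: eq_big_nat => n /andP[n_gt0 _]; rewrite -sum_divisors_vonMangoldt //.
  rewrite mulr_suml mulr_sumr; apply: eq_big_seq => d.
  rewrite -dvdn_divisors // => dn; rewrite -mulnA [(d * _)%N]mulnC divnK //.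
  have nd_gt0 : (0 < n %/ d)%N by rewrite divn_gt0 ?(dvdn_gt0 n_gt0 dn) // dvdn_leq.
  have nE : n%:R = (n %/ d)%:R * d%:R :> R by rewrite -natrM divnK.
  rewrite nE; field.
  by rewrite !pnatr_eq0 -!lt0n (dvdn_gt0 n_gt0 dn) nd_gt0.
have diff : `|S - Psum x (Lop h) g| <= (M *+ N) * 6.
  rewrite SE -sumrB; apply: le_trans (ler_norm_sum _ _ _) _.
  apply: le_trans (_ : \sum_(1 <= d < x.+1) Lam d * ((M *+ N) / x%:R) <= _); last first.
    rewrite -mulr_suml mulrCA ler_wpM2l ?mulrn_wge0 // ler_pdivrMr //.
    by rewrite -natrM; exact: psi_le.
  apply: ler_sum_nat => d /andP[d_gt0 _]; have d0 : 0 < d%:R :> R by rewrite ltr0n.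
  rewrite -mulrBr normrM ger0_norm ?divr_ge0 ?vonMangoldt_ge0 ?ler0n //.
  rewrite -mulrA ler_wpM2l ?vonMangoldt_ge0 // mulrC ler_pdivrMr //.
  exact: harmonic_sum_quotient.
rewrite (_ : Psum x (Lop h) g = S - (S - Psum x (Lop h) g)); last by ring.
by apply: le_trans (ler_normB _ _) _; rewrite lerD.
Qed.

(** Summing [moebius d * (ln x - ln d)] over the divisors of [n] gives [Lam n], plus [ln x] when
    [n = 1]. After the exchange of sums the inner harmonic sums tend to 0 and are at most
    [M *+ N * d / x], while the sum of [ln x - ln d] over [d <= x] is [x ln x - ln x!], at most
    [x]. *)
Lemma Psum_kernel v : unit_periodic v -> mean_zero v -> (forall g, Lop v g = 0) ->
  exists C, forall x g, (0 < x)%N -> `|Psum x v g + ln x%:R * v g| <= C.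
Proof.
move=> vU v0 Lv; have [M M_ge0 vM] := unit_periodic_bound N_gt0 vU.
exists (M *+ N) => x g x_gt0; have x0 : 0 < x%:R :> R by rewrite ltr0n.
pose F d k := moebius R d * (ln x%:R - ln d%:R) / d%:R * (v (g * d * k)%N / k%:R).
have -> : Psum x v g + ln x%:R * v g
    = \sum_(1 <= n < x.+1) \sum_(d <- divisors n) F d (n %/ d)%N.
  have lnx : ln x%:R * v g = \sum_(1 <= n < x.+1)
       (if 1%N == n then ln x%:R * v (g * n)%N / n%:R else 0).
    by rewrite -big_mkcond sum_nat_pick /= ltnS x_gt0 muln1 divr1.
  rewrite lnx -big_split; apply: eq_big_nat => n /andP[n_gt0 _] /=.
  rewrite (eq_big_seq (fun d => (moebius R d * ln x%:R - moebius R d * ln n%:R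
       + moebius R d * ln (n %/ d)%:R) * (v (g * n)%N / n%:R))) => [|d].
    rewrite -mulr_suml !big_split /= sumrN -!mulr_suml moebius_inversion // sum_moebius //.
    rewrite [n == 1%N]eq_sym; case: eqP => [<-|_]; last by rewrite !mul0r subrr add0r addr0 mulrAC mulrA.
    by rewrite ln1 muln1 !divr1 /=; ring.
  rewrite -dvdn_divisors // => dn; rewrite /F -mulnA [(d * _)%N]mulnC divnK //.
  have d_gt0 := dvdn_gt0 n_gt0 dn.
  have nd_gt0 : (0 < n %/ d)%N by rewrite divn_gt0 // dvdn_leq.
  have nE : n%:R = (n %/ d)%:R * d%:R :> R by rewrite -natrM divnK.
  rewrite nE lnM ?posrE ?ltr0n //; field.
  by rewrite !pnatr_eq0 -!lt0n d_gt0 nd_gt0.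
rewrite sum_divisors_sum.
apply: le_trans (_ : \sum_(1 <= d < x.+1) (ln x%:R - ln d%:R) * ((M *+ N) / x%:R) <= _).
  apply: le_trans (ler_norm_sum _ _ _) _; apply: ler_sum_nat => d /andP[d_gt0 dx].
  have d0 : 0 < d%:R :> R by rewrite ltr0n.
  rewrite -mulr_sumr normrM -mulrA normrM.
  rewrite -[X in _ <= X]mul1r -!mulrA ler_pM ?moebius_norm ?mulr_ge0 //.
  have ln_ge : 0 <= ln x%:R - ln d%:R :> R.
    by rewrite subr_ge0 ler_ln ?posrE // ler_nat.
  rewrite normrM (ger0_norm ln_ge) -mulrA ler_wpM2l // normfV (ger0_norm (ltW d0)).
  rewrite mulrC ler_pdivrMr //.
  have := harmonic_sum_quotient (g * d) vU v0 vM d_gt0 x_gt0.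
  by rewrite Lv subr0.
rewrite -mulr_suml mulrCA -[X in _ <= X]mulr1 ler_wpM2l ?mulrn_wge0 //.
rewrite ler_pdivrMr // mul1r sumrB -ln_fact sumr_const_nat subSS subn0.
by have := ln_fact_ge R x; rewrite mulr_natl; lra.
Qed.

(** A prime not coprime to [N] divides [N], so only finitely many primes occur; the remaining prime
    powers contribute at most 2. *)
Lemma nonunit_sum_bounded : exists C, forall x,
  \sum_(1 <= d < x.+1 | ~~ coprime d N) Lam d / d%:R <= C.
Proof.
have ge0 d : 0 <= Lam d / d%:R by rewrite divr_ge0 ?vonMangoldt_ge0 ?ler0n.
exists (2 + \sum_(1 <= d < N.+1) Lam d / d%:R) => x.
rewrite (bigID prime) /= addrC; apply: lerD.
  apply: le_trans (sum_prime_powers R x).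
  rewrite big_mkcond [X in _ <= X]big_mkcond; apply: ler_sum => d _.
  by case: (prime d); case: (coprime d N) => /=; rewrite ?lexx ?ge0.
have [xN|Nx] := leqP x N.
  rewrite [X in _ <= X](big_cat_nat (n := x.+1)) //= -[X in X <= _]addr0 lerD ?sumr_ge0 //.
  by rewrite big_mkcond; apply: ler_sum => d _; case: ifP; rewrite ?lexx ?ge0.
rewrite (big_cat_nat (n := N.+1)) //=; last exact: leqW.
rewrite -[X in _ <= X]addr0; apply: lerD.
  by rewrite big_mkcond; apply: ler_sum => d _; case: ifP; rewrite ?lexx ?ge0.
rewrite big_nat_cond big1 // => d /andP[/andP[Nd _] /andP[dN d_pr]].
case/negP: dN; rewrite prime_coprime //; apply: contraL Nd => /dvdn_leq.
by rewrite -leqNgt; apply.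
Qed.

Lemma mertens_units : exists C, forall x, (0 < x)%N -> `|Psum x unit_fun 1 - ln x%:R| <= C.
Proof.
have [C hC] := nonunit_sum_bounded; exists (7 + C) => x x_gt0.
have -> : Psum x unit_fun 1 = \sum_(1 <= d < x.+1) Lam d / d%:R
   - \sum_(1 <= d < x.+1 | ~~ coprime d N) Lam d / d%:R.
  rewrite [X in X - _](bigID (fun d => coprime d N)) /= addrK [RHS]big_mkcond.
  by apply: eq_bigr => d _; rewrite /unit_fun mul1n; case: coprime; rewrite ?mulr1 ?mulr0.
rewrite addrAC; apply: le_trans (ler_normB _ _) (lerD (mertens R x_gt0) _).
rewrite ger0_norm ?hC // sumr_ge0 // => d _.
by rewrite divr_ge0 ?vonMangoldt_ge0 ?ler0n.
Qed.

End WeightedSums.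

(** * From a kernel function of L to a real character *)

Section Kernel.
Variables (R : realType) (N : nat).
Hypothesis N_gt0 : (0 < N)%N.
Local Open Scope ring_scope.
Local Notation Lam := (vonMangoldt R).
Local Notation unit_periodic := (@unit_periodic R N).
Local Notation mean_zero := (@mean_zero R N).
Local Notation unit_fun := (unit_fun R N).
Implicit Types (h u v w : nat -> R).

Definition residue_sum x r := \sum_(1 <= d < x.+1 | (d %% N)%N == r) Lam d / d%:R.

(** Up to a bounded amount only these classes contribute to [Psum]. A number [r >= N] is never
    divergent, its sum being empty. *)
Definition divergent r := coprime r N /\ ~ exists C, forall x, residue_sum x r <= C.

Lemma residue_sum_ge0 x r : 0 <= residue_sum x r.
Proof. by apply: sumr_ge0 => d _; rewrite divr_ge0 ?vonMangoldt_ge0 ?ler0n. Qed.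

Lemma Psum_residues x h g : unit_periodic h ->
  Psum x h g = \sum_(0 <= r < N) residue_sum x r * h (g * r)%N.
Proof.
move=> hU.
rewrite /Psum (eq_bigr (fun d => \sum_(0 <= r < N | (d %% N)%N == r)
   Lam d / d%:R * h (g * r)%N)) => [|d _]; last first.
  rewrite (sum_nat_pick 0 N (d %% N)%N (fun r => Lam d / d%:R * h (g * r)%N)) /= ltn_mod N_gt0.
  by congr (_ * _); apply: unit_periodic_cong hU _; rewrite modnMmr.
rewrite (exchange_big_dep xpredT) //=; apply: eq_bigr => r _.
by rewrite /residue_sum mulr_suml.
Qed.

Lemma ln_unbounded (a C : R) : (forall x, (0 < x)%N -> `|ln x%:R * a| <= C) -> a = 0.
Proof.
move=> hC; apply/eqP/negPn/negP => a0.
have ln2 : 0 < ln 2 :> R by rewrite ln_gt0 // ltr1n.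
have b0 : 0 < ln 2 * `|a| by rewrite mulr_gt0 ?normr_gt0.
have : `|C / (ln 2 * `|a|)| < (Num.bound `|C / (ln 2 * `|a|)|)%:R by apply: archi_boundP.
set k := Num.bound _ => /(le_lt_trans (ler_norm _)); rewrite ltr_pdivrMr // => kC.
have := hC (2 ^ k)%N; rewrite expn_gt0 => /(_ isT); apply/negP; rewrite -ltNge.
rewrite natrX lnXn ?ltr0n // normrM -[_ *+ k]mulr_natl normrM.
by rewrite (gtr0_norm ln2) ger0_norm ?ler0n // -mulrA.
Qed.

Lemma bounded_sum (A : Type) (n : nat) (F : A -> nat -> R) :
  (forall r, exists C, forall t, `|F t r| <= C) ->
  exists C, forall t, `|\sum_(0 <= r < n) F t r| <= C.
Proof.
move=> hF; elim: n => [|n [C hC]].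
  by exists 0 => t; rewrite big_geq // normr0.
have [C' hC'] := hF n; exists (C + C') => t.
by rewrite big_nat_recr //=; apply: le_trans (ler_normD _ _) (lerD _ _).
Qed.

(** [Psum x] is a combination of translations, hence commutes with [Lop]. It is meant for
    [a = ln x]. *)
Lemma Psum_lin x u (a : R) g : unit_periodic u -> mean_zero u ->
  sums_to (translate g (fun g' => Psum x u g' - a * u g'))
          (Psum x (Lop u) g - a * Lop u g).
Proof.
move=> uU u0.
rewrite (_ : translate g _ = fun n =>
   \sum_(1 <= d < x.+1) Lam d / d%:R * translate (g * d) u n + (- a) * translate g u n).
  rewrite -mulNr; apply: sums_toD; last by apply: sums_toZ; exact: (Lop_sums_to N_gt0 _ uU u0).
  by apply: sums_to_sum => d; apply: sums_toZ; exact: (Lop_sums_to N_gt0 _ uU u0).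
apply/funext => n; rewrite /translate mulNr; congr (_ - _).
by apply: eq_bigr => d _; rewrite mulnAC.
Qed.

(** In [Psum x u g] replace each [u (g r)] by [u g]: nothing changes on divergent classes, a bounded
    amount on the others, and Mertens over the units gives the main term. *)
Lemma divergent_invariant_Psum u : unit_periodic u ->
  (forall g r, divergent r -> u (g * r)%N = u g) ->
  exists C, forall x g, (0 < x)%N -> `|Psum x u g - ln x%:R * u g| <= C.
Proof.
move=> uU uD; have [M M_ge0 uM] := unit_periodic_bound N_gt0 uU.
have [C1 hC1] := mertens_units R N_gt0.
have [C2 hC2] : exists C, forall t : nat * nat, `|\sum_(0 <= r < N)
     residue_sum t.1 r * (unit_fun r * (u (t.2 * r)%N - u t.2))| <= C.
  apply: bounded_sum => r; rewrite /unit_fun.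
  have [rN|rN] := boolP (coprime r N); last first.
    by exists 0 => t; rewrite mul0r mulr0 normr0.
  have [rD|rD] := pselect (exists C, forall x, residue_sum x r <= C).
    have [C hC] := rD; exists (C * (M + M)) => t.
    rewrite mul1r normrM ger0_norm ?residue_sum_ge0 //.
    apply: ler_pM => //; first exact: residue_sum_ge0.
    exact: le_trans (ler_normB _ _) (lerD (uM _) (uM _)).
  by exists 0 => t; rewrite uD ?subrr ?mulr0 ?normr0.
exists (C2 + C1 * M) => x g x_gt0.
have -> : Psum x u g - ln x%:R * u g =
    \sum_(0 <= r < N) residue_sum x r * (unit_fun r * (u (g * r)%N - u g))
    + (Psum x unit_fun 1 - ln x%:R) * u g.
  rewrite mulrBl addrA; congr (_ - _).
  rewrite !Psum_residues //; last exact: unit_fun_periodic.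
  rewrite mulr_suml -big_split; apply: eq_bigr => r _ /=.
  rewrite mul1n /unit_fun; have [rN|rN] := boolP (coprime r N); first by rewrite /=; ring.
  by rewrite (uU.2 (g * r)%N) ?coprimeMl ?(negbTE rN) ?andbF //=; ring.
apply: le_trans (ler_normD _ _) (lerD (hC2 (x, g)) _).
by rewrite normrM ler_pM ?normr_ge0 // hC1.
Qed.

(** Here [Psum x u] is [ln x * u + O(1)]. Applying [Lop] gives the same for [Lop u], whose [Psum] is
    bounded, so [Lop u = 0]. Then [Psum_kernel] says that [Psum x u] is also [- ln x * u + O(1)],
    which forces [u = 0]. *)
Lemma divergent_invariant_eq0 u : unit_periodic u -> mean_zero u ->
  (forall g r, divergent r -> u (g * r)%N = u g) -> forall g, u g = 0.
Proof.
move=> uU u0 uD.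
have [C1 hC1] := divergent_invariant_Psum uU uD.
have [C2 hC2] := Psum_Lop_bounded N_gt0 uU u0.
have Lu g : Lop u g = 0.
  apply: (@ln_unbounded _ (C1 *+ N + C2)) => x x_gt0.
  pose w g' := Psum x u g' - ln x%:R * u g'.
  have wU : unit_periodic w.
    split=> [n|n nN]; rewrite /w /Psum.
      rewrite uU.1; congr (_ - _); apply: eq_bigr => d _; congr (_ * _).
      by apply: unit_periodic_cong uU _; rewrite modnMml.
    rewrite uU.2 // mulr0 subr0 big1 // => d _.
    by rewrite uU.2 ?mulr0 // coprimeMl (negbTE nN).
  have w0 : mean_zero w.
    rewrite /mean_zero /w sumrB -mulr_sumr u0 mulr0 subr0 exchange_big /= big1 // => d _.
    rewrite -mulr_sumr (eq_bigr (fun i => u (d * i)%N)) => [|i _]; last by rewrite mulnC.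
    by rewrite [X in _ * X](translate_mean_zero N_gt0 d uU u0) mulr0.
  have hw := Psum_lin x (ln x%:R) g uU u0.
  have := Lop_bound N_gt0 g wU w0 (fun n => hC1 x n x_gt0).
  rewrite /Lop (sums_toE hw) => h; have := hC2 x g x_gt0.
  rewrite -[X in `|X| <= _ -> _](subrK (ln x%:R * Lop u g)).
  set a := _ - _ in h *; move=> h'.
  rewrite -[X in `|X|](addKr a) addrC.
  by apply: le_trans (ler_normB _ _) _; rewrite addrC lerD.
have [C3 hC3] := Psum_kernel N_gt0 uU u0 Lu.
move=> g; apply: (@ln_unbounded _ (C3 + C1)) => x x_gt0.
have E : ln x%:R * u g = 2^-1 * ((Psum x u g + ln x%:R * u g) - (Psum x u g - ln x%:R * u g)).
  by field.
have h1 := hC3 x g x_gt0; have h2 := hC1 x g x_gt0.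
rewrite E normrM gtr0_norm ?invr_gt0 ?ltr0n //.
have := le_trans (ler_normB _ _) (lerD h1 h2).
have := normr_ge0 (Psum x u g + ln x%:R * u g - (Psum x u g - ln x%:R * u g)).
move: `|_| => t; lra.
Qed.

(** Subtracting the mean over the units reduces this to mean zero. Equivalently, the divergent
    classes generate the unit group. *)
Lemma divergent_invariant_const u g : unit_periodic u ->
  (forall g r, divergent r -> u (g * r)%N = u g) -> coprime g N -> u g = u 1%N.
Proof.
move=> uU uD gN.
have phi_gt0 := sum_unit_fun_gt0 R N_gt0.
pose c := (\sum_(0 <= i < N) u i) / \sum_(0 <= i < N) unit_fun i.
have eU := unit_fun_periodic R N.
have h0 k : u k - c * unit_fun k = 0.
  apply: (@divergent_invariant_eq0 (fun k => u k - c * unit_fun k)) => [||{}k r [rN rD]].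
  - split=> [n|n nN]; first by rewrite uU.1 eU.1.
    by rewrite uU.2 // eU.2 // mulr0 subr0.
  - by rewrite /mean_zero sumrB -mulr_sumr /c mulfVK ?subrr // gt_eqF.
  - by rewrite uD // /unit_fun coprimeMl rN andbT.
have := h0 g; have := h0 1%N; rewrite /unit_fun gN coprime1n !mulr1.
by move=> /eqP; rewrite subr_eq0 => /eqP -> /eqP; rewrite subr_eq0 => /eqP.
Qed.

Lemma kernel_character v g0 : unit_periodic v -> mean_zero v -> (forall g, Lop v g = 0) ->
  v g0 != 0 ->
  exists w, [/\ unit_periodic w, mean_zero w, Lop w 1 = 0, w 1%N = 1 &
    (forall n, coprime n N -> `|w n| = 1) /\ (forall m n, w (m * n)%N = w m * w n)].
Proof.
move=> vU v0 Lv vg0.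
have [g1 g1max] : exists g1, forall g, `|v g| <= `|v g1|.
  pose f (i : 'I_N) := `|v i|.
  pose i0 : 'I_N := Ordinal N_gt0.
  exists [arg max_(i > i0) f i]%O; case: arg_maxP => // i _ hi g.
  by rewrite -vU.1; apply: (hi (Ordinal (ltn_pmod g N_gt0))).
have vg1 : v g1 != 0.
  by rewrite -normr_gt0; apply: lt_le_trans (g1max g0); rewrite normr_gt0.
pose w n := (v g1)^-1 * translate g1 v n.
have wU : unit_periodic w.
  have tU := translate_periodic g1 vU.
  by split=> [n|n nN]; rewrite /w ?tU.1 // tU.2 // mulr0.
have w0 : mean_zero w.
  by rewrite /mean_zero /w -mulr_sumr (translate_mean_zero N_gt0 g1 vU v0) mulr0.
have Lw g : Lop w g = 0.
  apply: sums_toE; rewrite -(mulr0 (v g1)^-1) -(Lv (g1 * g)%N) -Lop_translate.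
  apply: sums_toZ; apply: (Lop_sums_to N_gt0) => //; first exact: translate_periodic.
  exact: translate_mean_zero.
have w1 : w 1%N = 1 by rewrite /w /translate muln1 mulVf.
have w_le1 n : `|w n| <= 1.
  by rewrite /w normrM normfV mulrC ler_pdivrMr ?normr_gt0 // mul1r; exact: g1max.
(* Since [w g ^ 2 = 1], the [ln x] terms cancel in the sum of [Lam d / d] against
   [1 + w g * w (g d)] over units. This weight is nonnegative, so a class on which it is positive
   has a bounded sum. *)
have flip g r : `|w g| = 1 -> divergent r -> w (g * r)%N = - w g.
  move=> wg [rN rD]; apply/eqP/negPn/negP => neq; apply: rD.
  have wg2 : w g * w g = 1 by rewrite -expr2 -real_normK ?num_real // wg expr1n.
  have [C1 hC1] := mertens_units R N_gt0.
  have [C2 hC2] := Psum_kernel N_gt0 wU w0 Lw.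
  have delta_gt0 : 0 < 1 + w g * w (g * r)%N.
    rewrite lt_def; apply/andP; split.
      apply: contra neq => /eqP h; apply/eqP.
      by rewrite -[LHS]mul1r -wg2 -mulrA (_ : w g * w (g * r)%N = -1) ?mulrN1 //; lra.
    have : `|w g * w (g * r)%N| <= 1 by rewrite normrM wg mul1r w_le1.
    by rewrite ler_norml => /andP[]; lra.
  have term_ge0 s : 0 <= unit_fun s + w g * w (g * s)%N.
    rewrite /unit_fun; have [sN|sN] := boolP (coprime s N); last first.
      by rewrite (wU.2 (g * s)%N) ?mulr0 ?addr0 // coprimeMl (negbTE sN) andbF.
    have : `|w g * w (g * s)%N| <= 1 by rewrite normrM wg mul1r w_le1.
    by rewrite ler_norml => /andP[]; rewrite /=; lra.
  have C12 : 0 <= C1 + C2.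
    by rewrite addr_ge0 // ?(le_trans _ (hC1 1%N _)) ?(le_trans _ (hC2 1%N g _)).
  exists ((C1 + C2) / (1 + w g * w (g * r)%N)) => x.
  case: (posnP x) => [->|x_gt0].
    by rewrite /residue_sum big_geq // divr_ge0 // ltW.
  rewrite ler_pdivlMr //.
  apply: le_trans (_ : Psum x unit_fun 1 + w g * Psum x w g <= _); last first.
    have -> : Psum x unit_fun 1 + w g * Psum x w g
      = (Psum x unit_fun 1 - ln x%:R) + w g * (Psum x w g + ln x%:R * w g).
      by rewrite [w g * (_ + _)]mulrDr mulrCA wg2; ring.
    apply: le_trans (ler_norm _) _; apply: le_trans (ler_normD _ _) _.
    by rewrite normrM wg mul1r lerD ?hC1 ?hC2.
  rewrite !Psum_residues //; last exact: unit_fun_periodic.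
  rewrite mulr_sumr -big_split /=.
  have [rN'|Nr] := ltnP r N; last first.
    have -> : residue_sum x r = 0.
      by rewrite /residue_sum big1 // => d /eqP dr; move: Nr; rewrite -dr leqNgt ltn_mod N_gt0.
    rewrite mul0r sumr_ge0 // => s _.
    by rewrite mul1n mulrCA -mulrDr mulr_ge0 ?residue_sum_ge0.
  rewrite (bigD1_seq r) ?iota_uniq ?mem_index_iota //= -[X in X <= _]addr0.
  rewrite lerD //.
    by rewrite mul1n /unit_fun rN [X in _ <= X](_ : _ = residue_sum x r * (1 + w g * w (g * r)%N)) //=; ring.
  rewrite sumr_ge0 // => s _.
  by rewrite mul1n mulrCA -mulrDr mulr_ge0 ?residue_sum_ge0.
(* The set where [|w| = 1] is invariant under divergent classes, so its indicator is constant on the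
   units. *)
have norm_const g : coprime g N -> `|w g| = 1.
  pose u n := unit_fun n * (`|w n| == 1)%:R.
  have uE n : u n = (`|w n| == 1)%:R.
    rewrite /u /unit_fun; case: (boolP (coprime n N)) => nN; first by rewrite mul1r.
    by rewrite mul0r wU.2 // normr0 eq_sym oner_eq0.
  have uU : unit_periodic u.
    by split=> [n|n nN]; rewrite !uE ?wU.1 // wU.2 // normr0 eq_sym oner_eq0.
  have uD (k : nat) r : divergent r -> u (k * r)%N = u k.
    move=> rD; rewrite !uE; case: (eqVneq `|w k| 1) => [wh|wh].
      by rewrite flip // normrN wh eqxx.
    case: eqP => // whr; case/eqP: wh.
    (* [flip] only goes forward; the way back uses that [r] has finite order modulo [N], so further
       multiplications by [r] lead from [k * r] to [k]. *)
    have iter j : `|w (k * r ^ j.+1)%N| = 1.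
      elim: j => [|j IHj]; first by rewrite expn1.
      by rewrite expnSr mulnA flip // normrN.
    have := iter (totient N).-1; rewrite prednK ?totient_gt0 //.
    rewrite (unit_periodic_cong (n := k) wU) // -modnMmr Euler_exp_totient; last by case: rD.
    by rewrite modnMmr muln1.
  move=> gN; have := divergent_invariant_const uU uD gN.
  by rewrite !uE w1 normr1 eqxx => /eqP; rewrite eqr_nat; case: (`|w g| =P 1).
have sqr g : coprime g N -> w g * w g = 1.
  by move=> gN; rewrite -expr2 -real_normK ?num_real // norm_const // expr1n.
have flip' g r : divergent r -> w (g * r)%N = - w g.
  move=> rD; have [gN|gN] := boolP (coprime g N); first by rewrite flip ?norm_const.
  by rewrite !wU.2 ?oppr0 // coprimeMl (negbTE gN).
exists w; split=> //; split=> // m n.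
have [mN|mN] := boolP (coprime m N); last first.
  by rewrite !(wU.2 m) // wU.2 ?mul0r // coprimeMl (negbTE mN).
have [nN|nN] := boolP (coprime n N); last first.
  by rewrite !(wU.2 n) // wU.2 ?mulr0 // coprimeMl (negbTE nN) andbF.
(* A divergent class flips both factors, so [u] is constant on the units, with value [w m] at 1; as
   [w n ^ 2 = 1], multiplicativity follows. *)
pose u k := w (m * k)%N * w k.
have := @divergent_invariant_const u n; rewrite /u !muln1 w1 mulr1 => <- //.
- by rewrite -mulrA sqr ?mulr1.
- split=> [k|k kN]; last by rewrite (wU.2 k) ?mulr0.
  by rewrite wU.1; congr (_ * _); apply: unit_periodic_cong wU _; rewrite modnMmr.
- by move=> g r rD; rewrite mulnA (flip' (m * g)%N r rD) (flip' g r rD) mulrNN.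
Qed.

End Kernel.

(** * Nonvanishing for real characters *)

Section RealCharacter.
Variables (R : realType) (N : nat) (w : nat -> R).
Hypothesis N_gt0 : (0 < N)%N.
Local Open Scope ring_scope.
Hypothesis wU : unit_periodic N w.
Hypothesis w0 : mean_zero N w.
Hypothesis Lw : Lop w 1 = 0.
Hypothesis w1 : w 1%N = 1.
Hypothesis w_norm : forall n, coprime n N -> `|w n| = 1.
Hypothesis wM : forall m n, w (m * n)%N = w m * w n.

Lemma character_le1 n : `|w n| <= 1.
Proof.
have [nN|nN] := boolP (coprime n N); first by rewrite w_norm.
by rewrite wU.2 // normr0 ler01.
Qed.

Lemma character_exp p i : w (p ^ i)%N = w p ^+ i.
Proof. by elim: i => [|i IHi]; rewrite ?w1 // expnS exprS wM IHi. Qed.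

Lemma character_geometric_ge0 p k :
  0 <= \sum_(0 <= i < k.+1) w (p ^ i)%N /\ (~~ odd k -> 1 <= \sum_(0 <= i < k.+1) w (p ^ i)%N).
Proof.
have [pN|pN] := boolP (coprime p N); last first.
  rewrite big_ltn // expn0 w1 big_nat_cond big1 ?addr0 ?ler01 //.
  by move=> i /andP[/andP[i0 _] _]; rewrite character_exp wU.2 // expr0n gtn_eqF.
rewrite (eq_bigr (fun i => w p ^+ i)) => [|i _]; last exact: character_exp.
have /eqP := w_norm pN; rewrite eqr_norml ler01 andbT => /orP[] /eqP ->.
  rewrite (eq_bigr (fun=> 1)) => [|i _]; last by rewrite expr1n.
  by rewrite sumr_const_nat subn0 ler0n ler1n.
suff -> : \sum_(0 <= i < k.+1) (-1 : R) ^+ i = (odd k.+1)%:R.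
  by rewrite ler0n /=; split=> // ->.
elim: k => [|k IHk]; first by rewrite big_nat1.
rewrite big_nat_recr //= IHk -signr_odd /=.
by case: (odd k); rewrite /= ?expr0 ?expr1; ring.
Qed.

Definition character_divisor_sum n := \sum_(d <- divisors n) w d.
Local Notation r := character_divisor_sum.

Lemma character_divisor_sumM p k m : prime p -> (0 < m)%N -> ~~ (p %| m)%N ->
  r (p ^ k * m) = (\sum_(0 <= i < k.+1) w (p ^ i)%N) * r m.
Proof.
move=> p_pr m_gt0 pm; rewrite /r sum_divisors_pfactor // mulr_suml.
by apply: eq_bigr => i _; rewrite mulr_sumr; apply: eq_bigr => d _; rewrite wM.
Qed.

Lemma character_divisor_sum_ge0 n : (0 < n)%N -> 0 <= r n.
Proof.
have [k] := ubnP n; elim: k n => // k IHk n nk n_gt0.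
have [->|n_neq1] := eqVneq n 1%N; first by rewrite /r big_seq1 w1 ler01.
have n_gt1 : (1 < n)%N by case: n n_gt0 n_neq1 {nk} => [|[]].
have p_pr := pdiv_prime n_gt1; set p := pdiv n in p_pr.
have [m pm nE] := pfactor_coprime p_pr n_gt0.
have l_gt0 : (0 < logn p n)%N by rewrite logn_gt0 mem_primes p_pr n_gt0 pdiv_dvd.
have m_gt0 : (0 < m)%N by move: n_gt0; rewrite nE muln_gt0 => /andP[].
rewrite nE mulnC character_divisor_sumM -?prime_coprime //.
rewrite mulr_ge0 ?(character_geometric_ge0 _ _).1 // IHk //.
apply: (@leq_trans n); last by rewrite -ltnS.
  rewrite [X in (_ < X)%N]nE ltn_Pmulr //.
by rewrite -(exp1n (logn p n)) ltn_exp2r // prime_gt1.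
Qed.

Lemma character_divisor_sum_square n : (0 < n)%N -> 1 <= r (n ^ 2).
Proof.
have [k] := ubnP n; elim: k n => // k IHk n nk n_gt0.
have [->|n_neq1] := eqVneq n 1%N; first by rewrite /r exp1n big_seq1 w1.
have n_gt1 : (1 < n)%N by case: n n_gt0 n_neq1 {nk} => [|[]].
have p_pr := pdiv_prime n_gt1; set p := pdiv n in p_pr.
have [m pm nE] := pfactor_coprime p_pr n_gt0.
have l_gt0 : (0 < logn p n)%N by rewrite logn_gt0 mem_primes p_pr n_gt0 pdiv_dvd.
have m_gt0 : (0 < m)%N by move: n_gt0; rewrite nE muln_gt0 => /andP[].
rewrite nE mulnC expnMn -expnM character_divisor_sumM ?expn_gt0 ?m_gt0 //; last first.
  by rewrite -prime_coprime // coprimeXr.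
have h1 : 1 <= r (m ^ 2).
  apply: IHk => //; apply: (@leq_trans n); last by rewrite -ltnS.
  rewrite [X in (_ < X)%N]nE ltn_Pmulr //.
  by rewrite -(exp1n (logn p n)) ltn_exp2r // prime_gt1.
have h2 := (character_geometric_ge0 p (logn p n * 2)).2.
apply: (mulr_ege1 (h2 _) h1).
by rewrite oddM andbF.
Qed.

(** The coefficient of [w d] when [r n] is summed with weight [X - n]. In a plain count the squares
    contribute about the square root of [X], no more than the error of these estimates; with the
    linear weight they win for large [X]. *)
Definition weight X d : R := \sum_(1 <= k < (X %/ d).+1) (X - d * k)%:R.

Lemma weight_estimate X d : (0 < d)%N ->
  `|weight X d - (X%:R ^+ 2 / (2 * d%:R) - X%:R / 2)| <= d%:R.
Proof.
move=> d_gt0; have d0 : 0 < d%:R :> R by rewrite ltr0n.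
have closed K : (d * K <= X)%N -> \sum_(1 <= k < K.+1) (X - d * k)%:R
    = K%:R * X%:R - d%:R * K%:R * (K%:R + 1) / 2 :> R.
  elim: K => [|K IHK] dK; first by rewrite big_geq //; ring.
  rewrite big_nat_recr //= IHK; last by apply: leq_trans dK; rewrite leq_mul2l leqnSn orbT.
  by rewrite natrB // natrM -[K.+1%:R]natr1; field.
rewrite /weight closed; last by rewrite mulnC leq_trunc_div.
set K := (X %/ d)%N; set rho : R := (X %% d)%:R.
have -> : X%:R = K%:R * d%:R + rho :> R by rewrite -natrM -natrD -divn_eq.
have rho0 : 0 <= rho by rewrite ler0n.
have rhod : rho <= d%:R by rewrite ler_nat ltnW // ltn_mod.
rewrite (_ : _ - _ = rho * (d%:R - rho) / (2 * d%:R)); last first.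
  by field; rewrite gt_eqF.
rewrite ger0_norm; last by rewrite divr_ge0 ?mulr_ge0 ?subr_ge0 ?ler0n.
rewrite ler_pdivrMr ?mulr_gt0 //; move: (d%:R : R) d0 rhod => e e0 rhod; nra.
Qed.

Lemma sum_squares_le (F : nat -> R) Y : (forall n, (0 < n)%N -> 0 <= F n) ->
  \sum_(1 <= k < Y.+1) F (k ^ 2)%N <= \sum_(1 <= n < (Y ^ 2).+1) F n.
Proof.
move=> F_ge0; elim: Y => [|Y IHY]; first by rewrite !big_geq.
rewrite big_nat_recr //= [X in _ <= X](big_cat_nat (n := (Y ^ 2).+1)) //=; last first.
  by rewrite ltnS leq_exp2r.
rewrite lerD // big_nat_recr /=; last by rewrite ltn_exp2r.
rewrite lerDr big_nat_cond sumr_ge0 // => n /andP[/andP[n0 _] _]; apply: F_ge0.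
exact: leq_trans n0.
Qed.

Lemma real_character_nonvanishing : False.
Proof.
have LwE : Lsum w = 0.
  by rewrite -Lw /Lop; congr Lsum; apply/funext => n; rewrite /translate mul1n.
have NR1 : 1 <= N%:R :> R by rewrite ler1n.
(* As [X = 2 Y ^ 2], each of the [Y] squares up to [Y ^ 2] has weight at least [Y ^ 2], so
   [Q >= Y ^ 3]. In the upper bound [Z = 12 N Y] makes the main term [Y ^ 3 / 3], and
   [Y = 400 N ^ 2] makes the other terms at most [157 Y ^ 3 / 400]; together they stay below
   [5 Y ^ 3 / 6]. *)
have [Y YE] : {Y | Y = 400 * N ^ 2}%N by exists (400 * N ^ 2)%N.
have [X XE] : {X | X = 2 * Y ^ 2}%N by exists (2 * Y ^ 2)%N.
have [Z ZE] : {Z | Z = 12 * N * Y}%N by exists (12 * N * Y)%N.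
have Y_gt0 : (0 < Y)%N by rewrite YE muln_gt0 expn_gt0 N_gt0.
have Z_gt0 : (0 < Z)%N by rewrite ZE !muln_gt0 N_gt0 Y_gt0.
have ZX : (Z <= X.+1)%N.
  have : (6 * N <= Y)%N by rewrite YE; nia.
  by rewrite ZE XE; move: Y_gt0; move: (Y) => y; nia.
pose Q : R := \sum_(1 <= n < X.+1) r n * (X - n)%:R.
have Q_ge : Y%:R ^+ 3 <= Q.
  apply: le_trans (_ : \sum_(1 <= n < (Y ^ 2).+1) r n * (X - n)%:R <= _); last first.
    rewrite /Q [X in _ <= X](big_cat_nat (n := (Y ^ 2).+1)) //=; last by rewrite ltnS XE; lia.
    rewrite lerDl big_nat_cond sumr_ge0 // => n /andP[/andP[n0 _] _].
    by rewrite mulr_ge0 ?ler0n // character_divisor_sum_ge0 // (leq_trans _ n0).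
  apply: le_trans (@sum_squares_le (fun n => r n * (X - n)%:R) Y _); last first.
    by move=> n n0; rewrite mulr_ge0 ?ler0n // character_divisor_sum_ge0.
  apply: le_trans (_ : \sum_(1 <= k < Y.+1) Y%:R ^+ 2 <= _).
    by rewrite sumr_const_nat subSS subn0 -[_ ^+ 2 *+ Y]mulr_natl exprS.
  apply: ler_sum_nat => k /andP[k0 kY].
  rewrite -[X in X <= _]mul1r ler_pM ?ler01 ?exprn_ge0 ?ler0n ?character_divisor_sum_square //.
  rewrite -natrX ler_nat XE; have : (k ^ 2 <= Y ^ 2)%N by rewrite leq_exp2r.
  lia.
have QE : Q = \sum_(1 <= d < Z) w d * weight X d
   + \sum_(Z <= d < X.+1) w d * weight X d.
  rewrite -(big_cat_nat (n := Z)) //= /Q.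
  rewrite (eq_big_nat _ _ (F2 := fun n => \sum_(d <- divisors n) w d * (X - d * (n %/ d))%:R)).
    rewrite (sum_divisors_sum (fun d k => w d * (X - d * k)%:R)).
    by apply: eq_bigr => d _; rewrite mulr_sumr.
  move=> n /andP[n0 _]; rewrite mulr_suml; apply: eq_big_seq => d.
  by rewrite -dvdn_divisors // => dn; rewrite mulnC divnK.
(* For small [d] the weight is replaced by its estimate; since the series of [w d / d] has sum 0,
   its partial sum is at most [N / Z]. *)
have part1 : `|\sum_(1 <= d < Z) w d * weight X d|
    <= X%:R ^+ 2 / 2 * (N%:R / Z%:R) + X%:R / 2 * N%:R + Z%:R * Z%:R.
  rewrite (eq_big_nat _ _ (F2 := fun d => X%:R ^+ 2 / 2 * (w d / d%:R) - X%:R / 2 * w d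
     + w d * (weight X d - (X%:R ^+ 2 / (2 * d%:R) - X%:R / 2)))); last first.
    move=> d /andP[d0 _]; field.
    by rewrite pnatr_eq0 -lt0n d0.
  rewrite !big_split /= sumrN -!mulr_sumr.
  apply: le_trans (ler_normD _ _) (lerD _ _).
    apply: le_trans (ler_normB _ _) (lerD _ _); rewrite normrM.
      rewrite ger0_norm ?divr_ge0 ?exprn_ge0 ?ler0n // ler_wpM2l ?divr_ge0 ?exprn_ge0 ?ler0n //.
      have := Lsum_bound N_gt0 Z.-1 wU w0 character_le1.
      by rewrite LwE subr0 /harmonic_sum prednK.
    rewrite ger0_norm ?divr_ge0 ?ler0n // ler_wpM2l ?divr_ge0 ?ler0n //.
    by apply: (periodic_sum_bound _ _ N_gt0 _ w0 character_le1) => n; apply: unit_periodicD.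
  apply: le_trans (ler_norm_sum _ _ _) _.
  apply: le_trans (_ : \sum_(1 <= d < Z) Z%:R <= _).
    apply: ler_sum_nat => d /andP[d0 dZ]; rewrite normrM -[X in _ <= X]mul1r ler_pM //.
      exact: character_le1.
    by apply: le_trans (weight_estimate X d0) _; rewrite ler_nat ltnW.
  rewrite sumr_const_nat -[_ *+ (Z - 1)]mulr_natl ler_wpM2r ?ler0n // ler_nat; lia.
(* For large [d] the estimate is too coarse, but [X - d * k] decreases in [d], so partial summation
   against the periodic [w] applies for each [k]. *)
have part2 : `|\sum_(Z <= d < X.+1) w d * weight X d| <= N%:R * (X%:R ^+ 2 / (2 * Z%:R) + Z%:R).
  have ext d : (0 < d)%N -> weight X d = \sum_(1 <= k < X.+1) (X - d * k)%:R.
    move=> d0; rewrite [RHS](big_cat_nat (n := (X %/ d).+1)) //=; last by rewrite ltnS leq_div.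
    rewrite [X in _ = _ + X]big_nat_cond [X in _ = _ + X]big1 ?addr0 // => k /andP[/andP[kX _] _].
    rewrite (eqP (_ : X - d * k == 0)%N) // subn_eq0 ltnW // mulnC -ltn_divLR //.
  rewrite (eq_big_nat _ _ (F2 := fun d => \sum_(1 <= k < X.+1) (X - d * k)%:R * w d)); last first.
    move=> d /andP[Zd _]; rewrite ext ?mulr_sumr ?(leq_trans Z_gt0) //.
    by apply: eq_bigr => k _; rewrite mulrC.
  rewrite exchange_big /=; apply: le_trans (ler_norm_sum _ _ _) _.
  apply: le_trans (_ : \sum_(1 <= k < X.+1) (X - Z * k)%:R * N%:R <= _).
    apply: ler_sum => k _; apply: (abel_bound (c := fun d => (X - d * k)%:R)) => //.
    - by move=> d _; rewrite ler_nat leq_sub2l // leq_mul2r leqnSn orbT.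
    - by move=> d _; apply: (periodic_sum_bound _ _ N_gt0 _ w0 character_le1) => n; apply: unit_periodicD.
  rewrite -mulr_suml -ext // mulrC ler_wpM2l ?ler0n //.
  have := weight_estimate X Z_gt0; rewrite ler_norml => /andP[_].
  have : 0 <= X%:R :> R by rewrite ler0n.
  move: (_ / _) (weight _ _) => a b; lra.
have : Q <= Y%:R ^+ 3 * (5 / 6).
  apply: le_trans (ler_norm _) _; rewrite QE.
  apply: le_trans (ler_normD _ _) _; apply: le_trans (lerD part1 part2) _.
  have YR : Y%:R = 400 * N%:R ^+ 2 :> R by rewrite YE natrM natrX.
  have XR : X%:R = 2 * Y%:R ^+ 2 :> R by rewrite XE natrM natrX.
  have ZR : Z%:R = 12 * N%:R * Y%:R :> R by rewrite ZE !natrM.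
  rewrite XR ZR; move: (N%:R : R) NR1 YR => n n1 YR.
  have : 1 <= n ^+ 2 by rewrite expr2; nra.
  have n_neq0 : n != 0 by rewrite gt_eqF //; lra.
  have y_neq0 : Y%:R != 0 :> R by rewrite pnatr_eq0 -lt0n.
  move: YR y_neq0; move: (Y%:R : R) => y yE y_neq0 n2.
  rewrite (_ : _ + _ = y ^+ 3 / 3 + n * y ^+ 2 + 144 * n ^+ 2 * y ^+ 2 + 12 * n ^+ 2 * y); last first.
    by field; rewrite n_neq0 y_neq0.
  have y1 : 400 <= y by rewrite yE; lra.
  have h1 : n * y ^+ 2 <= n ^+ 2 * y ^+ 2 by rewrite ler_wpM2r ?sqr_ge0 // expr2; nra.
  have h2 : n ^+ 2 * y <= n ^+ 2 * y ^+ 2.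
    by rewrite ler_wpM2l ?sqr_ge0 // expr2 -[X in X <= _]mul1r ler_wpM2r; lra.
  have h3 : n ^+ 2 * y ^+ 2 = y ^+ 3 / 400 by rewrite (_ : n ^+ 2 = y / 400); [field | rewrite yE; field].
  have : 0 <= y ^+ 3 by rewrite exprn_ge0 //; lra.
  rewrite h3 in h1 h2; move: (y ^+ 3) h1 h2 h3 => z; lra.
have : 0 < Y%:R ^+ 3 :> R by rewrite exprn_gt0 // ltr0n.
by move: (Y%:R ^+ 3) Q Q_ge {QE} => y q; lra.
Qed.

End RealCharacter.

(** * Invertibility of L and primes in progressions *)

Section Dirichlet.
Variables (R : realType) (N : nat).
Hypothesis N_gt0 : (0 < N)%N.
Local Open Scope ring_scope.
Local Notation unit_periodic := (@unit_periodic R N).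
Local Notation mean_zero := (@mean_zero R N).
Local Notation unit_fun := (unit_fun R N).
Local Notation phi := (\sum_(0 <= i < N) unit_fun i).

Lemma Lop_injective v : unit_periodic v -> mean_zero v -> (forall g, Lop v g = 0) ->
  forall g, v g = 0.
Proof.
move=> vU v0 Lv g; apply/eqP/negPn/negP => vg.
have [w [wU w0 Lw w1 [w_norm wM]]] := kernel_character N_gt0 vU v0 Lv vg.
exact: (real_character_nonvanishing N_gt0 wU w0 Lw w1 w_norm wM).
Qed.

Local Notation phi_gt0 := (sum_unit_fun_gt0 R N_gt0).

(** The indicator of the class of [i] minus its mean over the units. It is identically zero when [i]
    is not a unit, so that every [i < N] can serve as an index. *)
Definition residue_fun i n : R :=
  unit_fun n * unit_fun i * (((n %% N)%N == (i %% N)%N)%:R - phi^-1).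

Lemma residue_fun_periodic i : unit_periodic (residue_fun i).
Proof.
have [e1 e2] := unit_fun_periodic R N.
split=> [n|n nN]; rewrite /residue_fun; first by rewrite e1 modn_mod.
by rewrite e2 // !mul0r.
Qed.

Lemma sum_indicator (F : nat -> R) i :
  \sum_(0 <= n < N) F n * ((n %% N)%N == (i %% N)%N)%:R = F (i %% N)%N.
Proof.
rewrite (eq_big_nat _ _ (F2 := fun n => if (i %% N)%N == n then F n else 0)).
  by rewrite -big_mkcond sum_nat_pick /= ltn_mod N_gt0.
move=> n /andP[_ nN]; rewrite (modn_small nN) eq_sym.
by case: eqP => _; rewrite ?mulr1 ?mulr0.
Qed.

Lemma residue_fun_mean_zero i : mean_zero (residue_fun i).
Proof.
have [e1 e2] := unit_fun_periodic R N.
rewrite /mean_zero /residue_fun.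
rewrite (eq_bigr (fun n => unit_fun i * (unit_fun n * ((n %% N)%N == (i %% N)%N)%:R)
    - unit_fun i / phi * unit_fun n)) => [|n _]; last by ring.
rewrite sumrB -!mulr_sumr sum_indicator e1 mulfVK ?gt_eqF ?phi_gt0 //.
rewrite /unit_fun.
by case: coprime; rewrite ?mulr1 ?mul0r subrr.
Qed.

Lemma residue_fun_sum (r : nat -> R) n : (n < N)%N ->
  \sum_(0 <= i < N) r i * residue_fun i n
  = unit_fun n * (r n - (\sum_(0 <= i < N) r i * unit_fun i) / phi).
Proof.
move=> nN; rewrite /residue_fun.
rewrite (eq_big_nat _ _ (F2 := fun i => unit_fun n * (r i * unit_fun i * ((i %% N)%N == (n %% N)%N)%:R)
    - unit_fun n / phi * (r i * unit_fun i))) => [|i /andP[_ iN]]; last first.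
  by rewrite [_ == (n %% N)%N]eq_sym; ring.
rewrite sumrB -!mulr_sumr sum_indicator modn_small // mulrBr; congr (_ - _); last by ring.
rewrite /unit_fun.
by case: coprime; rewrite ?mulr0 ?mul0r ?mul1r ?mulr1.
Qed.

Lemma combination_periodic (r : nat -> R) :
  unit_periodic (fun n => \sum_(0 <= i < N) r i * residue_fun i n).
Proof.
split=> [n|n nN]; last by rewrite big1 // => i _; rewrite (residue_fun_periodic i).2 ?mulr0.
by apply: eq_bigr => i _; rewrite (residue_fun_periodic i).1.
Qed.

Lemma combination_mean_zero (r : nat -> R) :
  mean_zero (fun n => \sum_(0 <= i < N) r i * residue_fun i n).
Proof.
rewrite /mean_zero exchange_big big1 //= => i _.
by rewrite -mulr_sumr (residue_fun_mean_zero i) mulr0.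
Qed.

Lemma Lop_combination (r : nat -> R) g :
  Lop (fun n => \sum_(0 <= i < N) r i * residue_fun i n) g
  = \sum_(0 <= i < N) r i * Lop (residue_fun i) g.
Proof.
apply: sums_toE.
apply: (@sums_to_sum _ _ _ (fun i n => r i * translate g (residue_fun i) n)) => i.
apply: sums_toZ; apply: (Lop_sums_to N_gt0).
  exact: residue_fun_periodic.
exact: residue_fun_mean_zero.
Qed.

(* Adding the mean on units and the identity off units turns [Lop] into an
   endomorphism of all functions on residues, so injectivity gives surjectivity. *)
Lemma Lop_surjective u : unit_periodic u -> mean_zero u ->
  exists h, [/\ unit_periodic h, mean_zero h & forall g, Lop h g = u g].
Proof.
move=> uU u0; have phi0 : phi != 0 by rewrite gt_eqF ?phi_gt0.
pose A : 'M[R]_N := \matrix_(i, j) (Lop (residue_fun i) j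
   + unit_fun i * unit_fun j / phi + (1 - unit_fun i) * (i == j)%:R).
pose ext (r : 'rV[R]_N) i := r 0 (Ordinal (ltn_pmod i N_gt0)).
have extE r (i : 'I_N) : ext r i = r 0 i.
  by rewrite /ext; congr (r 0 _); apply/val_inj; rewrite /= modn_small.
pose mean r := (\sum_(0 <= i < N) ext r i * unit_fun i) / phi.
pose comb r n := \sum_(0 <= i < N) ext r i * residue_fun i n.
have AE (r : 'rV[R]_N) (j : 'I_N) :
    (r *m A) 0 j = Lop (comb r) j + mean r * unit_fun j + (1 - unit_fun j) * r 0 j.
  rewrite Lop_combination mxE big_mkord /mean.
  rewrite (big_mkord xpredT (fun i => ext r i * unit_fun i)).
  rewrite (eq_bigr (fun i : 'I_N => ext r i * Lop (residue_fun i) j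
     + unit_fun j / phi * (ext r i * unit_fun i)
     + (if i == j then (1 - unit_fun i) * ext r i else 0))) => [|i _]; last first.
    by rewrite mxE extE; case: eqP => _ /=; ring.
  rewrite !big_split /= -big_mkcond big_pred1_eq extE -mulr_sumr.
  by congr (_ + _ + _); ring.
have combU r : unit_periodic (comb r) by exact: combination_periodic.
have comb0 r : mean_zero (comb r) by exact: combination_mean_zero.
have uf2 i : unit_fun i * unit_fun i = unit_fun i.
  by rewrite /unit_fun; case: coprime; rewrite ?mulr1 ?mulr0.
have unit_funM h n : unit_periodic h -> unit_fun n * h n = h n.
  by move=> hU; rewrite /unit_fun; case: (boolP (coprime n N)) => nN;
    rewrite ?mul1r // hU.2 // mulr0.
have key r t : unit_periodic t -> mean_zero t -> (forall j : 'I_N, (r *m A) 0 j = t j) ->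
    mean r = 0 /\ forall g, Lop (comb r) g = t g.
  move=> tU t0 rA; have LU := Lop_periodic (combU r).
  (* Sum over the units: both [t] and the values of [Lop] have mean zero, leaving [mean r] times the
     number of units. *)
  have mean0 : mean r = 0.
    have : \sum_(j < N) unit_fun j * (r *m A) 0 j = 0.
      rewrite (eq_bigr (fun j : 'I_N => t j)) => [|j _]; last by rewrite rA unit_funM.
      by rewrite -(big_mkord xpredT t).
    rewrite (eq_bigr (fun j : 'I_N => Lop (comb r) j + mean r * unit_fun j)) => [|j _].
      rewrite big_split /= -mulr_sumr -(big_mkord xpredT (Lop (comb r))).
      rewrite (Lop_mean_zero N_gt0 (combU r) (comb0 r)) add0r -(big_mkord xpredT unit_fun).
      by move/eqP; rewrite mulf_eq0 (negbTE phi0) orbF => /eqP.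
    rewrite AE !mulrDr unit_funM // mulrCA uf2 mulrA mulrBr mulr1 uf2.
    by rewrite subrr mul0r addr0.
  split=> // g; rewrite -LU.1 -tU.1.
  have [gN|gN] := boolP (coprime (g %% N) N); last by rewrite LU.2 // tU.2.
  rewrite -(rA (Ordinal (ltn_pmod g N_gt0))) AE mean0 /= /unit_fun gN.
  by rewrite mul0r addr0 subrr mul0r addr0.
have A_unit : A \in unitmx.
  rewrite -row_free_unit; apply: inj_row_free => r rA0.
  have rA0E (j : 'I_N) : (r *m A) 0 j = 0 by rewrite rA0 mxE.
  have zU : unit_periodic (fun=> 0) by split.
  have z0 : mean_zero (fun=> 0) by rewrite /mean_zero big1.
  have [mean0 Lr] := key r (fun=> 0) zU z0 rA0E.
  have combr := Lop_injective (combU r) (comb0 r) Lr.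
  apply/rowP => j; rewrite mxE; have := combr j.
  rewrite /comb residue_fun_sum // -/(mean r) mean0 subr0 extE.
  rewrite /unit_fun; have [jN|jN] := boolP (coprime j N); first by rewrite mul1r.
  by have := rA0E j; rewrite AE Lr mean0 /unit_fun (negbTE jN) mul0r subr0 mul1r !add0r.
pose r : 'rV[R]_N := (\row_j u j) *m invmx A.
have rA (j : 'I_N) : (r *m A) 0 j = u j by rewrite /r mulmxKV // mxE.
have [_ Lr] := key r u uU u0 rA.
by exists (comb r).
Qed.

Lemma Psum_bounded u : unit_periodic u -> mean_zero u ->
  exists C, forall x g, (0 < x)%N -> `|Psum x u g| <= C.
Proof.
move=> uU u0; have [h [hU h0 Lh]] := Lop_surjective uU u0.
have [C hC] := Psum_Lop_bounded N_gt0 hU h0; exists C => x g x0.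
by rewrite (_ : u = Lop h) ?hC //; apply/funext => k; rewrite Lh.
Qed.

(** If all primes of the class were at most [B], its sum would be bounded. But [Psum] of
    [residue_fun a] is bounded and equals that sum minus [(ln x + O(1)) / phi], so [ln x / phi]
    would be bounded. *)
Lemma dirichlet_real a B : coprime a N ->
  exists p, [/\ prime p, (B < p)%N & (p = a %[mod N])%N].
Proof.
move=> aN; apply: contrapT => none.
have small p : prime p -> (p %% N)%N = (a %% N)%N -> (p <= B)%N.
  by move=> p_pr pa; rewrite leqNgt; apply/negP => Bp; apply: none; exists p.
have [C1 hC1] := Psum_bounded (residue_fun_periodic a) (residue_fun_mean_zero a).
have [C2 hC2] := mertens_units R N_gt0.
pose C3 : R := 2 + \sum_(1 <= d < B.+1) vonMangoldt R d / d%:R.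
have ge0 d : 0 <= vonMangoldt R d / d%:R by rewrite divr_ge0 ?vonMangoldt_ge0 ?ler0n.
have hC3 x : residue_sum R N x (a %% N)%N <= C3.
  rewrite /residue_sum /C3 (bigID prime) /= addrC; apply: lerD.
    apply: le_trans (sum_prime_powers R x).
    rewrite big_mkcond [X in _ <= X]big_mkcond; apply: ler_sum => d _.
    by case: (prime d); case: ((d %% N)%N == _) => /=; rewrite ?lexx ?ge0.
  have [xB|Bx] := leqP x B.
    rewrite [X in _ <= X](big_cat_nat (n := x.+1)) //= -[X in X <= _]addr0 lerD ?sumr_ge0 //.
    by rewrite big_mkcond; apply: ler_sum => d _; case: ifP; rewrite ?lexx ?ge0.
  rewrite (big_cat_nat (n := B.+1)) //=; last exact: leqW.
  rewrite -[X in _ <= X]addr0; apply: lerD.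
    by rewrite big_mkcond; apply: ler_sum => d _; case: ifP; rewrite ?lexx ?ge0.
  rewrite big_nat_cond big1 // => d /andP[/andP[Bd _] /andP[/eqP da d_pr]].
  by move: Bd; rewrite ltnNge small.
have : phi^-1 = 0.
  apply: (@ln_unbounded _ _ (C3 + C1 + C2 / phi)) => x x0.
  have phiV : 0 < phi^-1 by rewrite invr_gt0 phi_gt0.
  have E : Psum x (residue_fun a) 1 = residue_sum R N x (a %% N)%N - phi^-1 * Psum x unit_fun 1.
    rewrite /Psum /residue_sum [X in _ = X - _]big_mkcond mulr_sumr -sumrB.
    apply: eq_bigr => d _; rewrite mul1n /residue_fun {2}/unit_fun aN mulr1.
    rewrite mulrBr mulrBr; congr (_ - _); last by ring.
    case: eqP => [da|_]; last by rewrite !mulr0.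
    by rewrite /unit_fun -coprime_modl da coprime_modl aN !mulr1.
  have -> : ln x%:R / phi = residue_sum R N x (a %% N)%N - Psum x (residue_fun a) 1
      - (Psum x unit_fun 1 - ln x%:R) / phi by rewrite E; ring.
  have t1 : `|residue_sum R N x (a %% N)%N| <= C3 by rewrite ger0_norm ?residue_sum_ge0.
  have t2 := hC1 x 1%N x0.
  have t3 : `|(Psum x unit_fun 1 - ln x%:R) / phi| <= C2 / phi.
    by rewrite normrM (gtr0_norm phiV); apply: ler_wpM2r (hC2 _ _) => //; exact: ltW.
  apply: le_trans (ler_normB _ _) (le_trans (lerD (le_trans (ler_normB _ _) (lerD t1 t2)) t3) _).
  exact: lexx.
by move/eqP; rewrite invr_eq0 gt_eqF ?phi_gt0.
Qed.

End Dirichlet.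

Lemma dirichlet N a B : (0 < N)%N -> coprime a N ->
  exists p, [/\ prime p, (B < p)%N & p = a %[mod N]].
Proof. by move=> N_gt0; exact: (@dirichlet_real Rdefinitions.R). Qed.

(** * Bounded elementary products and Mennicke symbols *)

(** Gives products by [mulmx] the big operator theory of monoid laws, such as splitting over a
    concatenation. *)
HB.instance Definition _ (R : pzSemiRingType) n :=
  Monoid.isLaw.Build 'M[R]_n 1%:M%R (@mulmx R n n n)
    (@mulmxA R n n n n) (@mul1mx R n n) (@mulmx1 R n n).

Section BoundedProducts.
Local Open Scope ring_scope.
Variable n : nat.
Implicit Types (A B : 'M[int]_n) (S : mxset n) (i j : 'I_n) (r : int).

Lemma prod_of_at_most_le k k' S A : (k <= k')%N ->
  prod_of_at_most k S A -> prod_of_at_most k' S A.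
Proof. by move=> kk' [s [sk hs ->]]; exists s; split=> //; apply: leq_trans sk kk'. Qed.

Lemma prod_of_at_most_sub k S S' A : (forall B, S B -> S' B) ->
  prod_of_at_most k S A -> prod_of_at_most k S' A.
Proof. by move=> SS' [s [sk hs ->]]; exists s; split=> // B /hs /SS'. Qed.

Lemma prod_of_at_most_1 k S : prod_of_at_most k S 1%:M.
Proof. by exists [::]; split=> //; rewrite big_nil. Qed.

Lemma prod_of_at_most_base S A : S A -> prod_of_at_most 1 S A.
Proof.
by move=> SA; exists [:: A]; split=> // [B|]; [rewrite inE => /eqP -> | rewrite big_seq1].
Qed.

Lemma prod_of_at_most_mul k k' S A B : prod_of_at_most k S A -> prod_of_at_most k' S B ->
  prod_of_at_most (k + k') S (A *m B).
Proof.
move=> [s [sk hs ->]] [t [tk ht ->]]; exists (s ++ t); split.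
- by rewrite size_cat leq_add.
- by move=> C; rewrite mem_cat => /orP[/hs|/ht].
- by rewrite big_cat.
Qed.

Lemma elem_mx_mull i j r A x y :
  (elem_mx i j r *m A) x y = A x y + (x == i)%:R * r * A j y.
Proof.
rewrite /elem_mx mulmxDl mul1mx -scalemxAl !mxE; congr (_ + _).
rewrite (bigD1 j) //= big1 => [|k kj]; rewrite !mxE ?(negbTE kj) ?andbF ?mul0r //.
by rewrite eqxx andbT addr0; ring.
Qed.

Lemma elem_mx_mulr i j r A x y :
  (A *m elem_mx i j r) x y = A x y + A x i * r * (y == j)%:R.
Proof.
rewrite /elem_mx mulmxDr mulmx1 -scalemxAr !mxE; congr (_ + _).
rewrite (bigD1 i) //= big1 => [|k ki]; rewrite !mxE ?(negbTE ki) ?mulr0 //.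
by rewrite eqxx addr0 /=; ring.
Qed.

Lemma elem_mxN i j r : i != j -> elem_mx i j r *m elem_mx i j (- r) = 1%:M.
Proof.
move=> ij; apply/matrixP => x y; rewrite elem_mx_mulr /elem_mx !mxE (negbTE ij) andbF.
by case: (x == i); case: (y == j) => /=; ring.
Qed.

Lemma tr_elem_mx i j r : (elem_mx i j r)^T = elem_mx j i r.
Proof. by rewrite /elem_mx linearD linearZ /= trmx1 trmx_delta. Qed.

Variable m : nat.
Local Notation elementary k A := (prod_of_at_most k (@X_set n m) A).

Lemma X_set_elem i j r : i != j -> X_set m (elem_mx i j (m%:Z * r)).
Proof. by move=> ij; exists i, j, (m%:Z * r); rewrite dvdz_mulr. Qed.

Lemma X_set_inv A : X_set m A -> exists2 B, X_set m B & A *m B = 1%:M.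
Proof.
move=> [i [j [r [ij mr ->]]]]; exists (elem_mx i j (- r)); last exact: elem_mxN.
by exists i, j, (- r); rewrite rpredN.
Qed.

Lemma elementary_inv k A B : elementary k A -> A *m B = 1%:M -> elementary k B.
Proof.
move=> [s [sk hs ->]] AB.
suff [C eC CB] : exists2 C, elementary (size s) C & \big[mulmx/1%:M]_(D <- s) D *m C = 1%:M.
  rewrite -[B]mulmx1 -CB mulmxA (mulmx1C AB) mul1mx.
  exact: prod_of_at_most_le eC.
elim: s {sk AB} hs => [|D s IHs] hs; first by exists 1%:M; rewrite ?big_nil ?mulmx1 //; exact: prod_of_at_most_1.
have [E XE DE] := X_set_inv (hs D (mem_head _ _)).
have [|C eC sC] := IHs; first by move=> F Fs; apply: hs; rewrite inE Fs orbT.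
exists (C *m E); last by rewrite big_cons mulmxA -(mulmxA D) sC mulmx1.
by rewrite /= -addn1; apply: prod_of_at_most_mul => //; apply: prod_of_at_most_base.
Qed.

Lemma elementary_tr k A : elementary k A -> elementary k A^T.
Proof.
move=> [s [sk hs ->]]; exists (rev (map trmx s)); split.
- by rewrite size_rev size_map.
- move=> B; rewrite mem_rev => /mapP[C /hs [i [j [r [ij mr ->]]]] ->].
  by exists j, i, r; rewrite eq_sym tr_elem_mx.
- elim: s {sk hs} => [|B s IHs]; first by rewrite !big_nil trmx1.
  by rewrite /= rev_cons -cats1 big_cat big_seq1 big_cons /= trmx_mul IHs.
Qed.

Lemma elementary_mull k i j r A : i != j ->
  elementary k (elem_mx i j (m%:Z * r) *m A) -> elementary k.+1 A.
Proof.
move=> ij h; rewrite -[A]mul1mx -(elem_mxN (- (m%:Z * r)) ij) opprK -mulmxA -add1n.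
apply: prod_of_at_most_mul h; apply: prod_of_at_most_base.
by rewrite -mulrN; apply: X_set_elem.
Qed.

Lemma elementary_mulr k i j r A : i != j ->
  elementary k (A *m elem_mx i j (m%:Z * r)) -> elementary k.+1 A.
Proof.
move=> ij h; rewrite -[A]mulmx1 -(elem_mxN (m%:Z * r) ij) mulmxA -addn1.
apply: (prod_of_at_most_mul h); apply: prod_of_at_most_base.
by rewrite -mulrN; apply: X_set_elem.
Qed.

Lemma elementary_mul_elem k i j r A : i != j -> elementary k A ->
  elementary k.+1 (A *m elem_mx i j (m%:Z * r)).
Proof.
move=> ij h; rewrite -addn1; apply: (prod_of_at_most_mul h).
by apply: prod_of_at_most_base; apply: X_set_elem.
Qed.

Lemma elementary_elem_mul k i j r A : i != j -> elementary k A ->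
  elementary k.+1 (elem_mx i j (m%:Z * r) *m A).
Proof.
move=> ij h; rewrite -add1n; apply: (prod_of_at_most_mul _ h).
by apply: prod_of_at_most_base; apply: X_set_elem.
Qed.

End BoundedProducts.

(** * Two by two blocks inside SL_3 *)

Section Blocks.
Local Open Scope ring_scope.

Definition blk (i j : 'I_3) (a b c d : int) : 'M[int]_3 := \matrix_(x, y)
  if x == i then (if y == i then a else if y == j then b else 0)
  else if x == j then (if y == i then c else if y == j then d else 0)
  else (x == y)%:R.

Ltac ord3 := case=> [[|[|[|?]]] ?] //.
Ltac ord3_entries := apply/matrixP; do 2!ord3;
  rewrite !(mxE, big_ord_recl, big_ord0) /=.

Lemma blk_mul i j a b c d a' b' c' d' : i != j ->
  blk i j a b c d *m blk i j a' b' c' d'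
  = blk i j (a * a' + b * c') (a * b' + b * d') (c * a' + d * c') (c * b' + d * d').
Proof. by move: i j; do 2!ord3; move=> _; ord3_entries; ring. Qed.

Lemma blk_swap i j a b c d : i != j -> blk i j a b c d = blk j i d c b a.
Proof. by move: i j; do 2!ord3; move=> _; ord3_entries. Qed.

Lemma blk_tr i j a b c d : i != j -> (blk i j a b c d)^T = blk i j a c b d.
Proof. by move: i j; do 2!ord3; move=> _; ord3_entries. Qed.

Lemma blk1 i j : i != j -> blk i j 1 0 0 1 = 1%:M.
Proof. by move: i j; do 2!ord3; move=> _; ord3_entries. Qed.

Lemma elem_mx_blk i j r : i != j -> elem_mx i j r = blk i j 1 r 0 1.
Proof. by move: i j; do 2!ord3; move=> _; ord3_entries; ring. Qed.

Lemma ord3_cases (i j k : 'I_3) : i != j -> i != k -> j != k ->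
  forall x, [\/ x = i, x = j | x = k].
Proof.
move=> ij ik jk x; suff /or3P[/eqP|/eqP|/eqP] : [|| x == i, x == j | x == k].
  - by constructor 1.
  - by constructor 2.
  - by constructor 3.
apply: contraTT isT; rewrite !negb_or => /and3P[xi xj xk].
have : (#|[:: x; i; j; k]| <= #|'I_3|)%N by exact: max_card.
rewrite card_ord; have /card_uniqP -> // : uniq [:: x; i; j; k].
by rewrite /= !inE !negb_or xi xj xk ij ik jk.
Qed.

Lemma sum_ord3 (i j k : 'I_3) (F : 'I_3 -> int) : i != j -> i != k -> j != k ->
  \sum_x F x = F i + F j + F k.
Proof.
move=> ij ik jk; rewrite (bigD1 i) //= (bigD1 j) 1?eq_sym //= (bigD1 k) /=.
  rewrite big1 ?addr0 ?addrA // => x /andP[/andP[xi xj] xk].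
  by case: (ord3_cases ij ik jk x) => E; rewrite E eqxx in xi xj xk.
by rewrite ![k == _]eq_sym ik jk.
Qed.

(* Mennicke's computation in SL_3: two symbols with the same diagonal entry [a],
   placed in overlapping blocks, combine into a single one. *)
Lemma blk_mennicke i j k a b1 c1 d1 b2 c2 d2 : i != j -> i != k -> j != k ->
  a * d2 - b2 * c2 = 1 ->
  elem_mx k i (- b2) *m (elem_mx j i (- (c1 * d2)) *m (elem_mx i k (- c2) *m
    (blk i j a b1 c1 d1 *m blk k i a b2 c2 d2))) *m elem_mx i j (- b1)
  = blk k j a (- (b1 * b2)) (c1 * c2) (d1 - b1 * c1 * d2).
Proof.
move=> ij ik jk det2.
have neq := (negbTE ij, negbTE ik, negbTE jk).
have neq' : ((j == i = false) * (k == i = false) * (k == j = false))%type.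
  by rewrite ![_ == i]eq_sym [k == j]eq_sym !neq.
pose N := blk i j a b1 c1 d1 *m blk k i a b2 c2 d2.
have NE x y : N x y = blk i j a b1 c1 d1 x i * blk k i a b2 c2 d2 i y
    + blk i j a b1 c1 d1 x j * blk k i a b2 c2 d2 j y
    + blk i j a b1 c1 d1 x k * blk k i a b2 c2 d2 k y.
  by rewrite /N mxE (sum_ord3 _ ij ik jk).
(* Here the determinant of the second block enters: row [i] becomes [(1, b1, 0)] in the columns [i],
   [j], [k], and its pivot 1 clears the rest. *)
have NB : elem_mx i k (- c2) *m N = \matrix_(x, y)
    if x == i then (if y == i then 1 else if y == j then b1 else 0) else N x y.
  apply/matrixP => x y; rewrite elem_mx_mull !NE [RHS]mxE.
  case: (ord3_cases ij ik jk x) => ->; case: (ord3_cases ij ik jk y) => ->;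
    rewrite ?NE !mxE !(eqxx, neq, neq') /=; try ring.
  by rewrite -[RHS]det2; ring.
rewrite -/N; clearbody N; rewrite NB; apply/matrixP => x y; rewrite elem_mx_mulr !elem_mx_mull.
case: (ord3_cases ij ik jk x) => ->; case: (ord3_cases ij ik jk y) => ->;
  rewrite !mxE !(eqxx, neq, neq') /= ?NE ?mxE ?(eqxx, neq, neq') /=; ring.
Qed.

End Blocks.

(** * Calculus of Mennicke symbols at level [m ^ 2] *)

Section Symbols.
Local Open Scope ring_scope.
Variable m : nat.
Local Notation M := (m%:Z).
Local Notation elementary k A := (prod_of_at_most k (@X_set 3 m) A).
Implicit Types (i j : 'I_3) (a b c d t x y : int) (k : nat).

(* The Mennicke symbol of [(a, b)] at level [m ^ 2] is trivial within [k] factors,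
   in every position and for every completion of the row [(a, m b)]. *)
Definition short_symbol k a b := forall i j c d, i != j -> a * d - M ^+ 2 * b * c = 1 ->
  elementary k (blk i j a (M * b) (M * c) d).

Lemma short_symbol_le k k' a b : (k <= k')%N -> short_symbol k a b -> short_symbol k' a b.
Proof. by move=> kk' h i j c d ij det; apply: prod_of_at_most_le kk' (h _ _ _ _ ij det). Qed.

Lemma blk_mul_elem i j a b c d r : i != j ->
  blk i j a b c d *m elem_mx i j r = blk i j a (b + a * r) c (d + c * r).
Proof. by move=> ij; rewrite elem_mx_blk // blk_mul //; congr blk; ring. Qed.

Lemma blk_mul_elem' i j a b c d r : i != j ->
  blk i j a b c d *m elem_mx j i r = blk i j (a + b * r) b (c + d * r) d.
Proof.
move=> ij; have ji : j != i by rewrite eq_sym.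
by rewrite elem_mx_blk // (blk_swap _ _ _ _ ji) blk_mul //; congr blk; ring.
Qed.

Lemma elem_mul_blk i j a b c d r : i != j ->
  elem_mx j i r *m blk i j a b c d = blk i j a b (c + r * a) (d + r * b).
Proof.
move=> ij; have ji : j != i by rewrite eq_sym.
by rewrite elem_mx_blk // (blk_swap _ _ _ _ ji) blk_mul //; congr blk; ring.
Qed.

Lemma short_symbol_shiftl k a b t :
  short_symbol k (a + M ^+ 2 * t * b) b -> short_symbol k.+1 a b.
Proof.
move=> h i j c d ij det; apply: (@elementary_mulr _ _ _ j i t); first by rewrite eq_sym.
rewrite blk_mul_elem' // (_ : a + _ = a + M ^+ 2 * t * b); last by ring.
rewrite (_ : M * c + _ = M * (c + d * t)); last by ring.
by apply: h => //; rewrite -[RHS]det; ring.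
Qed.

Lemma short_symbol_shiftr k a b t : short_symbol k a (b + t * a) -> short_symbol k.+1 a b.
Proof.
move=> h i j c d ij det; apply: (@elementary_mulr _ _ _ i j t) => //.
rewrite blk_mul_elem // (_ : M * b + _ = M * (b + t * a)); last by ring.
by apply: h => //; rewrite -[RHS]det; ring.
Qed.

(** Two completions of the same first row to determinant 1 differ by a multiple of that row, hence
    by one elementary factor on the left. *)
Lemma short_completion k i j a b c d c' d' : i != j ->
  a * d - M ^+ 2 * b * c = 1 -> a * d' - M ^+ 2 * b * c' = 1 ->
  elementary k (blk i j a (M * b) (M * c') d') -> elementary k.+1 (blk i j a (M * b) (M * c) d).
Proof.
move=> ij det det' h; pose s := c' * d - c * d'.
apply: (@elementary_mull _ _ _ j i s); first by rewrite eq_sym.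
rewrite elem_mul_blk // (_ : M * c + _ = M * c').
  rewrite (_ : d + _ = d') //; apply/eqP; rewrite -subr_eq0 /s; apply/eqP.
  transitivity (d * (1 - (a * d' - M ^+ 2 * b * c')) - d' * (1 - (a * d - M ^+ 2 * b * c))).
    by ring.
  by rewrite det det'; ring.
rewrite /s; apply/eqP; rewrite -subr_eq0; apply/eqP.
transitivity (M * (c * (1 - (a * d' - M ^+ 2 * b * c')) - c' * (1 - (a * d - M ^+ 2 * b * c)))).
  by ring.
by rewrite det det'; ring.
Qed.

Lemma short_symbol_one b : short_symbol 2 1 b.
Proof.
move=> i j c d ij det; have dE : d = 1 + M ^+ 2 * b * c by rewrite -det; ring.
have ji : j != i by rewrite eq_sym.
have -> : blk i j 1 (M * b) (M * c) d = elem_mx j i (M * c) *m (elem_mx i j (M * b) *m 1%:M).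
  rewrite mulmx1 [elem_mx i j _]elem_mx_blk // elem_mul_blk // dE; congr blk; ring.
by do 2!(apply: elementary_elem_mul => //); exact: prod_of_at_most_1.
Qed.

Lemma short_symbol_triv a b t : a = 1 + M ^+ 2 * b * t -> short_symbol 3 a b.
Proof.
move=> ->; apply: (@short_symbol_shiftl _ _ _ (- t)).
rewrite (_ : 1 + M ^+ 2 * b * t + _ = 1); [exact: short_symbol_one | by ring].
Qed.

Lemma third_index (i j : 'I_3) : i != j -> exists2 k, i != k & j != k.
Proof.
move=> ij; have /existsP[k /andP[ik jk]] : [exists k, (i != k) && (j != k)]; last by exists k.
by move: i j ij; do 2!(case=> [[|[|[|?]]] ?] //); move=> _; apply/existsP;
  do ?[by exists ord0 | by exists (lift ord0 ord0) | by exists ord_max].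
Qed.

(** The completions are chosen so that both blocks have the same diagonal [(a, d)]: the other
    parameter is moved into the lower entry. The factor [- M] arises because the combined entry is
    [- (M b1) (M b2)]; 5 counts four elementary factors and one change of completion. *)
Lemma short_symbol_mulm k1 k2 a b1 b2 :
  short_symbol k1 a b1 -> short_symbol k2 a b2 ->
  short_symbol (k1 + k2 + 5) a (- M * b1 * b2).
Proof.
move=> h1 h2 p j c d pj det.
have [i pi ji] := third_index pj.
have ij : i != j by rewrite eq_sym. have ip : i != p by rewrite eq_sym.
have jp : j != p by rewrite eq_sym.
have det1 : a * d - M ^+ 2 * b1 * (- M * b2 * c) = 1 by rewrite -[RHS]det; ring.
have det2 : a * d - M ^+ 2 * b2 * (- M * b1 * c) = 1 by rewrite -[RHS]det; ring.
have det2' : a * d - M * b2 * (M * (- M * b1 * c)) = 1 by rewrite -[RHS]det; ring.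
have A1 := h1 i j _ _ ij det1; have A2 := h2 p i _ _ pi det2.
have := blk_mennicke (M * b1) (M * (- M * b2 * c)) d ij ip jp det2'.
set lhs := _ *m _ *m _ => E.
have sE : elementary (k1 + k2 + 4) lhs.
  rewrite /lhs (_ : - (M * b2) = M * (- b2)); last by ring.
  rewrite (_ : - (M * (- M * b2 * c) * d) = M * (M * b2 * c * d)); last by ring.
  rewrite (_ : - (M * (- M * b1 * c)) = M * (M * b1 * c)); last by ring.
  rewrite (_ : - (M * b1) = M * (- b1)); last by ring.
  rewrite addn4; apply: elementary_mul_elem => //; do 3!(apply: elementary_elem_mul => //).
  exact: prod_of_at_most_mul.
rewrite E in sE; rewrite addnS.
set d' := d - _ in sE.
rewrite (_ : - (M * b1 * (M * b2)) = M * (- M * b1 * b2)) in sE; last by ring.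
rewrite (_ : M * (- M * b2 * c) * (M * (- M * b1 * c)) = M * (M ^+ 3 * b1 * b2 * c ^+ 2)) in sE; last by ring.
apply: (short_completion pj det _ sE); rewrite /d'.
apply/eqP; rewrite -subr_eq0; apply/eqP.
transitivity ((1 + M ^+ 3 * b1 * b2 * c) * (a * d - M ^+ 2 * (- M * b1 * b2) * c - 1)); first by ring.
by rewrite det subrr mulr0.
Qed.

(** A third short symbol, that of [(a, - a')], removes the factor [- M]: the triple product is
    [- M ^ 2 a' b1 b2], which is [b1 b2] modulo [a]. The count is 5 + 5 + 3, and 1 for the shift. *)
Lemma short_symbol_mul k1 k2 a a' b1 b2 : a = 1 + M ^+ 2 * a' ->
  short_symbol k1 a b1 -> short_symbol k2 a b2 -> short_symbol (k1 + k2 + 14) a (b1 * b2).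
Proof.
move=> aE h1 h2; rewrite -[14%N]/(5 + 9)%N addnA addnS.
apply: (@short_symbol_shiftr _ _ _ (- (b1 * b2))).
have hV : short_symbol 3 a (- a') by apply: (@short_symbol_triv _ _ (-1)); rewrite aE; ring.
have := short_symbol_mulm (short_symbol_mulm h1 h2) hV.
rewrite (_ : - M * _ * _ = b1 * b2 + - (b1 * b2) * a); last by rewrite aE; ring.
by rewrite -!addnA.
Qed.

(** Modulo [a = 2 x - 1] the entry [x] becomes [x - a = - M ^ 2 t], a product of three entries with
    short symbols: -1, [M ^ 2] and [t]. *)
Lemma short_symbol_sign x t : x = 1 + M ^+ 2 * t -> short_symbol 54 (2 * x - 1) x.
Proof.
move=> xE; set a := 2 * x - 1; have aE : a = 1 + M ^+ 2 * (2 * t) by rewrite /a xE; ring.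
have h1 : short_symbol 3 a 1 by apply: (@short_symbol_triv _ _ (2 * t)); rewrite aE; ring.
have hN1 : short_symbol 3 a (-1) by apply: (@short_symbol_triv _ _ (- (2 * t))); rewrite aE; ring.
have hM2 : short_symbol 19 a (M ^+ 2).
  have := short_symbol_mulm (short_symbol_mulm h1 h1) h1.
  by rewrite (_ : - M * _ * _ = M ^+ 2) //; ring.
have ht : short_symbol 3 a t by apply: (@short_symbol_triv _ _ 2); rewrite aE; ring.
apply: (@short_symbol_shiftr _ _ _ (-1)).
have := short_symbol_mul aE (short_symbol_mul aE hN1 hM2) ht.
by rewrite (_ : _ * _ * t = x + -1 * a) //; rewrite /a xE; ring.
Qed.

End Symbols.

(** * Powers of a block, by Cayley-Hamilton *)

Section Powers.
Local Open Scope ring_scope.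
Variable m : nat.
Local Notation M := (m%:Z).
Local Notation elementary k A := (prod_of_at_most k (@X_set 3 m) A).
Local Notation short_symbol := (short_symbol m).

Lemma eq_mod_relation (k e u v : int) : e = 1 -> u - v = k * (e - 1) -> u = v.
Proof. by move=> ->; rewrite subrr mulr0 => /eqP; rewrite subr_eq0 => /eqP. Qed.

Variables (i j : 'I_3) (a b c d a1 d1 : int).
Hypothesis ij : i != j.
Hypothesis det : a * d - M ^+ 2 * b * c = 1.
Hypothesis aE : a = 1 + M ^+ 2 * a1.
Hypothesis dE : d = 1 + M ^+ 2 * d1.
Local Notation T := (a + d).
Local Notation A := (blk i j a (M * b) (M * c) d).
Local Notation blkp x y := (blk i j (x * a + y) (M * (x * b)) (M * (x * c)) (x * d + y)).

Lemma blkp_mul x y x' y' :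
  blkp x y *m blkp x' y' = blkp (x * x' * T + x * y' + y * x') (y * y' - x * x').
Proof.
rewrite blk_mul //; congr blk; try ring.
  by apply: (eq_mod_relation (k := - (x * x')) det); ring.
by apply: (eq_mod_relation (k := - (x * x')) det); ring.
Qed.

(** The quadratic relation is the determinant of [x A + y]. Products of off-diagonal entries are
    divisible by [M ^ 2 * b], so modulo it the corner of a power is the power of the corner. *)
Lemma blk_power n : exists x y s, [/\ A ^+ n = blkp x y,
  x ^+ 2 + x * y * T + y ^+ 2 = 1 & x * a + y = a ^+ n + M ^+ 2 * b * s].
Proof.
elim: n => [|n [x [y [s [An q xa]]]]].
  exists 0, 1, 0; split; [|ring|by rewrite expr0; ring].
  rewrite expr0 -[1 : 'M_3]/(1%:M) -(blk1 ij); congr blk; ring.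
exists (x * T + y), (- x), (s * a + c * x); split.
- rewrite exprSr An -[_ * _]/(_ *m _) (_ : A = blkp 1 0); last by congr blk; ring.
  rewrite blkp_mul; congr blk; ring.
- by rewrite -[RHS]q; ring.
- rewrite exprSr; have -> : (x * T + y) * a - x = (x * a + y) * a + x * (a * d - 1) by ring.
  by rewrite xa (_ : a * d - 1 = M ^+ 2 * b * c); [ring | rewrite -det; ring].
Qed.

Lemma a_power n : exists t, a ^+ n = 1 + M ^+ 2 * t.
Proof.
elim: n => [|n [t tE]]; first by exists 0; rewrite expr0; ring.
by exists (a1 + t * a); rewrite exprS tE aE; ring.
Qed.

Lemma power_entry n x y : A ^+ n = blkp x y -> exists t, x * a + y = a ^+ n + M ^+ 2 * b * t.
Proof.
have [x' [y' [s [-> _ xa']]]] := blk_power n => /matrixP /(_ i i).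
by rewrite !mxE eqxx xa' => <-; exists s.
Qed.

Lemma blkp_det x y : x ^+ 2 + x * y * T + y ^+ 2 = 1 ->
  (x * a + y) * (x * d + y) - M ^+ 2 * (x * b) * (x * c) = 1.
Proof.
by move=> q; rewrite -[RHS]q; apply: (eq_mod_relation (k := x ^+ 2) det); ring.
Qed.

(* With [T] the trace, [A ^ n = x A + y] where [x] is a product
   of two factors, modulo each of which the diagonal entry becomes explicit. *)
Lemma even_power_short n s : ~~ odd n -> a ^+ n = 1 + M ^+ 2 * b * s -> elementary 39 (A ^+ n).
Proof.
move=> n_even an; have nE : n = (n./2 + n./2)%N by rewrite addnn even_halfK.
have [x' [y' [s' [Ah q xa']]]] := blk_power n./2.
have [th thE] := a_power n./2.
pose w := x' * T + 2 * y'; pose x := x' * w; pose y := y' ^+ 2 - x' ^+ 2.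
have AnE : A ^+ n = blkp x y.
  by rewrite {1}nE exprD Ah -[_ * _]/(_ *m _) blkp_mul /x /y /w; congr blk; ring.
have qn : x ^+ 2 + x * y * T + y ^+ 2 = 1.
  by rewrite -(expr1n _ 2) -[in RHS]q /x /y /w; ring.
have xy : x + y = 1 + M ^+ 2 * ((a1 + d1) * x' * (x' - y')).
  by rewrite -[1 in RHS]q /x /y /w aE dE; ring.
have xy' : x + y = (x' + y') * w - 1 by rewrite -[1 in RHS]q /x /y /w; ring.
have hz1 : x' + y' = 1 + M ^+ 2 * (th + b * s' - a1 * x').
  have -> : x' + y' = (x' * a + y') - M ^+ 2 * a1 * x' by rewrite aE; ring.
  by rewrite xa' thE; ring.
pose z := x * a + y.
have zE : z = x + y + M ^+ 2 * a1 * x by rewrite /z aE; ring.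
have hxx : short_symbol 3 z x'.
  apply: (@short_symbol_triv _ _ _ ((a1 + d1) * (x' - y') + a1 * w)).
  by rewrite zE xy /x; ring.
(* Modulo [w] the entry [z] is -1. Since [x' + y' = 1] modulo [M ^ 2], an allowed shift turns [z]
   into [w - 1]; then [w] becomes 1, and [w - 1] is 1 modulo [M ^ 2]. *)
have hw : short_symbol 5 z w.
  apply: (@short_symbol_shiftl _ _ _ _ (- (th + b * s' - a1 * x' + a1 * x'))).
  rewrite (_ : z + _ = w - 1); last by rewrite zE xy' hz1 /x; ring.
  apply: (@short_symbol_shiftr _ _ _ _ (-1)).
  rewrite (_ : w + -1 * _ = 1); last by ring.
  apply: (@short_symbol_triv _ _ _ ((a1 + d1) * x' + 2 * (th + b * s' - a1 * x'))).
  have -> : w - 1 = 2 * (x' + y') + (T - 2) * x' - 1 by rewrite /w; ring.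
  by rewrite hz1 aE dE; ring.
have hb : short_symbol 3 z b.
  have [t zb] := power_entry AnE.
  by apply: (@short_symbol_triv _ _ _ (s + t)); rewrite /z zb an; ring.
have [zt ztE] : exists t, z = 1 + M ^+ 2 * t.
  by exists ((a1 + d1) * x' * (x' - y') + a1 * x); rewrite zE xy; ring.
rewrite AnE; have := short_symbol_mul ztE (short_symbol_mul ztE hxx hw) hb.
by apply=> //; exact: blkp_det.
Qed.

(** Same scheme, with [x = x1 * x2]: modulo [x2] the entry [z] is 1, and modulo [x1] it is -1, which
    costs a sign symbol. The symbol of [(z, b)] stays a hypothesis because in the application the
    power of [a] may be -1 modulo [b]. *)
Lemma odd_power_short n kb : odd n ->
  (forall z s, z = a ^+ n + M ^+ 2 * b * s -> short_symbol kb z b) ->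
  elementary (86 + kb) (A ^+ n).
Proof.
move=> n_odd hb; have nE : n = (n./2 + n./2 + 1)%N.
  by rewrite addnn addn1 -[in LHS](odd_double_half n) n_odd add1n.
have [x' [y' [s' [Ah q xa']]]] := blk_power n./2.
have [th thE] := a_power n./2.
pose w := x' * T + 2 * y'.
pose x1 := x' * T + y' - x'; pose x2 := x' * T + y' + x'.
pose x := x1 * x2; pose y := - (x' * w).
have AnE : A ^+ n = blkp x y.
  rewrite {1}nE !exprD Ah expr1 -![_ * _]/(_ *m _) (_ : A = blkp 1 0); last by congr blk; ring.
  by rewrite !blkp_mul /x /y /w /x1 /x2; congr blk; ring.
have qn : x ^+ 2 + x * y * T + y ^+ 2 = 1.
  by rewrite -(expr1n _ 2) -[in RHS]q /x /y /w /x1 /x2; ring.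
have xy : x + y = 1 + M ^+ 2 * ((a1 + d1) * x2 * x').
  by rewrite -[1 in RHS]q /x /y /w /x1 /x2 aE dE; ring.
have xy' : x + y = x1 * w - 1.
  by rewrite -[1 in RHS]q /x /y /w /x1 /x2; ring.
have hz1 : x' + y' = 1 + M ^+ 2 * (th + b * s' - a1 * x').
  have -> : x' + y' = (x' * a + y') - M ^+ 2 * a1 * x' by rewrite aE; ring.
  by rewrite xa' thE; ring.
pose z := x * a + y.
have zE : z = x + y + M ^+ 2 * a1 * x by rewrite /z aE; ring.
have h2 : short_symbol 3 z x2.
  apply: (@short_symbol_triv _ _ _ ((a1 + d1) * x' + a1 * x1)).
  by rewrite zE xy /x; ring.
have [w0 w0E] : exists t, w = 2 + M ^+ 2 * t.
  exists ((a1 + d1) * x' + 2 * (th + b * s' - a1 * x')).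
  have -> : w = 2 * (x' + y') + (T - 2) * x' by rewrite /w; ring.
  by rewrite hz1 aE dE; ring.
(* Because [w = 2] modulo [M ^ 2], a shift brings [z] to [2 * x1 - 1], the shape of
   [short_symbol_sign]. *)
have h1 : short_symbol 55 z x1.
  apply: (@short_symbol_shiftl _ _ _ _ (- (w0 + a1 * x2))).
  rewrite (_ : z + _ = 2 * x1 - 1); last by rewrite zE xy' w0E /x; ring.
  apply: (@short_symbol_sign _ _ (th + b * s' - a1 * x' + (a1 + d1) * x')).
  have -> : x1 = x' + y' + (T - 2) * x' by rewrite /x1; ring.
  by rewrite hz1 aE dE; ring.
have [t zb] := power_entry AnE.
have [zt ztE] : exists t, z = 1 + M ^+ 2 * t.
  by exists ((a1 + d1) * x2 * x' + a1 * x); rewrite zE xy; ring.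
rewrite AnE; have := short_symbol_mul ztE (short_symbol_mul ztE h1 h2) (hb _ _ zb).
rewrite addnC addnA -/x => h; apply: h => //; exact: blkp_det.
Qed.

End Powers.

(** * Fermat, coprime shifts and primes in two progressions *)

Section NumberTheory.
Local Open Scope ring_scope.

Lemma fermat_int (p : nat) (a : int) : prime p -> coprimez a p ->
  exists s, a ^+ p.-1 = 1 + p%:Z * s.
Proof.
move=> p_pr ap; have p_gt0 := prime_gt0 p_pr.
suff : (p%:Z %| a ^+ p.-1 - 1)%Z.
  by move/dvdzP => [s sE]; exists s; rewrite mulrC -sE addrC subrK.
have [r rE] : exists r : nat, (a %% p%:Z)%Z = r.
  have : 0 <= (a %% p%:Z)%Z by rewrite modz_ge0 //; lia.
  by case: (a %% p%:Z)%Z => // r _; exists r.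
rewrite -eqz_mod_dvd; apply/eqP; rewrite -modzXm rE.
have rp : coprime r p.
  by have : coprimez r p by rewrite /coprimez -rE gcdz_modl.
have := Euler_exp_totient rp; rewrite totient_prime // => e.
by rewrite -[r%:Z]natz -natrX natz -[1]/(1%:Z) !modz_nat e.
Qed.

(** Take for [t] the part of [D] prime to [a]. A prime of [D] dividing [a] divides neither [t] nor
    [v]; any other prime of [D] divides [t] but not [a]. Either way it does not divide [a + t v]. *)
Lemma coprime_shift (a v D : int) : D != 0 ->
  (forall p : nat, prime p -> (p %| a)%Z -> (p %| v)%Z -> (p %| D)%Z -> False) ->
  exists t : nat, coprimez (a + t%:Z * v) D.
Proof.
move=> D0 h; have D_gt0 : (0 < `|D|)%N by rewrite absz_gt0.
pose pi : nat_pred := [pred p | (p %| `|a|)%N].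
exists ((absz D)`_pi^')%N; set t := ((absz D)`_pi^')%N.
have t_gt0 : (0 < t)%N by rewrite part_gt0.
apply: contraT => nco; rewrite coprimezE /coprime in nco.
set w := a + t%:Z * v in nco *.
have g_gt1 : (1 < gcdn (absz w) (absz D))%N by rewrite ltn_neqAle eq_sym nco gcdn_gt0 D_gt0 orbT.
set p := pdiv _ in (p_pr := pdiv_prime g_gt1).
have := pdiv_dvd (gcdn (absz w) (absz D)); rewrite -/p dvdn_gcd => /andP[p1 pD].
have p1' : (p %| a + t%:Z * v)%Z by [].
have [pa|pa] := boolP (p %| `|a|)%N; exfalso.
  apply: (h p p_pr) => //.
  have : (p %| t%:Z * v)%Z by rewrite (_ : _ * v = w - a) ?rpredB //; rewrite /w; ring.
  rewrite Gauss_dvdzr // coprimezE /= prime_coprime //; apply/negP => pt.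
  have := pnatPpi (part_pnat pi^' `|D|); move=> /(_ p).
  by rewrite mem_primes p_pr t_gt0 pt !inE pa => /(_ isT).
have pt : (p %| t)%N.
  move: pD; rewrite -(partnC pi D_gt0) Euclid_dvdM // => /orP[pDpi|//].
  have := pnatPpi (part_pnat pi `|D|); move=> /(_ p).
  by rewrite mem_primes p_pr part_gt0 pDpi inE (negbTE pa) => /(_ isT).
case/negP: pa; have : (p %| a)%Z; last by [].
by rewrite (_ : a = w - t%:Z * v) ?rpredB ?dvdz_mulr //; rewrite /w; ring.
Qed.

Lemma dirichlet_int (u a : int) (k B : nat) : a != 0 -> (0 < k)%N -> coprimez u a ->
  coprimez a k ->
  exists p : nat, [/\ prime p, (B < p)%N & (exists s, p%:Z = u + a * s) /\
    (exists t, p%:Z = -1 + k%:Z * t)].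
Proof.
move=> a0 k0 ua ak.
pose x := zchinese a k%:Z u (-1).
have xa : (x = u %[mod a])%Z by rewrite zchinese_modl.
have xk : (x = -1 %[mod k%:Z])%Z by rewrite zchinese_modr.
pose N := (`|a| * k)%N.
have N_gt0 : (0 < N)%N by rewrite muln_gt0 absz_gt0 a0.
have NZ : N%:Z != 0 by lia.
have aN : (a %| N%:Z)%Z by rewrite dvdzE /= dvdn_mulr.
have kN : (k%:Z %| N%:Z)%Z by rewrite dvdzE /= dvdn_mull.
have [r rE] : exists r : nat, (x %% N%:Z)%Z = r.
  have : 0 <= (x %% N%:Z)%Z by rewrite modz_ge0.
  by case: (x %% N%:Z)%Z => // r _; exists r.
have rx : (N%:Z %| r%:Z - x)%Z by rewrite -eqz_mod_dvd -rE modz_mod.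
have ra : (a %| r%:Z - u)%Z.
  rewrite -(subrKA x) rpredD //; first exact: dvdz_trans rx.
  by rewrite -eqz_mod_dvd xa.
have rk : (k%:Z %| r%:Z - -1)%Z.
  rewrite -(subrKA x) rpredD //; first exact: dvdz_trans rx.
  by rewrite -eqz_mod_dvd xk.
have rN : coprime r N.
  rewrite coprimeMr; apply/andP; split.
    have : coprimez r a; last by rewrite coprimezE.
    have /dvdzP[s sE] := ra; have -> : r%:Z = s * a + u by rewrite -sE subrK.
    by rewrite coprimez_sym /coprimez gcdzMDl -/(coprimez _ _) coprimez_sym.
  have : coprimez r k; last by rewrite coprimezE.
  have /dvdzP[s sE] := rk; have -> : r%:Z = s * k%:Z + -1 by rewrite -sE; ring.
  by rewrite coprimez_sym /coprimez gcdzMDl -/(coprimez _ _) coprimezN coprimezE coprimen1.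
have [p [p_pr Bp pr]] := dirichlet B N_gt0 rN.
have pN : (N%:Z %| p%:Z - r%:Z)%Z by rewrite -eqz_mod_dvd !modz_nat pr.
exists p; split=> //; split.
  have /dvdzP[s sE] : (a %| p%:Z - u)%Z.
    by rewrite -(subrKA r%:Z) rpredD //; apply: dvdz_trans pN.
  by exists s; rewrite mulrC -sE addrC subrK.
have /dvdzP[s sE] : (k%:Z %| p%:Z - -1)%Z.
  by rewrite -(subrKA r%:Z) rpredD //; apply: dvdz_trans pN.
by exists s; rewrite mulrC -sE; ring.
Qed.

End NumberTheory.

(** * A bound for all symbols, uniform in [m] *)

Section AllSymbolsShort.
Local Open Scope ring_scope.
Variable m : nat.
Hypothesis m_gt0 : (0 < m)%N.
Local Notation M := (m%:Z).
Local Notation elementary k A := (prod_of_at_most k (@X_set 3 m) A).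
Local Notation short_symbol := (short_symbol m).
Implicit Types (a b c d : int).

Lemma Bezout_coprimez (u v a b : int) : u * a + v * b = 1 -> coprimez a b.
Proof. by move=> h; apply/coprimezP; exists (u, v). Qed.

Lemma exp_congr (e k r : int) n : exists s, (e + k * r) ^+ n = e ^+ n + k * s.
Proof.
elim: n => [|n [s sE]]; first by exists 0; rewrite !expr0; ring.
by exists (r * e ^+ n + e * s + k * r * s); rewrite !exprS sE; ring.
Qed.

Lemma trmx_exp (A : 'M[int]_3) n : (A ^+ n)^T = A^T ^+ n.
Proof.
elim: n => [|n IHn]; first by rewrite !expr0 trmx1.
by rewrite exprS exprSr -[A * _]/(A *m _) trmx_mul IHn.
Qed.

Lemma exp_cancel (A B : 'M[int]_3) n : A *m B = 1%:M -> A ^+ n *m B ^+ n = 1%:M.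
Proof.
move=> AB; elim: n => [|n IHn]; first by rewrite !expr0; exact: mulmx1.
by rewrite exprSr exprS -[_ * _]/(_ *m _) -[B * _]/(_ *m _) mulmxA -(mulmxA _ A) AB mulmx1.
Qed.

Lemma short_symbol_prime a a1 b (p : nat) t : a = 1 + M ^+ 2 * a1 -> prime p -> b = - p%:Z ->
  p%:Z = -1 + 4 * M ^+ 2 * t -> coprimez a p./2 -> short_symbol 181 a b.
Proof.
move=> aE p_pr bE pE aN1 i j c d ij det.
have bE' : b = 1 + M ^+ 2 * (- 4 * t) by rewrite bE pE; ring.
have p_odd : odd p.
  have : p%:Z = -1 + 2 * (2 * M ^+ 2 * t) by rewrite pE; ring.
  by move: (2 * M ^+ 2 * t) => w; lia.
set N1 := p./2 in aN1 *.
have N1_odd : odd N1.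
  have : p%:Z = -1 + 4 * (M ^+ 2 * t) by rewrite pE; ring.
  by rewrite /N1; move: (M ^+ 2 * t) => w; lia.
have N1_gt0 : (0 < N1)%N by case: N1 N1_odd {aN1}.
have pE2 : p.-1 = (N1 * 2)%N by rewrite /N1; lia.
have aMb : coprimez a (M ^+ 2 * b) by apply: (@Bezout_coprimez d (- c)); rewrite -[RHS]det; ring.
have ab : coprimez a b by move: aMb; rewrite coprimezMr => /andP[].
have a_neq0 : a != 0.
  apply: contraTneq ab => ->; rewrite bE coprimezN coprimezE /coprime gcd0n.
  by have := prime_gt1 p_pr; rewrite /=; case: (p) => [|[|]].
have ca : coprimez c a by apply: (@Bezout_coprimez (- M ^+ 2 * b) d); rewrite -[RHS]det; ring.
(* [p' = c] modulo [a] lets [p'] replace [c] in a completion; [p' = -1] modulo [N1] makes [p' - 1]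
   prime to the odd [N1]; [p' > m + 2] makes [p'] odd and prime to [m]. *)
have [p' [p'_pr mp' [[s sE] [t' tE]]]] := dirichlet_int (m + 2) a_neq0 N1_gt0 ca aN1.
pose c' := p'%:Z; pose d' := d + M ^+ 2 * b * s.
have det' : a * d' - M ^+ 2 * b * c' = 1 by rewrite /c' sE /d' -[RHS]det; ring.
apply: (short_completion ij det det').
set A := blk i j a (M * b) (M * c') d'.
have d'E : d' = 1 + M ^+ 2 * (b * c' - a1 * d').
  have -> : 1 + M ^+ 2 * (b * c' - a1 * d') = (a * d' - M ^+ 2 * b * c') + M ^+ 2 * (b * c' - a1 * d').
    by rewrite det'.
  by rewrite aE; ring.
have p'_odd : odd p' by case: (even_prime p'_pr) => // p'2; lia.
have N12 : coprime N1 p'.-1.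
  have : coprimez N1 p'.-1; last by rewrite coprimezE.
  have -> : p'.-1%:Z = t' * N1%:Z + - 2.
    have -> : p'.-1%:Z = p'%:Z - 1 by have := prime_gt0 p'_pr; lia.
    by rewrite tE; ring.
  by rewrite /coprimez gcdzMDl -/(coprimez _ _) coprimezN coprimezE coprimen2.
have [u v uv _] := egcdnP p'.-1 N1_gt0.
rewrite (eqP N12) in uv.
(* Transposition puts [c' = p'] in the role of [b]. The power of [a] is 1 modulo [p'] by Fermat and
   modulo [M ^ 2] because [a] is, and these moduli are coprime. *)
have even_part : elementary 39 (A ^+ (v * p'.-1)).
  rewrite -[A ^+ _]trmxK; apply: elementary_tr; rewrite trmx_exp blk_tr //.
  have [s0 s0E] : exists s0, a ^+ p'.-1 = 1 + p'%:Z * s0.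
    apply: fermat_int => //; apply: (@Bezout_coprimez d' (- M ^+ 2 * b)).
    by rewrite -[RHS]det'; ring.
  have [s1 s1E] := exp_congr 1 p'%:Z s0 v.
  have [s2 s2E] := a_power aE (v * p'.-1).
  have aV : a ^+ (v * p'.-1) = 1 + p'%:Z * s1 by rewrite mulnC exprM s0E s1E expr1n.
  have : (M ^+ 2 %| s1)%Z.
    rewrite -(@Gauss_dvdzr _ p'%:Z).
      by apply/dvdzP; exists s2; apply: (addrI 1); rewrite -aV s2E; ring.
    rewrite coprimezXl // coprimezE coprime_sym prime_coprime // gtnNdvd //.
    by move: mp'; lia.
  move=> /dvdzP[s3 s3E].
  apply: (@even_power_short m i j a c' b d' a1 _ ij _ aE d'E _ s3).
  - by rewrite -[RHS]det'; ring.
  - by rewrite oddM negb_and; apply/orP; right; have := prime_gt0 p'_pr; lia.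
  - by rewrite aV s3E /c'; ring.
have odd_part : elementary 141 (A ^+ (u * N1)).
  apply: (@odd_power_short m i j a b c' d' a1 _ ij det' aE d'E _ 55).
    rewrite uv addn1 /= oddM negb_and; apply/orP; right.
    by have := prime_gt0 p'_pr; lia.
  move=> z s' zE.
  have u_odd : odd u.
    have : odd (u * N1) by rewrite uv addn1 /= oddM negb_and; apply/orP; right;
      have := prime_gt0 p'_pr; lia.
    by rewrite oddM => /andP[].
  have [zt ztE] : exists zt, z = 1 + M ^+ 2 * zt.
    by have [w wE] := a_power aE (u * N1); exists (w + b * s'); rewrite zE wE; ring.
  have [s0 s0E] : exists s0, a ^+ p.-1 = 1 + p%:Z * s0.
    by apply: fermat_int => //; move: ab; rewrite bE coprimezN.
  have : (p%:Z %| (a ^+ N1 - 1) * (a ^+ N1 + 1))%Z.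
    by apply/dvdzP; exists s0; rewrite -subr_sqr expr1n -exprM -pE2 s0E; ring.
  (* In the first case [z] is 1 modulo [b] and modulo [M ^ 2], hence modulo [M ^ 2 * b], as [b = 1]
     modulo [M ^ 2]. In the second, with [u] odd, [z] is -1 modulo [b], so it is [2 * b - 1] modulo
     [M ^ 2 * b]. *)
  rewrite dvdzE abszM Euclid_dvdM // => /orP[pd|pd].
    have /dvdzP[r rE] : (p%:Z %| a ^+ N1 - 1)%Z by [].
    have [r' r'E] := exp_congr 1 p%:Z r u.
    have aV : a ^+ (u * N1) = 1 + p%:Z * r'.
      by rewrite mulnC exprM (_ : a ^+ N1 = 1 + p%:Z * r) ?r'E ?expr1n // mulrC -rE; ring.
    pose y := - r' + M ^+ 2 * s'.
    have zy : z = 1 + b * y by rewrite zE aV /y bE; ring.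
    have yE : y = M ^+ 2 * (zt - (- 4 * t) * y).
      have : b * y = M ^+ 2 * zt by apply: (addrI 1); rewrite -zy.
      by rewrite {1}bE' => h; rewrite mulrBr -h; ring.
    apply: short_symbol_le (short_symbol_triv (t := zt - (- 4 * t) * y) _) => //.
    by rewrite zy {1}yE; ring.
  have /dvdzP[r rE] : (p%:Z %| a ^+ N1 + 1)%Z by [].
  have [r' r'E] := exp_congr (-1) p%:Z r u.
  have aV : a ^+ (u * N1) = -1 + p%:Z * r'.
    rewrite mulnC exprM (_ : a ^+ N1 = -1 + p%:Z * r) ?r'E; last by rewrite mulrC -rE; ring.
    by rewrite -signr_odd u_odd expr1.
  pose y := - r' + M ^+ 2 * s' - 2.
  have zy : z = 2 * b - 1 + b * y by rewrite zE aV /y bE; ring.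
  pose e := zt - 2 * (- 4 * t).
  have yE : y = M ^+ 2 * (e - (- 4 * t) * y).
    have : b * y = M ^+ 2 * e.
      apply: (addrI (2 * b - 1)); rewrite -zy ztE {1}bE' /e; ring.
    by rewrite {1}bE' => h; rewrite mulrBr -h; ring.
  apply: (@short_symbol_shiftl _ _ _ _ (- (e - (- 4 * t) * y))).
  rewrite (_ : z + _ = 2 * b - 1); first exact: short_symbol_sign bE'.
  by rewrite zy {1}yE; ring.
have AA' : A *m blk i j d' (M * - b) (M * - c') a = 1%:M.
  by rewrite blk_mul // -(blk1 ij); congr blk; rewrite -?[RHS]det'; ring.
have inv := exp_cancel (v * p'.-1) AA'.
(* From [u * N1 = v * p'.-1 + 1]. The total 181 is 39 + 141 and one change of completion. *)
have -> : A = blk i j d' (M * - b) (M * - c') a ^+ (v * p'.-1) *m A ^+ (u * N1).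
  by rewrite uv addn1 exprSr -[A ^+ _ * A]/(_ *m _) mulmxA (mulmx1C inv) mul1mx.
apply: (@prod_of_at_most_mul _ 39 141) => //.
exact: elementary_inv even_part inv.
Qed.

(** One shift makes [b] the negative of a prime [p = -1] modulo [4 M ^ 2], which requires [a] odd
    for the congruences to be compatible; a second makes [a] prime to [p./2]. *)
Lemma short_symbol_odd a a1 b : a = 1 + M ^+ 2 * a1 -> coprimez a 2 -> coprimez a b ->
  short_symbol 183 a b.
Proof.
move=> aE a2 ab.
have aM : coprimez a (M ^+ 2) by apply: (@Bezout_coprimez 1 (- a1)); rewrite aE; ring.
have a_neq0 : a != 0 by apply: contraTneq a2 => ->.
have ua : coprimez (- b) a by rewrite coprimezE abszN -coprimezE coprimez_sym.
have ak : coprimez a (4 * (m * m))%N.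
  have -> : (4 * (m * m))%N%:Z = 2 * 2 * M ^+ 2 by rewrite !PoszM; ring.
  by rewrite 2!coprimezMr a2 aM.
have k_gt0 : (0 < 4 * (m * m))%N by rewrite !muln_gt0 m_gt0.
have [p [p_pr _ [[s sE] [t tE]]]] := dirichlet_int 0 a_neq0 k_gt0 ua ak.
have pE : p%:Z = -1 + 4 * M ^+ 2 * t by rewrite tE !PoszM; ring.
apply: (@short_symbol_shiftr _ _ _ _ (- s)).
rewrite (_ : b + _ = - p%:Z); last by rewrite sE; ring.
have N1_neq0 : p./2%:Z != 0.
  have : p%:Z = -1 + 4 * (M ^+ 2 * t) by rewrite pE; ring.
  by have := prime_gt1 p_pr; move: (M ^+ 2 * t) => w; lia.
have ap : coprimez a p.
  have : coprimez a (- s * a + b).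
    by rewrite /coprimez gcdzMDl.
  by rewrite (_ : _ + b = - p%:Z) ?coprimezN //; rewrite sE; ring.
have [|t' at'] := coprime_shift (a := a) (v := M ^+ 2 * - p%:Z) N1_neq0.
  move=> l l_pr la lv _.
  have : coprimez a (M ^+ 2 * - p%:Z) by rewrite coprimezMr aM coprimezN.
  rewrite coprimezE /coprime => /eqP g1.
  have : (l %| gcdn (absz a) (absz (M ^+ 2 * - p%:Z)%R))%N by rewrite dvdn_gcd; apply/andP.
  by rewrite g1 dvdn1 => /eqP l1; rewrite l1 in l_pr.
apply: (@short_symbol_shiftl _ _ _ _ t').
rewrite (_ : a + _ = a + t'%:Z * (M ^+ 2 * - p%:Z)); last by ring.
apply: (short_symbol_prime (a1 := a1 + t'%:Z * - p%:Z) _ p_pr _ pE) => //.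
by rewrite {1}aE; ring.
Qed.

Lemma short_symbol_all a a1 b : a = 1 + M ^+ 2 * a1 -> coprimez a b -> short_symbol 184 a b.
Proof.
move=> aE ab; have [a2|a2] := boolP (coprimez a 2).
  by apply: short_symbol_le (short_symbol_odd aE a2 ab).
apply: (@short_symbol_shiftl _ _ _ _ 1); apply: (short_symbol_odd (a1 := a1 + b)).
- by rewrite aE; ring.
- move: a2 ab; rewrite !coprimezE !coprimen2 => a2 ab.
  have b2 : odd (absz b).
    apply: contraT => b2; move: ab; rewrite /coprime => /eqP g1.
    have : (2 %| gcdn (absz a) (absz b))%N by rewrite dvdn_gcd !dvdn2 a2 b2.
    by rewrite g1.
  have M2 : odd m.
    apply: contraT => m2; move: a2; rewrite aE.
    have -> : m = (m./2 * 2)%N by lia.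
    by rewrite PoszM; move: (m./2) => h; lia.
  have : odd (absz (M ^+ 2 * b)) by rewrite abszM abszX oddM oddX M2 b2.
  by move: (M ^+ 2) a2 => M' a2; rewrite mulr1; move: (M' * b) => w; lia.
have [[u v] /= uv] := coprimezP _ _ ab.
apply: (@Bezout_coprimez u (v - u * M ^+ 2)); rewrite -[RHS]uv; ring.
Qed.

End AllSymbolsShort.

(** * Reduction to size three *)

Section Reduction.
Local Open Scope ring_scope.
Variable m : nat.
Local Notation M := (m%:Z).
Local Notation elementary k A := (prod_of_at_most k (@X_set _ m) A).

Lemma lift0_mxE n (A : 'M[int]_n) :
  let L : 'M_n.+1 := lift0_mx A in
  [/\ forall i j, L (lift ord0 i) (lift ord0 j) = A i j, forall i, L (lift ord0 i) ord0 = 0,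
      forall j, L ord0 (lift ord0 j) = 0 & L ord0 ord0 = 1].
Proof.
move=> L; have ul : @lshift 1 n 0 = ord0 by exact: val_inj.
split=> [i j|i|j|].
- by have := @block_mxEdr _ 1 n 1 n 1 0 0 A i j; rewrite !rshift1.
- by have := @block_mxEdl _ 1 n 1 n 1 0 0 A i 0; rewrite !rshift1 ul [RHS]mxE.
- by have := @block_mxEur _ 1 n 1 n 1 0 0 A 0 j; rewrite !rshift1 ul [RHS]mxE.
- by have := @block_mxEul _ 1 n 1 n 1 0 0 A 0 0; rewrite ul [RHS]mxE eqxx.
Qed.

Lemma bezout_sum n (w : 'I_n -> int) :
  exists D c, D = \sum_i c i * w i /\ forall i, (D %| w i)%Z.
Proof.
elim: n w => [|n IHn] w; first by exists 0, (fun=> 0); split=> [|[]//]; rewrite big_ord0.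
have [D [c [DE Dw]]] := IHn (fun i => w (lift ord0 i)).
have [u [v uv]] := Bezoutz (w ord0) D.
exists (gcdz (w ord0) D), (fun i => if unlift ord0 i is Some i' then v * c i' else u).
split=> [|i].
  rewrite big_ord_recl unlift_none -uv DE mulr_sumr; congr (_ + _).
  by apply: eq_bigr => i _; rewrite liftK mulrA.
case: (unliftP ord0 i) => [i'|] ->; last exact: dvdz_gcdl.
exact: dvdz_trans (dvdz_gcdr _ _) (Dw i').
Qed.

(** A stable range condition for the integers: [coprime_shift] makes the first [w] prime to the gcd
    [D] of the others. If [D = 0] the others vanish, and [v0] itself is added to one of them; this
    is why [w] needs at least two entries. *)
Lemma unimodular_shift n (v0 x0 : int) (w y : 'I_n.+2 -> int) :
  v0 * x0 + \sum_i w i * y i = 1 ->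
  exists j t c, \sum_i c i * (w i + (i == j)%:R * t * v0) = 1.
Proof.
move=> h1; have [D [c [DE Dw]]] := bezout_sum (fun i => w (lift ord0 i)).
have [D0|D0] := eqVneq D 0.
  have w0 i : w (lift ord0 i) = 0.
    by have := Dw i; rewrite D0 => /dvdzP[q]; rewrite mulr0.
  exists (lift ord0 ord0), 1, (fun i => if i == ord0 then y ord0 else if i == lift ord0 ord0 then x0 else 0).
  rewrite !big_ord_recl big1 => [|i _] /=; last by rewrite mul0r.
  rewrite -[RHS]h1 big_ord_recl big1 => [|i _]; last by rewrite w0 mul0r.
  by rewrite w0; ring.
have [p p_pr pw pv pD|t] := coprime_shift (a := w ord0) (v := v0) D0.
  have : (p %| (1 : int))%Z.
    rewrite -h1 rpredD ?dvdz_mulr // big_ord_recl rpredD ?dvdz_mulr //.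
    by apply: rpred_sum => i _; rewrite dvdz_mulr // (dvdz_trans pD).
  by rewrite dvdz1 /= => /eqP p1; rewrite p1 in p_pr.
move=> /coprimezP[[u v] /= uv].
exists ord0, t%:Z, (fun i => if unlift ord0 i is Some i' then v * c i' else u).
rewrite big_ord_recl unlift_none eqxx -[RHS]uv DE mulr_sumr; congr (_ + _); first by rewrite /=; ring.
by apply: eq_bigr => i _; rewrite liftK [_ == ord0]eq_sym (negbTE (neq_lift _ _)) /=; ring.
Qed.

Lemma det_elem_mx n (i j : 'I_n) r : i != j -> \det (elem_mx i j r) = 1.
Proof.
have low (i' j' : 'I_n) : (j' < i')%N -> \det (elem_mx i' j' r) = 1.
  move=> ji; rewrite det_trig.
    rewrite big1 // => x _; rewrite !mxE eqxx.
    case: (x =P i') => [->|_] /=; last by rewrite mulr0 addr0.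
    by rewrite -val_eqE (gtn_eqF ji) mulr0 addr0.
  apply/is_trig_mxP => x y xy; rewrite !mxE -val_eqE (ltn_eqF xy) /=.
  case: (x =P i') => [xi|_] /=; last by rewrite mulr0 addr0.
  by case: (y =P j') => [yj|_] /=; [move: xy; rewrite xi yj => xy; lia | rewrite mulr0 addr0].
move=> ij; case: (ltngtP j i) => [/low//|ji|/val_inj ji].
  by rewrite -det_tr tr_elem_mx low.
by rewrite ji eqxx in ij.
Qed.

(** The last diagonal entry is left free because the conjugated generators correct only the
    others. *)
Definition quasi_congruent n (A : 'M[int]_n) :=
  [/\ \det A = 1, forall i j, i != j -> (M %| A i j)%Z &
      forall i : 'I_n, (i.+1 < n)%N -> (M ^+ 2 %| A i i - 1)%Z].

Lemma size_index_enum_ord n : size (index_enum 'I_n) = n.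
Proof.
rewrite -(card_uniqP (index_enum_uniq _)) -[RHS]card_ord.
by apply: eq_card => i; rewrite mem_index_enum.
Qed.

Lemma add_columns_to_first n (r : 'I_n -> int) (A : 'M[int]_n.+1) :
  exists B : 'M[int]_n.+1, [/\ \det B = \det A,
    forall x y, B x y = A x y + (y == ord0)%:R * \sum_i A x (lift ord0 i) * (M * r i) &
    forall k, elementary k B -> elementary (k + n) A].
Proof.
suff [B [dB BE hB]] : exists B : 'M[int]_n.+1, [/\ \det B = \det A,
    forall x y, B x y = A x y
       + (y == ord0)%:R * \sum_(i <- index_enum 'I_n) A x (lift ord0 i) * (M * r i) &
    forall k, elementary k B -> elementary (k + size (index_enum 'I_n)) A].
  by exists B; split=> // k /hB; rewrite size_index_enum_ord.
elim: (index_enum 'I_n) => [|i s [B [dB BE hB]]].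
  by exists A; split=> // [x y|k]; rewrite ?big_nil ?mulr0 ?addr0 ?addn0.
exists (B *m elem_mx (lift ord0 i) ord0 (M * r i)); split.
- by rewrite det_mulmx det_elem_mx ?mulr1 // eq_sym neq_lift.
- move=> x y; rewrite elem_mx_mulr !BE big_cons [lift _ _ == _]eq_sym (negbTE (neq_lift _ _)) /=.
  by case: (y == ord0) => /=; ring.
- move=> k /elementary_mulr h; rewrite addnS -addSn; apply: hB; apply: h.
  by rewrite eq_sym neq_lift.
Qed.

Lemma add_first_column n (r : 'I_n -> int) (A : 'M[int]_n.+1) :
  exists B : 'M[int]_n.+1, [/\ \det B = \det A,
    forall x, B x ord0 = A x ord0,
    forall x i, B x (lift ord0 i) = A x (lift ord0 i) + A x ord0 * (M * r i) &
    forall k, elementary k B -> elementary (k + n) A].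
Proof.
suff [B [dB B0 BE hB]] : exists B : 'M[int]_n.+1, [/\ \det B = \det A,
    forall x, B x ord0 = A x ord0,
    forall x i, B x (lift ord0 i) = A x (lift ord0 i)
       + \sum_(j <- index_enum 'I_n) A x ord0 * (M * r j) * (i == j)%:R &
    forall k, elementary k B -> elementary (k + size (index_enum 'I_n)) A].
  exists B; split=> // [x i|k /hB]; last by rewrite size_index_enum_ord.
  rewrite BE (bigD1 i) //= eqxx mulr1 big1 ?addr0 // => j ji.
  by rewrite eq_sym (negbTE ji) mulr0.
elim: (index_enum 'I_n) => [|j s [B [dB B0 BE hB]]].
  by exists A; split=> // [x y|k]; rewrite ?big_nil ?addr0 ?addn0.
exists (B *m elem_mx ord0 (lift ord0 j) (M * r j)); split.
- by rewrite det_mulmx det_elem_mx ?mulr1 // neq_lift.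
- by move=> x; rewrite elem_mx_mulr B0 (negbTE (neq_lift _ _)) mulr0 addr0.
- move=> x i; rewrite elem_mx_mulr B0 BE big_cons (inj_eq lift_inj).
  by ring.
- move=> k /elementary_mulr h; rewrite addnS -addSn; apply: hB; apply: h.
  exact: neq_lift.
Qed.

Lemma elementary_lift n k (A : 'M[int]_n) : elementary k A -> elementary k (lift0_mx A : 'M_n.+1).
Proof.
move=> [s [sk hs ->]]; exists [seq (lift0_mx B : 'M_n.+1) | B <- s]; split.
- by rewrite size_map.
- move=> _ /mapP[B /hs [i [j [r [ij mr ->]]]] ->].
  exists (lift ord0 i), (lift ord0 j), r; split=> //.
  have [Lij Li0 L0j L00] := lift0_mxE (elem_mx i j r); apply/matrixP => x y.
  case: (unliftP ord0 x) => [x'|] ->; case: (unliftP ord0 y) => [y'|] ->;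
    rewrite ?Lij ?Li0 ?L0j ?L00 !mxE ?(inj_eq lift_inj) //.
  + by rewrite [_ == ord0]eq_sym !(negbTE (neq_lift _ _)) andbF mulr0.
  + by rewrite !(negbTE (neq_lift _ _)) mulr0.
  + by rewrite eqxx !(negbTE (neq_lift _ _)) mulr0.
- elim: s {sk hs} => [|B s IHs]; first by rewrite !big_nil /lift0_mx -scalar_mx_block.
  rewrite /= !big_cons -IHs; set P := \big[_/_]_(_ <- s) _.
  have := @mulmx_block _ 1 n 1 n 1 n 1 0 0 B 1 0 0 P.
  by rewrite !(mulmx0, mul0mx, mulmx1, addr0, add0r).
Qed.

Lemma quasi_congruent_step n (A : 'M[int]_n.+3) : quasi_congruent A ->
  exists A' : 'M[int]_n.+2, quasi_congruent A' /\
    forall k, elementary k (lift0_mx A' : 'M_n.+3) -> elementary (k + (3 * n.+2 + 1)) A.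
Proof.
case=> dA offA diagA; have A0 x : (M %| A (lift ord0 x) ord0)%Z.
  by apply: offA; rewrite eq_sym neq_lift.
have rowE (i : 'I_n.+2) : exists w, A ord0 (lift ord0 i) = M * w.
  have /dvdzP[w ->] : (M %| A ord0 (lift ord0 i))%Z by apply: offA; exact: neq_lift.
  by exists w; rewrite mulrC.
have [w wE] := choice rowE.
have uni : A ord0 ord0 * \adj A ord0 ord0 + \sum_i w i * (M * \adj A (lift ord0 i) ord0) = 1.
  have : (A *m \adj A) ord0 ord0 = 1 by rewrite mul_mx_adj dA !mxE eqxx.
  rewrite mxE big_ord_recl => h; rewrite -[RHS]h; congr (_ + _); apply: eq_bigr => i _.
  by rewrite wE; ring.
have [j0 [t [c cE]]] := unimodular_shift uni.
have /dvdzP[alpha alphaE] : (M ^+ 2 %| A ord0 ord0 - 1)%Z by apply: diagA.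
have v0E : A ord0 ord0 = 1 + M ^+ 2 * alpha by rewrite mulrC -alphaE addrC subrK.
pose A1 := A *m elem_mx ord0 (lift ord0 j0) (M * t).
pose w1 i := w i + (i == j0)%:R * t * A ord0 ord0.
have A1E x y : A1 x y = A x y + A x ord0 * (M * t) * (y == lift ord0 j0)%:R.
  exact: elem_mx_mulr.
have A1w i : A1 ord0 (lift ord0 i) = M * w1 i.
  by rewrite A1E wE (inj_eq lift_inj) /w1; ring.
have A1x x : A1 x ord0 = A x ord0.
  by rewrite A1E (negbTE (neq_lift _ _)) mulr0 addr0.
(* The shifted row is [M] times the unimodular [w1], so these multiples subtract exactly
   [M ^ 2 * alpha] from the corner, which becomes 1. *)
have [A2 [dA2 A2E hA2]] := add_columns_to_first (fun i => - alpha * c i) A1.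
have A200 : A2 ord0 ord0 = 1.
  rewrite A2E A1x eqxx mul1r (eq_bigr (fun i => - (M ^+ 2 * alpha) * (c i * w1 i))).
    by rewrite -mulr_sumr cE v0E; ring.
  by move=> i _; rewrite A1w; ring.
have A2l x i : A2 x (lift ord0 i) = A1 x (lift ord0 i).
  by rewrite A2E [_ == ord0]eq_sym (negbTE (neq_lift _ _)) mul0r addr0.
have A2x x : (M %| A2 (lift ord0 x) ord0)%Z.
  rewrite A2E A1x rpredD // dvdz_mull //; apply: rpred_sum => i _.
  by rewrite dvdz_mull // dvdz_mulr.
have [A3 [dA3 A30 A3E hA3]] := add_first_column (fun i => - w1 i) A2.
have A30l i : A3 ord0 (lift ord0 i) = 0.
  by rewrite A3E A2l A1w A200; ring.
have colE (i : 'I_n.+2) : exists z, A3 (lift ord0 i) ord0 = M * z.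
  by rewrite A30; have /dvdzP[z ->] := A2x i; exists z; rewrite mulrC.
have [z zE] := choice colE.
have [B [dB B0 BE hB]] := add_first_column (fun i => - z i) A3^T.
pose A' : 'M[int]_n.+2 := \matrix_(i, j) A3 (lift ord0 i) (lift ord0 j).
have BT : B^T = lift0_mx A'.
  have [Lij Li0 L0j L00] := lift0_mxE A'; apply/matrixP => x y; rewrite [LHS]mxE.
  case: (unliftP ord0 x) => [x'|] ->; case: (unliftP ord0 y) => [y'|] ->.
  - by rewrite Lij BE !mxE A30l mul0r addr0.
  - by rewrite Li0 BE !mxE zE A30 A200; ring.
  - by rewrite L0j B0 mxE A30l.
  - by rewrite L00 B0 mxE A30 A200.
(* Every change to the remaining block is a multiplier in [M] times a first column entry in [M]; so
   the congruences pass to the smaller matrix. *)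
have A'E i j : (M ^+ 2 %| A' i j - A (lift ord0 i) (lift ord0 j))%Z.
  rewrite mxE A3E A2l A1E.
  have -> : forall p q r s : int, p + q * (M * t) * r + s - p = q * (M * t) * r + s.
    by move=> p q r s; ring.
  rewrite rpredD //.
    by rewrite dvdz_mulr // expr2 dvdz_mul // dvdz_mulr.
  by rewrite expr2 dvdz_mul // dvdz_mulr.
have MM2 : (M %| M ^+ 2)%Z by rewrite expr2 dvdz_mulr.
exists A'; split.
  split.
  - have : \det B^T = 1 by rewrite det_tr dB det_tr dA3 dA2 det_mulmx dA det_elem_mx ?mul1r // neq_lift.
    rewrite BT; have := @det_ublock _ 1 n.+2 1 0 A'.
    by rewrite det1 mul1r => <-.
  - move=> i j ij; rewrite -(subrK (A (lift ord0 i) (lift ord0 j)) (A' i j)) rpredD //.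
      exact: dvdz_trans (A'E i j).
    by apply: offA; rewrite (inj_eq lift_inj).
  - move=> i i_lt; rewrite -(subrKA (A (lift ord0 i) (lift ord0 i))) rpredD //.
    by apply: diagA; rewrite lift0.
move=> k; rewrite -BT => /elementary_tr; rewrite trmxK => /hB /elementary_tr; rewrite trmxK.
move=> /hA3 /hA2 h; rewrite (_ : _ + _ = (k + n.+2 + n.+2 + n.+2).+1)%N; last by lia.
exact: elementary_mulr (neq_lift _ _) h.
Qed.

Lemma det2 (A : 'M[int]_2) :
  \det A = A ord0 ord0 * A ord_max ord_max - A ord0 ord_max * A ord_max ord0.
Proof.
rewrite (expand_det_row _ ord0) !big_ord_recl big_ord0 /cofactor !det_mx11 !mxE.
have -> : lift ord0 (ord0 : 'I_1) = ord_max :> 'I_2 by exact: val_inj.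
have -> : lift ord_max (0 : 'I_1) = ord0 :> 'I_2 by exact: val_inj.
by rewrite /= expr0 expr1; ring.
Qed.

Lemma quasi_congruent_bounded n (A : 'M[int]_n.+3) : (0 < m)%N -> quasi_congruent A ->
  elementary (184 + 2 * n.+3 ^ 2) A.
Proof.
move=> m_gt0; elim: n A => [|n IHn] A /quasi_congruent_step [A' [qA' hA']].
  have : elementary 184 (lift0_mx A' : 'M_3); last first.
    by move/hA'; apply: prod_of_at_most_le.
  case: qA' => dA' offA' diagA'.
  have /dvdzP[a1 a1E] := diagA' ord0 isT.
  have /dvdzP[b bE] : (M %| A' ord0 ord_max)%Z by apply: offA'.
  have /dvdzP[c cE] : (M %| A' ord_max ord0)%Z by apply: offA'.
  have aE : A' ord0 ord0 = 1 + M ^+ 2 * a1 by rewrite mulrC -a1E addrC subrK.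
  have det' : A' ord0 ord0 * A' ord_max ord_max - M ^+ 2 * b * c = 1.
    by rewrite -[RHS]dA' det2 bE cE; ring.
  have ab : coprimez (A' ord0 ord0) b.
    by apply: (@Bezout_coprimez (A' ord_max ord_max) (- M ^+ 2 * c)); rewrite -[RHS]det'; ring.
  have := short_symbol_all m_gt0 aE ab (i := lift ord0 ord0) (j := ord_max) isT det'.
  congr (prod_of_at_most _ _ _).
  have [Lij Li0 L0j L00] := lift0_mxE A'; apply/matrixP => x y.
  have -> : (ord_max : 'I_3) = lift ord0 ord_max by exact: val_inj.
  case: (unliftP ord0 x) => [x'|] ->; case: (unliftP ord0 y) => [y'|] ->;
    rewrite ?Lij ?Li0 ?L0j ?L00 !mxE //.
    rewrite !(inj_eq lift_inj) [M * b]mulrC [M * c]mulrC -bE -cE.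
    by move: x' y'; do 2!(case=> [[|[|?]] ?] //); congr (A' _ _); exact: val_inj.
  by case: x' => [[|[|?]] ?].
have h := hA' _ (elementary_lift (IHn _ qA')).
(* Passing from size [s] to [s - 1] costs [3 (s - 1) + 1], less than the difference [2 (2 s - 1)] of
   the bounds. *)
by apply: prod_of_at_most_le h; lia.
Qed.

End Reduction.

(** * Congruence subgroups and conjugated generators *)

Section CongruenceSubgroups.
Local Open Scope ring_scope.
Variable m : nat.
Local Notation M := (m%:Z).

Definition diag_congruent n (A : 'M[int]_n) :=
  (forall i j, i != j -> (M %| A i j)%Z) /\ (forall i, (M ^+ 2 %| A i i - 1)%Z).

Lemma diag_congruent_mul n (A B : 'M[int]_n) :
  diag_congruent A -> diag_congruent B -> diag_congruent (A *m B).
Proof.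
have M2 : (M %| M ^+ 2)%Z by rewrite expr2 dvdz_mulr.
move=> [oA dA] [oB dB]; split=> [i j ij|i]; rewrite mxE (bigD1 i) //=.
  rewrite rpredD //; first by rewrite dvdz_mull ?oB.
  by apply: rpred_sum => k ki; rewrite dvdz_mulr // oA // eq_sym.
rewrite addrAC rpredD //.
  have -> : A i i * B i i - 1 = (A i i - 1) * B i i + (B i i - 1) by ring.
  by rewrite rpredD // dvdz_mulr.
by apply: rpred_sum => k ki; rewrite expr2 dvdz_mul ?oA ?oB // eq_sym.
Qed.

Lemma diag_congruent1 n : diag_congruent (1%:M : 'M[int]_n).
Proof. by split=> [i j ij|i]; rewrite mxE ?(negbTE ij) ?eqxx ?subrr. Qed.

Lemma diag_congruent_elem n (i j : 'I_n) r : i != j -> (M %| r)%Z ->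
  diag_congruent (elem_mx i j r).
Proof.
move=> ij mr; split=> [x y xy|x]; rewrite !mxE.
  by rewrite (negbTE xy) add0r dvdz_mulr.
rewrite eqxx; case: eqP => [->|_]; rewrite ?(negbTE ij) ?mulr0 ?addr0 ?subrr //.
Qed.

(** The inverse and its congruences are carried through the induction, which settles the [gen_inv]
    case. *)
Lemma EL_diag_congruent n (A : 'M[int]_n) : EL m A ->
  exists B, [/\ A *m B = 1%:M, \det A = 1, diag_congruent A & diag_congruent B].
Proof.
elim=> {A} [A [i [j [r [ij mr ->]]]]||A B _ [A' [AA dA cA cA']] _ [B' [BB dB cB cB']]|A _ [A' [AA dA cA cA']]].
- exists (elem_mx i j (- r)); split; first exact: elem_mxN.
  + exact: det_elem_mx.
  + exact: diag_congruent_elem.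
  + by apply: diag_congruent_elem; rewrite ?rpredN.
- by exists 1%:M; rewrite mulmx1 det1; split=> //; exact: diag_congruent1.
- exists (B' *m A'); split; try exact: diag_congruent_mul.
  + by rewrite mulmxA -(mulmxA A) BB mulmx1.
  + by rewrite det_mulmx dA dB mulr1.
- have uA : A \in unitmx by rewrite unitmxE dA unitr1.
  have -> : invmx A = A' by rewrite -[A']mul1mx -(mulVmx uA) -mulmxA AA mulmx1.
  exists A; split=> //; first exact: mulmx1C.
  by move: (congr1 determinant AA); rewrite det_mulmx dA det1 mul1r.
Qed.

Lemma y_mxE n (i j : 'I_n) : y_mx n i j = (i == j)%:R - (i == j.+1 :> nat)%:R.
Proof.
rewrite /y_mx !mxE summxE; congr (_ - _).
rewrite (eq_bigr (fun p : 'I_n * 'I_n => if p == (i, j) then 1 else 0)) => [|[a b] _]; last first.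
  by rewrite mxE xpair_eqE [i == a]eq_sym [j == b]eq_sym; case: andP.
rewrite -big_mkcondr /=; case: eqP => ij.
  rewrite (big_pred1 (i, j)) // => p /=.
  by case: (p =P (i, j)) => [->|]; rewrite ?andbF //= ij eqxx.
by rewrite big_pred0 // => p /=; apply/negP => /andP[/eqP h /eqP E]; rewrite E /= in h.
Qed.

Lemma y_mx_unit n : y_mx n \in unitmx.
Proof.
rewrite unitmxE det_trig; last first.
  apply/is_trig_mxP => i j ij; rewrite y_mxE -val_eqE (ltn_eqF ij).
  by rewrite (_ : (i == j.+1 :> nat) = false) ?subrr //; apply/negbTE; lia.
rewrite big1 ?unitr1 // => i _; rewrite y_mxE eqxx (_ : (i == i.+1 :> nat) = false) ?subr0 //.
by apply/negbTE; lia.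
Qed.

(* Closed form of the conjugate by [y]: its column factor [y^-1 e_k] has entry 1 at
   the indices [>= k] and 0 elsewhere. *)
Definition conj_elem n (k k' : 'I_n) (r : int) : 'M[int]_n :=
  \matrix_(i, j) ((i == j)%:R + r * (k <= i)%:R * y_mx n k' j).

Lemma conj_elemE n (k k' : 'I_n) r :
  conj_elem k k' r = invmx (y_mx n) *m elem_mx k k' r *m y_mx n.
Proof.
have -> : conj_elem k k' r = 1%:M + r *: ((\col_i (k <= i)%:R) *m row k' (y_mx n)).
  apply/matrixP => i j; rewrite !mxE big_ord1 !mxE; ring.
rewrite -mulmxA; apply: (canRL (mulKmx (y_mx_unit n))).
rewrite mulmxDr mulmx1 (mulmxDl 1%:M (r *: delta_mx k k')) mul1mx -scalemxAl -scalemxAr; congr (_ + _ *: _).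
rewrite rowE mulmxA mulmxA; congr (_ *m _).
rewrite mulmxA; apply/matrixP => i j; rewrite [LHS]mxE big_ord1 [RHS]mxE [X in X * _]mxE [X in _ * X]mxE eqxx /=.
(* Multiplication by [y] takes differences of consecutive entries, so a step at [k] becomes the unit
   vector at [k]. *)
suff -> : \sum_j0 y_mx n i j0 * (\col_i0 (k <= i0)%:R) j0 0 = (i == k)%:R.
  by rewrite -natrM mulnb.
rewrite (eq_bigr (fun j0 : 'I_n => (if i == j0 then (k <= j0)%:R else 0)
    - (if (i == j0.+1 :> nat) then (k <= j0)%:R else 0))) => [|l _]; last first.
  by rewrite y_mxE !mxE; case: eqP; case: eqP => _ _ /=; ring.
rewrite sumrB -big_mkcond /= (big_pred1 i) => [|l]; last by rewrite eq_sym.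
rewrite -big_mkcond /=; case: (posnP i) => [i0|i_gt0].
  rewrite big_pred0 => [|l]; last by rewrite i0.
  by rewrite subr0 i0 leqn0 -val_eqE /= i0 eq_sym.
have i1 : (i.-1 < n)%N by apply: leq_ltn_trans (ltn_ord i); lia.
rewrite (big_pred1 (Ordinal i1)) => [|l]; last first.
  by rewrite /= -val_eqE /=; apply/eqP/eqP; lia.
rewrite /= -val_eqE /=; have [ik|ki|ik] := ltngtP (i : nat) k.
- by rewrite (_ : (k <= i.-1)%N = false) ?subrr //; apply/negbTE; lia.
- by rewrite (_ : (k <= i.-1)%N) ?subrr //; lia.
- by rewrite (_ : (k <= i.-1)%N = false) ?subr0 //; apply/negbTE; lia.
Qed.

Lemma conj_elem_Xc n (k k' : 'I_n) r : k != k' -> (M %| r)%Z -> Xc_set m (conj_elem k k' r).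
Proof.
by move=> kk' mr; right; exists (elem_mx k k' r); rewrite ?conj_elemE //; exists k, k', r.
Qed.

Lemma conj_elem_inv n (k k' : 'I_n) r : k != k' ->
  conj_elem k k' r *m conj_elem k k' (- r) = 1%:M.
Proof.
move=> kk'; rewrite !conj_elemE.
rewrite !mulmxA -(mulmxA _ (y_mx n)) mulmxV ?y_mx_unit // mulmx1.
by rewrite -(mulmxA (invmx _)) elem_mxN // mulmx1 mulVmx ?y_mx_unit.
Qed.

Lemma GammaP n (A : 'M[int]_n) : Gamma m A <->
  \det A = 1 /\ forall i j, (M %| A i j - (i == j)%:R)%Z.
Proof.
split=> [[dA h]|[dA h]]; split=> // i j; have := h i j; rewrite ?mxE.
  by move/eqP; rewrite eqz_mod_dvd.
by rewrite -eqz_mod_dvd => /eqP.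
Qed.

Lemma Gamma_quasi n (A : 'M[int]_n) : Gamma m A ->
  (forall i : 'I_n, (i.+1 < n)%N -> (M ^+ 2 %| A i i - 1)%Z) -> quasi_congruent m A.
Proof.
move=> /GammaP[dA hA] diagA; split=> // i j ij.
by have := hA i j; rewrite (negbTE ij) subr0.
Qed.

(** Products from [X_set] have diagonal 1 modulo [M ^ 2], hence the need for conjugates. One of them
    changes the entry at [o] by [- M * r * S o] with [S o = 1] modulo [M], cancelling its error
    [M * r] modulo [M ^ 2]. Row [o'] of [y] vanishes before column [o], so earlier diagonal entries
    stay. *)
Lemma Gamma_bounded n K :
  (forall A, quasi_congruent m A -> prod_of_at_most K (@X_set n.+1 m) A) ->
  forall A : 'M[int]_n.+1, Gamma m A -> prod_of_at_most (K + n) (@Xc_set n.+1 m) A.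
Proof.
move=> hK A GA.
suff gen l k (B : 'M[int]_n.+1) : (k + l = n)%N -> Gamma m B ->
    (forall i : 'I_n.+1, (i < k)%N -> (M ^+ 2 %| B i i - 1)%Z) ->
    prod_of_at_most (K + l) (@Xc_set n.+1 m) B.
  exact: (gen n 0%N A).
elim: l k B => [|l IHl] k B kl GB dB.
  rewrite addn0; apply: prod_of_at_most_sub (hK B _); first by move=> C; left.
  by apply: Gamma_quasi => // i i_lt; apply: dB; lia.
have k_lt : (k < n.+1)%N by lia. have k1_lt : (k.+1 < n.+1)%N by lia.
pose o := Ordinal k_lt; pose o' := Ordinal k1_lt.
have oo' : o != o' by rewrite -val_eqE /= ltn_eqF.
have [detB hB] := (GammaP B).1 GB.
have /dvdzP[r rE] : (M %| B o o - 1)%Z by have := hB o o; rewrite eqxx.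
pose C := B *m conj_elem o o' (M * r).
pose S i := \sum_(j < n.+1) B i j * (k <= j)%:R.
have CE i j : C i j = B i j + M * r * S i * y_mx n.+1 o' j.
  rewrite /C mxE (eq_bigr (fun l => (if l == j then B i l else 0)
     + M * r * y_mx n.+1 o' j * (B i l * (k <= l)%:R))) => [|l' _].
    rewrite big_split /= -big_mkcond big_pred1_eq -mulr_sumr; congr (_ + _).
    by rewrite /S; ring.
  by rewrite mxE /=; case: eqP => _ /=; ring.
have So : (M %| S o - 1)%Z.
  rewrite /S (bigD1 o) //= leqnn mulr1 addrAC rpredD //; first by have := hB o o; rewrite eqxx.
  apply: rpred_sum => j jo; rewrite dvdz_mulr //.
  by have := hB o j; rewrite eq_sym (negbTE jo) subr0.
have yo : y_mx n.+1 o' o = -1.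
  by rewrite y_mxE [o' == o]eq_sym (negbTE oo') /= eqxx.
have ylt (i : 'I_n.+1) : (i < k)%N -> y_mx n.+1 o' i = 0.
  move=> ik; have e1 : (o' == i) = false by apply/negbTE; rewrite -val_eqE neq_ltn /= (leqW ik) orbT.
  have e2 : (o' == i.+1 :> nat) = false by apply/negbTE; rewrite neq_ltn /= !ltnS ik orbT.
  by rewrite y_mxE e1 e2 subrr.
have GC : Gamma m C.
  apply/GammaP; split.
    rewrite det_mulmx detB mul1r conj_elemE !det_mulmx det_elem_mx // mulr1 -det_mulmx.
    by rewrite mulVmx ?y_mx_unit // det1.
  by move=> i j; rewrite CE addrAC rpredD // -!mulrA dvdz_mulr.
have dC (i : 'I_n.+1) : (i < k.+1)%N -> (M ^+ 2 %| C i i - 1)%Z.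
  rewrite ltnS leq_eqVlt => /predU1P[ik|ik]; last by rewrite CE ylt // mulr0 addr0 dB.
  have -> : i = o by exact: val_inj.
  rewrite CE yo.
  have -> : B o o + M * r * S o * -1 - 1 = r * M - M * r * S o by rewrite -rE; ring.
  have -> : r * M - M * r * S o = - r * (M * (S o - 1)) by ring.
  by rewrite dvdz_mull // expr2 dvdz_mul.
have -> : B = C *m conj_elem o o' (- (M * r)).
  by rewrite /C -mulmxA conj_elem_inv // mulmx1.
rewrite (_ : K + l.+1 = K + l + 1)%N; last by lia.
apply: prod_of_at_most_mul.
  by apply: IHl GC dC; lia.
by apply: prod_of_at_most_base; apply: conj_elem_Xc => //; rewrite rpredN dvdz_mulr.
Qed.

End CongruenceSubgroups.

Theorem theorem1p6 :
  exists upsilon : nat -> nat,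
    (forall n : nat, 3 <= n -> 0 < upsilon n) /\
    (forall n m : nat, 3 <= n -> 0 < m ->
       (forall A : 'M[int]_n, EL m A ->
          prod_of_at_most (upsilon n) (@X_set n m) A) /\
       (forall A : 'M[int]_n, Gamma m A ->
          prod_of_at_most (2 * upsilon 3 + n ^ 3) (@Xc_set n m) A)).
Proof.
exists (fun n => 184 + 2 * n ^ 2); split=> [//|n m n3 m_gt0].
have bound (A : 'M[int]_n) : quasi_congruent m A ->
    prod_of_at_most (184 + 2 * n ^ 2) (@X_set n m) A.
  case: n n3 A => [|[|[|n]]] // _ A; exact: quasi_congruent_bounded.
split=> A.
  move=> /EL_diag_congruent[B [_ dA [oA cA] _]]; apply: bound; split=> // i _; exact: cA.
case: n n3 bound A => [|n] // n3 bound A /(Gamma_bounded bound).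
(* For size [s] this asks [184 + 2 s ^ 2 + (s - 1) <= 2 * 202 + s ^ 3], which holds as
   [s ^ 3 >= 3 s ^ 2]. *)
apply: prod_of_at_most_le.
rewrite !expnS !expn0; nia.
Qed.
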